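(* Let $k$, $G$, $V$ and $S=S(V)$ be as in the context, and let $\tilde\kappa: V\wedge V\to(k\oplus V)\otimes kG$ be a linear map. The quotient algebra $\mathcal{H}_{\tilde\kappa}$ is a Drinfeld orbifold algebra if and only if $\mathcal{H}_{\tilde\kappa}$ is isomorphic to $\mathcal{H}_\kappa$ as a filtered algebra for some parameter $\kappa: V\wedge V\to(k\oplus V)\otimes kG$ satisfying (i) $\kappa$ is $G$-invariant; (ii) the linear part $\kappa^L$ of $\kappa$ is a cocycle in $H^\bullet$ (that is, $\kappa^L\in H^2$); (iii) the Gerstenhaber square bracket of the linear part of $\kappa$ satisfies $[\kappa^L,\kappa^L]=2d^*(\kappa^C)$ as cochains; (iv) the bracket of the linear with the constant part of $\kappa$ is zero: $[\kappa^C,\kappa^L]=0$ as a cochain.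
   Context: Setting: $k$ is a field of characteristic not $2$; $G$ is a finite group acting linearly (not necessarily faithfully) on a finite-dimensional $k$-vector space $V$; $|G|$ is invertible in $k$; and $k$ contains all eigenvalues of the actions of elements of $G$ on $V$. Write ${}^g v$ for the action, extended to $S=S(V)$ and $T(V)$ by automorphisms. For $A=S$ or $T(V)$, $A\# G=A\otimes kG$ with multiplication $(a g)(b h)=a\,({}^g b)\,gh$. Algebras. For a parameter (linear map) $\kappa:V\wedge V\to(k\oplus V)\otimes kG$, write $\kappa=\kappa^C+\kappa^L$ with constant part $\kappa^C:V\wedge V\to kG$ and linear part $\kappa^L: V\wedge V\to V\otimes kG$, and set $\mathcal{H}_\kappa=T(V)\# G/(vw-wv-\kappa(v,w)\mid v,w\in V)$, filtered by giving $v\in V$ degree $1$ and $g\in G$ degree $0$. $\mathcal{H}_\kappa$ is a Drinfeld orbifold algebra when its associated graded algebra is isomorphic (as a graded algebra) to $S\# G$ (the PBW condition). $\kappa$ is $G$-invariant if ${}^h\big(\kappa({}^{h^{-1}}v,{}^{h^{-1}}w)\big)=\kappa(v,w)$ for all $h\in G$, $v,w\in V$, where $G$ acts on $(k\oplus V)\otimes kG$ by ${}^h(ug)=({}^hu)\,hgh^{-1}$. Cochains. $C^p=\bigoplus_{g\in G}C^p_g$ with $C^p_g=S g\otimes\bigwedge^p V^*$, identified with $\mathrm{Hom}_k(\bigwedge^pV,Sg)$; write $\alpha=\sum_g\alpha_g\,g$ with $\alpha_g:\bigwedge^pV\to S$. (This is the cochain complex $\mathrm{Hom}_{S^e}(K_\bullet(S),S\#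 G)$, $S^e=S\otimes S^{op}$, for the Koszul resolution $K_p(S)=S^e\otimes\bigwedge^pV$.) Its differential is $(d^*\alpha)(v_1\wedge\cdots\wedge v_{p+1})=\sum_i(-1)^{i+1}\big(v_i\,\alpha(\cdots\hat v_i\cdots)-\alpha(\cdots\hat v_i\cdots)\,v_i\big)$ in $S\# G$. Cocycles are taken with respect to $d^*$. A cochain is constant (resp. linear) if all its polynomial factors in $S$ are homogeneous of degree $0$ (resp. $1$). The maps $\kappa,\kappa^L,\kappa^C$ are regarded as elements of $C^2$; $\kappa^L$ is linear and $\kappa^C$ is constant. Representatives. $V^g$ is the $g$-fixed subspace and $(V^g)^\perp$ its $g$-stable complement (the sum of the eigenspaces of $g$ with eigenvalue $\ne1$). Set $$H^p=\bigoplus_{g\in G}S(V^g)\,g\otimes\textstyle\bigwedge^{p-\mathrm{codim}V^g}(V^g)^*\otimes\bigwedge^{\mathrm{codim}V^g}((V^g)^\perp)^*\subset C^p,$$ with negative exterior powers zero. All elements of $H^p$ are cocycles and $H^\bullet\cong \mathrm{HH}^\bullet(S,S\# G)$. Cochain bracket. The bracket in (iii), (iv) is the symmetric bilinear map from pairs of $2$-cochains of polynomial degree at most $1$ (sums of constant and linear cochains) to $3$-cochains determined by ($\mathrm{Alt}_3$ the cyclic group of order $3$ in $\mathrm{Sym}_3$): for $\alpha,\beta$ linear, $$[\alpha,\beta](v_1,v_2,v_3)=\sum_{g,h\in G,\ \sigma\in\mathrm{Alt}_3}\Big[\alpha_{gh^{-1}}\big(\beta_h(v_{\sigma(1)}\wedge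 v_{\sigma(2)})\wedge v_{\sigma(3)}\big)+\beta_{gh^{-1}}\big(\alpha_h(v_{\sigma(1)}\wedge v_{\sigma(2)})\wedge v_{\sigma(3)}\big)\Big]g;$$ for $\alpha$ constant and $\beta$ linear, $$[\alpha,\beta](v_1,v_2,v_3)=\sum_{g,h\in G,\ \sigma\in\mathrm{Alt}_3}\alpha_{gh^{-1}}\big(\beta_h(v_{\sigma(1)}\wedge v_{\sigma(2)})\wedge v_{\sigma(3)}\big)\,g;$$ and $[\alpha,\beta]=0$ for $\alpha,\beta$ both constant. *)

(* Defs.v *)
From HB Require Import structures.
From mathcomp Require Import all_boot all_order all_fingroup all_algebra.
From mathcomp Require Import all_solvable.
From mathcomp Require Import generic_quotient.
From mathcomp Require Import boolp.
From mathcomp Require monalg.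
Import -(notations) monalg.
From mathcomp Require Import mpoly.

Set Implicit Arguments.
Unset Strict Implicit.
Unset Printing Implicit Defensive.

Import GRing.Theory.
Local Open Scope ring_scope.
Local Open Scope quotient_scope.

(** * Submodules, quotient modules, quotient algebras *)

Section SubModule.
Context (k : pzRingType) (M : lmodType k) (N : submodClosed M).

Record subm := SubM { sm_val :> M; sm_valP : sm_val \in N }.

HB.instance Definition _ := [isSub for sm_val].
HB.instance Definition _ := [Choice of subm by <:].
HB.instance Definition _ := [SubChoice_isSubLmodule of subm by <:].

End SubModule.

Section QuotModule.
Context (k : pzRingType) (M : lmodType k) (N : submodClosed M).

Lemma submodN x : x \in N -> - x \in N.
Proof. by move=> Nx; rewrite -scaleN1r rpredZ. Qed.

Definition qm_eq (x y : M) : bool := x - y \in N.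

Lemma qm_eq_equiv : equiv_class_of qm_eq.
Proof.
split=> [x | x y | y x z]; rewrite /qm_eq.
- by rewrite subrr rpred0.
- by apply/idP/idP => /submodN; rewrite opprB.
- by move=> xy yz; rewrite -(subrKA y) rpredD.
Qed.

Canonical qm_equiv := EquivRelPack qm_eq_equiv.

Definition quotmod := {eq_quot qm_equiv}.
HB.instance Definition _ := Choice.on quotmod.
HB.instance Definition _ := EqQuotient.on quotmod.

Definition qm_pi (x : M) : quotmod := \pi_quotmod x.

Lemma qm_piE x y : (qm_pi x = qm_pi y) <-> (x - y \in N).
Proof. by split=> [/eqmodP | h]; [|apply/eqmodP]. Qed.

Lemma qm_reprK (a : quotmod) : qm_pi (repr a) = a.
Proof. exact: reprK. Qed.

Definition qm_add (a b : quotmod) := qm_pi (repr a + repr b).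
Definition qm_opp (a : quotmod) := qm_pi (- repr a).
Definition qm_scale (c : k) (a : quotmod) := qm_pi (c *: repr a).

Lemma qm_repr_pi x : repr (qm_pi x) - x \in N.
Proof. by apply/qm_piE; rewrite qm_reprK. Qed.

Lemma qm_addE x y : qm_add (qm_pi x) (qm_pi y) = qm_pi (x + y).
Proof. by apply/qm_piE; rewrite opprD addrACA rpredD ?qm_repr_pi. Qed.

Lemma qm_oppE x : qm_opp (qm_pi x) = qm_pi (- x).
Proof. by apply/qm_piE; rewrite -opprD submodN ?qm_repr_pi. Qed.

Lemma qm_scaleE c x : qm_scale c (qm_pi x) = qm_pi (c *: x).
Proof. by apply/qm_piE; rewrite -scalerBr rpredZ ?qm_repr_pi. Qed.

Lemma qm_ind (P : quotmod -> Prop) : (forall x, P (qm_pi x)) -> forall a, P a.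
Proof. by move=> h a; rewrite -[a]qm_reprK. Qed.

Lemma qm_addA : associative qm_add.
Proof.
by elim/qm_ind=> x; elim/qm_ind=> y; elim/qm_ind=> z; rewrite !qm_addE addrA.
Qed.

Lemma qm_addC : commutative qm_add.
Proof. by elim/qm_ind=> x; elim/qm_ind=> y; rewrite !qm_addE addrC. Qed.

Lemma qm_add0 : left_id (qm_pi 0) qm_add.
Proof. by elim/qm_ind=> x; rewrite qm_addE add0r. Qed.

Lemma qm_addN : left_inverse (qm_pi 0) qm_opp qm_add.
Proof. by elim/qm_ind=> x; rewrite qm_oppE qm_addE addNr. Qed.

HB.instance Definition _ :=
  GRing.isZmodule.Build quotmod qm_addA qm_addC qm_add0 qm_addN.

Lemma qm_scaleA a b x : qm_scale a (qm_scale b x) = qm_scale (a * b) x.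
Proof. by elim/qm_ind: x => x; rewrite !qm_scaleE scalerA. Qed.

Lemma qm_scale1 : left_id 1 qm_scale.
Proof. by elim/qm_ind=> x; rewrite qm_scaleE scale1r. Qed.

Lemma qm_scaleDr : right_distributive qm_scale +%R.
Proof.
move=> c; elim/qm_ind=> x; elim/qm_ind=> y.
by rewrite [X in qm_scale c X]qm_addE !qm_scaleE scalerDr -qm_addE.
Qed.

Lemma qm_scaleDl v : {morph qm_scale^~ v : a b / a + b}.
Proof.
by move=> a b; elim/qm_ind: v => x; rewrite !qm_scaleE scalerDl -qm_addE.
Qed.

HB.instance Definition _ := GRing.Zmodule_isLmodule.Build k quotmod
  qm_scaleA qm_scale1 qm_scaleDr qm_scaleDl.

End QuotModule.

(* Unital associative k-algebras, possibly zero: the quotient of a non-zero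
   algebra by an arbitrary ideal need not be an algType (whose unit is non-zero
   by definition). *)
Record kalg (k : pzRingType) := KAlg {
  ka_sort :> lmodType k;
  ka1 : ka_sort;
  kaM : ka_sort -> ka_sort -> ka_sort;
  kaMA : associative kaM;
  ka1M : left_id ka1 kaM;
  kaM1 : right_id ka1 kaM;
  kaMl : forall y, linear (kaM^~ y);
  kaMr : forall x, linear (kaM x)
}.

Section QuotAlgebra.
Context (k : comNzRingType) (A : algType k) (X : A -> Prop).

(* The two-sided ideal generated by X. *)
Definition ideal_gen : {pred A} := fun x => `[< exists s : seq (A * A * A),
  (forall t, t \in s -> X t.1.2) /\ x = \sum_(t <- s) t.1.1 * t.1.2 * t.2 >].

Lemma ideal_genMl a x : x \in ideal_gen -> a * x \in ideal_gen.
Proof.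
move=> /asboolP [s [Xs ->]]; apply/asboolP.
exists [seq (a * t.1.1, t.1.2, t.2) | t <- s]; split.
  by move=> _ /mapP [t /Xs Xt ->].
by rewrite big_map mulr_sumr; apply: eq_bigr => t _ /=; rewrite !mulrA.
Qed.

Lemma ideal_genMr a x : x \in ideal_gen -> x * a \in ideal_gen.
Proof.
move=> /asboolP [s [Xs ->]]; apply/asboolP.
exists [seq (t.1.1, t.1.2, t.2 * a) | t <- s]; split.
  by move=> _ /mapP [t /Xs Xt ->].
by rewrite big_map mulr_suml; apply: eq_bigr => t _ /=; rewrite !mulrA.
Qed.

Lemma ideal_gen_submod : submod_closed ideal_gen.
Proof.
split.
  by apply/asboolP; exists [::]; rewrite big_nil.
move=> c x y /(ideal_genMl c%:A) /asboolP [s [Xs hx]] /asboolP [t [Xt hy]].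
apply/asboolP; exists (s ++ t); split.
  by move=> u; rewrite mem_cat => /orP [/Xs|/Xt].
by rewrite big_cat /= -hx -hy mulr_algl.
Qed.

HB.instance Definition _ :=
  GRing.isSubmodClosed.Build k A ideal_gen ideal_gen_submod.

Definition qa_mul (a b : quotmod ideal_gen) : quotmod ideal_gen :=
  qm_pi ideal_gen (repr a * repr b).

Lemma qa_mulE x y :
  qa_mul (qm_pi ideal_gen x) (qm_pi ideal_gen y) = qm_pi ideal_gen (x * y).
Proof.
rewrite /qa_mul; set x' := repr _; set y' := repr _.
have hx : x' - x \in ideal_gen by apply: qm_repr_pi.
have hy : y' - y \in ideal_gen by apply: qm_repr_pi.
apply/qm_piE; rewrite -(subrKA (x * y')) -mulrBl -mulrBr.
by apply: rpredD; [apply: ideal_genMr | apply: ideal_genMl].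
Qed.

Lemma qa_mulA : associative qa_mul.
Proof.
by elim/qm_ind=> x; elim/qm_ind=> y; elim/qm_ind=> z; rewrite !qa_mulE mulrA.
Qed.

Lemma qa_mul1 : left_id (qm_pi ideal_gen 1) qa_mul.
Proof. by elim/qm_ind=> x; rewrite qa_mulE mul1r. Qed.

Lemma qa_1mul : right_id (qm_pi ideal_gen 1) qa_mul.
Proof. by elim/qm_ind=> x; rewrite qa_mulE mulr1. Qed.

Lemma qm_piD (x y : A) :
  qm_pi ideal_gen x + qm_pi ideal_gen y = qm_pi ideal_gen (x + y).
Proof. exact: qm_addE. Qed.

Lemma qm_piZ c (x : A) : c *: qm_pi ideal_gen x = qm_pi ideal_gen (c *: x).
Proof. exact: qm_scaleE. Qed.

Lemma qa_mull y : linear (qa_mul^~ y).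
Proof.
elim/qm_ind: y => z c x y; elim/qm_ind: x => x; elim/qm_ind: y => y.
by rewrite qm_piZ qm_piD !qa_mulE mulrDl -scalerAl qm_piZ qm_piD.
Qed.

Lemma qa_mulr x : linear (qa_mul x).
Proof.
elim/qm_ind: x => z c x y; elim/qm_ind: x => x; elim/qm_ind: y => y.
by rewrite qm_piZ qm_piD !qa_mulE mulrDr -scalerAr qm_piZ qm_piD.
Qed.

Definition quotalg : kalg k := KAlg qa_mulA qa_mul1 qa_1mul qa_mull qa_mulr.

End QuotAlgebra.

(** * Filtered and graded algebras *)

Record filtalg (k : pzRingType) := FiltAlg {
  fa_alg :> kalg k;
  fil : nat -> submodClosed fa_alg;
  fil_mono : forall m, {subset fil m <= fil m.+1};
  fil1 : ka1 fa_alg \in fil 0%N;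
  filM : forall m n x y,
    x \in fil m -> y \in fil n -> kaM x y \in fil (m + n)%N
}.

Definition filtered_iso (k : pzRingType) (A B : filtalg k) : Prop :=
  exists phi : {linear A -> B},
    [/\ bijective phi,
        phi (ka1 A) = ka1 B,
        {morph phi : x y / kaM x y}
      & forall m x, (phi x \in fil B m) = (x \in fil A m)].

(* A graded algebra given by its homogeneous components. *)
Record gralg (k : pzRingType) := GrAlg {
  gcomp :> nat -> lmodType k;
  gone : gcomp 0%N;
  gmul : forall m n, gcomp m -> gcomp n -> gcomp (m + n)%N
}.

Definition graded_iso (k : pzRingType) (A B : gralg k) : Prop :=
  exists phi : forall m, {linear A m -> B m},
    [/\ forall m, bijective (phi m),
        phi 0%N (gone A) = gone B
      & forall m n (a : A m) (b : A n),
          phi (m + n)%N (gmul a b) = gmul (phi m a) (phi n b)].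

Section AssociatedGraded.
Context (k : pzRingType) (A : filtalg k).

(* F_{m-1} inside F_m, with F_{-1} = 0. *)
Definition fil_pred m : {pred subm (fil A m)} :=
  match m return {pred subm (fil A m)} with
  | 0%N => fun x => val x == 0
  | m'.+1 => fun x => val x \in fil A m'
  end.

Lemma fil_pred_submod m : submod_closed (@fil_pred m).
Proof.
case: m => [|m]; split=> [|c x y]; rewrite !unfold_in /=.
- exact: eqxx.
- by move=> /eqP -> /eqP ->; rewrite scaler0 addr0.
- exact: (rpred0 (fil A m)).
- by move=> hx hy; apply: (rpredD (rpredZ c hx) hy).
Qed.

HB.instance Definition _ m := GRing.isSubmodClosed.Build k (subm (fil A m))
  (@fil_pred m) (@fil_pred_submod m).

Definition gr_comp m : lmodType k := quotmod (@fil_pred m).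

Definition gr_pi m (x : subm (fil A m)) : gr_comp m := qm_pi (@fil_pred m) x.
Definition gr_repr m (a : gr_comp m) : subm (fil A m) :=
  repr (a : quotmod (@fil_pred m)).

Definition fmulm m n (x : subm (fil A m)) (y : subm (fil A n)) :
  subm (fil A (m + n)) := SubM (filM (sm_valP x) (sm_valP y)).

Definition gr_mul m n (a : gr_comp m) (b : gr_comp n) : gr_comp (m + n)%N :=
  gr_pi (fmulm (gr_repr a) (gr_repr b)).

Lemma kaM0l (y : A) : kaM 0 y = 0.
Proof. by have := kaMl y (-1) 0 0; rewrite scaler0 addr0 scaleN1r addNr. Qed.

Lemma kaM0r (x : A) : kaM x 0 = 0.
Proof. by have := kaMr x (-1) 0 0; rewrite scaler0 addr0 scaleN1r addNr. Qed.

Lemma kaMBl (x x' y : A) : kaM (x - x') y = kaM x y - kaM x' y.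
Proof. by rewrite -scaleN1r addrC kaMl scaleN1r addrC. Qed.

Lemma kaMBr (x y y' : A) : kaM x (y - y') = kaM x y - kaM x y'.
Proof. by rewrite -scaleN1r addrC kaMr scaleN1r addrC. Qed.

Lemma fil_predS m p (z : subm (fil A p)) :
  p = m.+1 -> val z \in fil A m -> z \in @fil_pred p.
Proof. by move=> e; rewrite e in z *. Qed.

Lemma fil_pred0 p (z : subm (fil A p)) : val z = 0 -> z \in @fil_pred p.
Proof.
move=> z0; have -> : z = 0 by apply: val_inj.
exact: (fil_pred_submod p).1.
Qed.

Lemma fil_predMl m n (x : subm (fil A m)) (y : subm (fil A n)) :
  x \in @fil_pred m -> fmulm x y \in @fil_pred (m + n)%N.
Proof.
case: m x => [|m] x; rewrite [x \in _]unfold_in /= => h.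
  by apply: fil_pred0; rewrite /= (eqP h) kaM0l.
by apply: (@fil_predS (m + n)) => //=; apply: filM h (sm_valP y).
Qed.

Lemma fil_predMr m n (x : subm (fil A m)) (y : subm (fil A n)) :
  y \in @fil_pred n -> fmulm x y \in @fil_pred (m + n)%N.
Proof.
case: n y => [|n] y; rewrite [y \in _]unfold_in /= => h.
  by apply: fil_pred0; rewrite /= (eqP h) kaM0r.
by apply: (@fil_predS (m + n)) => //=; [rewrite addnS | apply: filM (sm_valP x) h].
Qed.

Lemma gr_mulE m n (x : subm (fil A m)) (y : subm (fil A n)) :
  gr_mul (gr_pi x) (gr_pi y) = gr_pi (fmulm x y).
Proof.
have: gr_repr (gr_pi x) - x \in @fil_pred m by apply: qm_repr_pi.
have: gr_repr (gr_pi y) - y \in @fil_pred n by apply: qm_repr_pi.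
rewrite /gr_mul; move: (gr_repr (gr_pi x)) (gr_repr (gr_pi y)) => x' y' hy hx.
apply/qm_piE; have -> : fmulm x' y' - fmulm x y =
    fmulm (x' - x) y' + fmulm x (y' - y).
  by apply: val_inj => /=; rewrite kaMBl kaMBr subrKA.
by apply: rpredD; [apply: fil_predMl | apply: fil_predMr].
Qed.

Definition gr : gralg k := GrAlg (gr_pi (SubM (fil1 A))) gr_mul.

End AssociatedGraded.

(** * Symmetric and tensor algebras of a finite-dimensional vector space *)

Section SymTens.
Context (k : fieldType).

(* S(V) and T(V) are the (commutative, resp. non-commutative) polynomial
   algebras on the basis vbasis {:V}; symX and tensX are the inclusions of V
   and Sym_map, Tens_map the functorial maps, which do not depend on it. *)
Definition Sym (V : vectType k) : Type := {mpoly k[\dim {:V}]}.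
HB.instance Definition _ (V : vectType k) := GRing.ComAlgebra.on (Sym V).

Definition symX (V : vectType k) (v : V) : Sym V :=
  \sum_(i < \dim {:V}) coord (vbasis {:V}) i v *: 'X_i.

Definition Sym_map (U V : vectType k) (f : 'Hom(U, V)) : Sym U -> Sym V :=
  comp_mpoly [tuple symX (f (vbasis {:U})`_i) | i < \dim {:U}].

HB.instance Definition _ (U V : vectType k) (f : 'Hom(U, V)) := GRing.LRMorphism.copy (@Sym_map U V f)
  (comp_mpoly [tuple symX (f (vbasis {:U})`_i) | i < \dim {:U}]).

Definition Tens (V : vectType k) : Type :=
  monalg.malg (monalg.fmonom 'I_(\dim {:V})) k.
HB.instance Definition _ (V : vectType k) := GRing.Lalgebra.on (Tens V).

Lemma Tens_scalerAr (V : vectType k) (c : k) (x y : Tens V) : c *: (x * y) = x * (c *: y).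
Proof.
have central z : z * monalg.mkmalgU monalg.mone c = c *: z :> Tens V.
  rewrite [LHS]monalg.fgmulgU [RHS]monalg.malgZ_def.
  by apply: eq_bigr => w _; rewrite mulrC monalg.mulm1.
by rewrite -[c *: y]central mulrA central.
Qed.

HB.instance Definition _ (V : vectType k) :=
  GRing.Lalgebra_isAlgebra.Build k (Tens V) (@Tens_scalerAr V).

Definition tensX (V : vectType k) (v : V) : Tens V :=
  \sum_(i < \dim {:V}) monalg.mkmalgU (monalg.fmu i) (coord (vbasis {:V}) i v).

Definition Tens_word (U V : vectType k) (f : 'Hom(U, V))
    (w : monalg.fmonom 'I_(\dim {:U})) : Tens V :=
  \prod_(i <- monalg.fmonom_val w) tensX (f (vbasis {:U})`_i).

Lemma Tens_word_mmorphism (U V : vectType k) f : monalg.mmorphism (@Tens_word U V f).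
Proof.
split=> [x y|]; last by rewrite /Tens_word monalg.fm1 big_nil.
by rewrite /Tens_word monalg.fmM big_cat.
Qed.

HB.instance Definition _ (U V : vectType k) (f : 'Hom(U, V)) :=
  monalg.isMultiplicative.Build _ _ _ (@Tens_word_mmorphism U V f).

Definition Tens_map (U V : vectType k) (f : 'Hom(U, V)) : Tens U -> Tens V :=
  monalg.mmap (in_alg (Tens V)) (Tens_word f).

Lemma Tens_map_is_additive (U V : vectType k) f : zmod_morphism (@Tens_map U V f).
Proof. exact: monalg.mmap_is_additive. Qed.

HB.instance Definition _ (U V : vectType k) (f : 'Hom(U, V)) :=
  GRing.isZmodMorphism.Build _ _ (@Tens_map U V f) (@Tens_map_is_additive U V f).

Lemma Tens_map_is_multiplicative (U V : vectType k) f : monoid_morphism (@Tens_map U V f).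
Proof.
have [] := @monalg.commr_mmap_is_multiplicative _ _ _
    (in_alg (Tens V)) (Tens_word f) _.
  by move=> g m m'; rewrite /GRing.comm /= mulr_algl mulr_algr.
by split.
Qed.

HB.instance Definition _ (U V : vectType k) (f : 'Hom(U, V)) := GRing.isMonoidMorphism.Build _ _
  (@Tens_map U V f) (@Tens_map_is_multiplicative U V f).

Lemma Tens_map_is_scalable (U V : vectType k) f : scalable (@Tens_map U V f).
Proof. by move=> c x; rewrite /Tens_map monalg.mmapZ /= mulr_algl. Qed.

HB.instance Definition _ (U V : vectType k) (f : 'Hom(U, V)) := GRing.isScalable.Build k _ _ _
  (@Tens_map U V f) (@Tens_map_is_scalable U V f).

Lemma symX_is_linear (V : vectType k) : linear (@symX V).
Proof.
move=> c u v; rewrite scaler_sumr -big_split; apply: eq_bigr => i _.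
by rewrite linearP scalerDl scalerA.
Qed.

HB.instance Definition _ (V : vectType k) :=
  GRing.isLinear.Build k V (Sym V) _ (@symX V) (@symX_is_linear V).

Lemma tensU_scale (V : vectType k) (i : 'I_(\dim {:V})) (c : k) :
  monalg.mkmalgU (monalg.fmu i) c
    = c *: monalg.mkmalgU (monalg.fmu i) 1 :> Tens V.
Proof.
apply/monalg.malgP => w.
by rewrite monalg.mcoeffZ !monalg.mcoeffU mulr_natr.
Qed.

Lemma tensX_is_linear (V : vectType k) : linear (@tensX V).
Proof.
move=> c u v; rewrite scaler_sumr -big_split; apply: eq_bigr => i _.
by rewrite linearP tensU_scale scalerDl -scalerA -!tensU_scale.
Qed.

HB.instance Definition _ (V : vectType k) :=
  GRing.isLinear.Build k V (Tens V) _ (@tensX V) (@tensX_is_linear V).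

Lemma Sym_mapX (U V : vectType k) (f : 'Hom(U, V)) u : Sym_map f (symX u) = symX (f u).
Proof.
rewrite [in RHS](coord_vbasis (memvf u)) !linear_sum; apply: eq_bigr => i _.
rewrite !linearZ /=; congr (_ *: _); rewrite /Sym_map comp_mpolyXU.
by rewrite nth_mktuple.
Qed.

Lemma Tens_mapX (U V : vectType k) (f : 'Hom(U, V)) u : Tens_map f (tensX u) = tensX (f u).
Proof.
rewrite [in RHS](coord_vbasis (memvf u)) !linear_sum; apply: eq_bigr => i _.
rewrite tensU_scale !linearZ /=; congr (_ *: _).
by rewrite /Tens_map monalg.mmapU /= scale1r mul1r /Tens_word monalg.fmU big_seq1.
Qed.

Lemma Sym_ext (U V : vectType k) (f g : {lrmorphism Sym U -> Sym V}) :
  (forall u, f (symX u) = g (symX u)) -> f =1 g.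
Proof.
move=> fg.
have fgX i : f 'X_i = g 'X_i.
  have := fg (vbasis {:U})`_i; suff -> : symX (vbasis {:U})`_i = 'X_i by [].
  rewrite /symX (bigD1 i) //= big1 ?addr0 => [|j ji].
    by rewrite coord_free ?eqxx ?scale1r //; apply: basis_free (vbasisP _).
  by rewrite coord_free ?(basis_free (vbasisP _)) // eq_sym (negPf ji) scale0r.
have fgM m : f 'X_[m] = g 'X_[m].
  rewrite [X in f X]mpolyXE_id [X in g X]mpolyXE_id !rmorph_prod.
  by apply: eq_bigr => i _; rewrite !rmorphXn /= fgX.
move=> x; rewrite [X in f X]mpolyE [X in g X]mpolyE !linear_sum.
by apply: eq_bigr => m _; rewrite !linearZ /= fgM.
Qed.

Lemma Tens_ext (U V : vectType k) (f g : {lrmorphism Tens U -> Tens V}) :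
  (forall u, f (tensX u) = g (tensX u)) -> f =1 g.
Proof.
move=> fg.
pose W w : Tens U := monalg.mkmalgU w 1.
have fgX i : f (W (monalg.fmu i)) = g (W (monalg.fmu i)).
  have := fg (vbasis {:U})`_i.
  suff -> : tensX (vbasis {:U})`_i = W (monalg.fmu i) by [].
  rewrite /tensX (bigD1 i) //= big1 ?addr0 => [|j ji].
    by rewrite coord_free ?eqxx //; apply: basis_free (vbasisP _).
  by rewrite coord_free ?(basis_free (vbasisP _)) // eq_sym (negPf ji) tensU_scale scale0r.
have WM a b : W (monalg.mmul a b) = W a * W b.
  by rewrite [RHS]monalg.fgmulUU mulr1.
have fgW w : f (W w) = g (W w).
  case: w => s; elim: s => [|i s IH].
    rewrite -monalg.fmoneE; have -> : W (monalg.fmone _) = 1 by [].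
    by rewrite !rmorph1.
  have -> : monalg.FMonom (i :: s)
      = monalg.mmul (monalg.fmu i) (monalg.FMonom s).
    by apply/eqP; rewrite -val_eqE /= monalg.fmM monalg.fmU.
  by rewrite WM !rmorphM /= fgX IH.
have Wc w c : monalg.mkmalgU w c = c *: W w.
  by apply/monalg.malgP => w'; rewrite monalg.mcoeffZ !monalg.mcoeffU mulr_natr.
move=> x; rewrite [x]monalg.monalgE !linear_sum.
by apply: eq_bigr => w _; rewrite Wc !linearZ /= fgW.
Qed.

Lemma symX_homog (V : vectType k) (v : V) :
  (symX v : {mpoly k[_]}) \is 1.-homog.
Proof.
by apply: rpred_sum => i _; apply: rpredZ; rewrite dhomogX /= mdeg1.
Qed.

Lemma Sym_map_homog (U V : vectType k) (f : 'Hom(U, V)) m (x : Sym U) :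
  (x : {mpoly k[_]}) \is m.-homog ->
  (Sym_map f x : {mpoly k[_]}) \is m.-homog.
Proof.
move=> /dhomogP hx; rewrite /Sym_map comp_mpolyEX big_seq.
apply: rpred_sum => w /hx <-; rewrite comp_mpolyX; apply: rpredZ.
rewrite /= mdegE; elim/big_rec2: _ => [|i d p _ hp]; first exact: dhomog1.
apply: dhomogM => //; rewrite tnth_mktuple -[d in d.-homog]mul1n.
exact/dhomogMn/symX_homog.
Qed.

(* Tensors of degree at most m. *)
Definition Tens_le (V : vectType k) (m : nat) : {pred Tens V} :=
  fun x => `[< forall w, monalg.mcoeff w x != 0 ->
                 (size (fmonom_val w) <= m)%N >].

Lemma Tens_le_submod (V : vectType k) m : submod_closed (@Tens_le V m).
Proof.
split=> [|c x y /asboolP hx /asboolP hy]; apply/asboolP => w.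
  by rewrite monalg.mcoeff0 eqxx.
rewrite monalg.mcoeffD monalg.mcoeffZ => nz.
have [x0|/hx //] := eqVneq (monalg.mcoeff w x) 0.
by apply: hy; move: nz; rewrite x0 mulr0 add0r.
Qed.

HB.instance Definition _ (V : vectType k) m := GRing.isSubmodClosed.Build k
  (Tens V) (@Tens_le V m) (@Tens_le_submod V m).

Lemma Tens_le_trans (V : vectType k) m n (x : Tens V) :
  (m <= n)%N -> x \in Tens_le m -> x \in Tens_le n.
Proof.
move=> mn /asboolP hx; apply/asboolP => w /hx h; exact: leq_trans h mn.
Qed.

Lemma Tens_leU (V : vectType k) w c :
  monalg.mkmalgU w c \in @Tens_le V (size (fmonom_val w)).
Proof.
apply/asboolP => w'; rewrite monalg.mcoeffU.
by case: (w =P w') => [-> //|_]; rewrite mulr0n eqxx.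
Qed.

Lemma Tens_le1 (V : vectType k) : 1 \in @Tens_le V 0.
Proof. by have := Tens_leU (V := V) monalg.mone 1; rewrite monalg.fm1. Qed.

Lemma Tens_leM (V : vectType k) m n (x y : Tens V) :
  x \in Tens_le m -> y \in Tens_le n -> x * y \in Tens_le (m + n).
Proof.
move=> /asboolP hx /asboolP hy; rewrite [x * y]monalg.malgME big_seq.
apply: rpred_sum => a xa; rewrite big_seq; apply: rpred_sum => b yb.
apply: Tens_le_trans (Tens_leU _ _).
by rewrite monalg.fmM size_cat leq_add ?hx ?hy // monalg.mcoeff_neq0.
Qed.

Lemma tensX_le (V : vectType k) (v : V) : tensX v \in Tens_le 1.
Proof.
apply: rpred_sum => i _; apply: Tens_le_trans (Tens_leU _ _).
by rewrite monalg.fmU.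
Qed.

Lemma Tens_map_le (U V : vectType k) (f : 'Hom(U, V)) m x :
  x \in Tens_le m -> Tens_map f x \in Tens_le m.
Proof.
move=> /asboolP hx; rewrite /Tens_map monalg.mmapE big_seq.
apply: rpred_sum => w xw; rewrite /= mulr_algl; apply: rpredZ.
have : (size (fmonom_val w) <= m)%N by apply: hx; rewrite monalg.mcoeff_neq0.
move/Tens_le_trans; apply; rewrite /Tens_word.
elim: (fmonom_val w) => [|i s IH]; first by rewrite big_nil Tens_le1.
by rewrite big_cons /= -[(size s).+1]add1n; apply: Tens_leM (tensX_le _) IH.
Qed.

End SymTens.

(** * Skew group algebras *)

Section Skew.
Context (k : fieldType) (gT : finGroupType) (A : algType k).

Record algact := AlgAct {
  alg_act :> gT -> {lrmorphism A -> A};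
  alg_act1 : alg_act 1%g =1 id;
  alg_actM : forall g h : gT, alg_act (g * h)%g =1 alg_act g \o alg_act h
}.

Variable act : algact.

(* A # G: the element x stands for \sum_g x(g) g. *)
Definition skew of algact : Type := {ffun gT -> A}.
Local Notation AG := (skew act).

HB.instance Definition _ := GRing.Lmodule.on AG.

Definition mk_skew (f : {ffun gT -> A}) : AG := f.
Definition skew_coef (x : AG) (g : gT) : A := (x : {ffun gT -> A}) g.

Lemma skewP (x y : AG) : (forall g, skew_coef x g = skew_coef y g) -> x = y.
Proof. by move=> h; apply/ffunP. Qed.

Lemma skew_coefD x y g : skew_coef (x + y) g = skew_coef x g + skew_coef y g.
Proof. exact: ffunE. Qed.

Lemma skew_coefZ c x g : skew_coef (c *: x) g = c *: skew_coef x g.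
Proof. exact: ffunE. Qed.

Definition skew1 : AG := mk_skew [ffun g => (g == 1%g)%:R].

(* (a g) (b h) = a ({}^g b) gh; the coefficient at z collects h = g^-1 z. *)
Definition skew_mul (x y : AG) : AG := mk_skew
  [ffun z => \sum_g skew_coef x g * act g (skew_coef y (g^-1 * z)%g)].

Lemma skew_mulE x y z : skew_coef (skew_mul x y) z =
  \sum_g skew_coef x g * act g (skew_coef y (g^-1 * z)%g).
Proof. exact: ffunE. Qed.

Lemma skew1E z : skew_coef skew1 z = (z == 1%g)%:R.
Proof. exact: ffunE. Qed.

Lemma skew_mulA : associative skew_mul.
Proof.
move=> x y z; apply/skewP => w; rewrite !skew_mulE.
under eq_bigr do rewrite skew_mulE raddf_sum /= mulr_sumr.
under [RHS]eq_bigr do rewrite skew_mulE mulr_suml.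
rewrite [RHS]exchange_big; apply: eq_bigr => g _.
rewrite [RHS](reindex (fun h => g * h)%g) /=; last first.
  by apply: onW_bij; exists (fun h => g^-1 * h)%g => h; rewrite ?mulKg ?mulKVg.
apply: eq_bigr => h _.
by rewrite mulKg rmorphM invMg (alg_actM act g h _) /= !mulgA mulrA.
Qed.

Lemma skew_mul1l : left_id skew1 skew_mul.
Proof.
move=> x; apply/skewP => z; rewrite skew_mulE (bigD1 1%g) //= skew1E eqxx mul1r.
rewrite alg_act1 invg1 mul1g big1 ?addr0 // => g /negPf g1.
by rewrite skew1E g1 mul0r.
Qed.

Lemma skew_mul1r : right_id skew1 skew_mul.
Proof.
move=> x; apply/skewP => z; rewrite skew_mulE (bigD1 z) //= skew1E mulVg eqxx.
rewrite rmorph1 mulr1 big1 ?addr0 // => g gz.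
by rewrite skew1E -eq_mulVg1 (negPf gz) rmorph0 mulr0.
Qed.

Lemma skew_mulDl : left_distributive skew_mul +%R.
Proof.
move=> x y z; apply/skewP => w; rewrite skew_coefD !skew_mulE -big_split.
by apply: eq_bigr => g _; rewrite skew_coefD mulrDl.
Qed.

Lemma skew_mulDr : right_distributive skew_mul +%R.
Proof.
move=> x y z; apply/skewP => w; rewrite skew_coefD !skew_mulE -big_split.
by apply: eq_bigr => g _; rewrite skew_coefD raddfD mulrDr.
Qed.

Lemma skew1_neq0 : skew1 != 0.
Proof.
by apply/eqP => /ffunP /(_ 1%g); rewrite !ffunE eqxx => /eqP; rewrite oner_eq0.
Qed.

HB.instance Definition _ := GRing.Zmodule_isNzRing.Build AG
  skew_mulA skew_mul1l skew_mul1r skew_mulDl skew_mulDr skew1_neq0.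

Lemma skew_scalerAl (c : k) (x y : AG) : c *: (x * y) = (c *: x) * y.
Proof.
apply/skewP => w; rewrite skew_coefZ !skew_mulE scaler_sumr.
by apply: eq_bigr => g _; rewrite skew_coefZ scalerAl.
Qed.

HB.instance Definition _ := GRing.Lmodule_isLalgebra.Build k AG skew_scalerAl.

Lemma skew_scalerAr (c : k) (x y : AG) : c *: (x * y) = x * (c *: y).
Proof.
apply/skewP => w; rewrite skew_coefZ !skew_mulE scaler_sumr.
by apply: eq_bigr => g _; rewrite skew_coefZ linearZ scalerAr.
Qed.

HB.instance Definition _ := GRing.Lalgebra_isAlgebra.Build k AG skew_scalerAr.

(* a # g *)
Definition skewU (a : A) (g : gT) : AG :=
  mk_skew [ffun h => if h == g then a else 0].

Lemma skewUE a g z : skew_coef (skewU a g) z = if z == g then a else 0.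
Proof. exact: ffunE. Qed.

Lemma skewUM a b g h :
  skewU a g * skewU b h = skewU (a * act g b) (g * h)%g.
Proof.
apply/skewP => z; rewrite [LHS]skew_mulE (bigD1 g) //= big1.
  rewrite addr0 !skewUE eqxx -[z in RHS](mulKVg g) (inj_eq (mulgI g)).
  by case: ifP; rewrite ?raddf0 ?mulr0.
by move=> i /negPf ig; rewrite skewUE ig mul0r.
Qed.

End Skew.

(** * Linear actions of a finite group *)

Record linrep (k : fieldType) (gT : finGroupType) (V : vectType k) := LinRep {
  lrep :> gT -> 'End(V);
  lrep1 : lrep 1%g = \1%VF;
  lrepM : forall g h : gT, lrep (g * h)%g = (lrep g \o lrep h)%VF
}.

Section Main.
Context (k : fieldType) (gT : finGroupType) (V : vectType k).
Variable rho : linrep gT V.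

(* Every eigenvalue, in an arbitrary field extension of k, of the matrix of the
   action of a group element already lies in k. *)
Definition contains_eigenvalues : Prop :=
  forall (L : fieldType) (iota : {rmorphism k -> L}) (g : gT) (a : L),
    eigenvalue
      (map_mx iota (passmx.mxof (vbasis {:V}) (vbasis {:V}) (rho g))) a ->
    exists b : k, a = iota b.

Lemma Sym_act1 : Sym_map (rho 1%g) =1 id.
Proof.
apply: (@Sym_ext k V V (Sym_map (rho 1%g)) idfun) => u.
by rewrite [LHS]Sym_mapX lrep1 lfunE.
Qed.

Lemma Sym_actM g h :
  Sym_map (rho (g * h)%g) =1 Sym_map (rho g) \o Sym_map (rho h).
Proof.
apply: (@Sym_ext k V V (Sym_map (rho (g * h)%g))
  (Sym_map (rho g) \o Sym_map (rho h))) => u.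
by rewrite [LHS]Sym_mapX /= !Sym_mapX lrepM lfunE.
Qed.

Definition Sym_act : algact gT (Sym V) :=
  @AlgAct k gT (Sym V) (fun g => Sym_map (rho g)) Sym_act1 Sym_actM.

Lemma Tens_act1 : Tens_map (rho 1%g) =1 id.
Proof.
apply: (@Tens_ext k V V (Tens_map (rho 1%g)) idfun) => u.
by rewrite [LHS]Tens_mapX lrep1 lfunE.
Qed.

Lemma Tens_actM g h :
  Tens_map (rho (g * h)%g) =1 Tens_map (rho g) \o Tens_map (rho h).
Proof.
apply: (@Tens_ext k V V (Tens_map (rho (g * h)%g))
  (Tens_map (rho g) \o Tens_map (rho h))) => u.
by rewrite [LHS]Tens_mapX /= !Tens_mapX lrepM lfunE.
Qed.

Definition Tens_act : algact gT (Tens V) :=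
  @AlgAct k gT (Tens V) (fun g => Tens_map (rho g)) Tens_act1 Tens_actM.

Definition SG : algType k := skew Sym_act.
Definition TG : algType k := skew Tens_act.

(** ** Parameters *)

(* (k (+) V) (x) kG *)
Definition target : lmodType k := {ffun gT -> (k^o * V)%type}.

(* Linear maps V /\ V -> (k (+) V) (x) kG are alternating bilinear maps. *)
Definition alternating (kappa : V -> V -> target) : Prop :=
  forall v, kappa v v = 0.

Definition target_coef (u : target) (g : gT) : k^o * V :=
  (u : {ffun gT -> (k^o * V)%type}) g.

Definition const_part (kappa : V -> V -> target) : V -> V -> target :=
  fun v w => [ffun g => ((target_coef (kappa v w) g).1, 0)].

Definition lin_part (kappa : V -> V -> target) : V -> V -> target :=
  fun v w => [ffun g => (0, (target_coef (kappa v w) g).2)].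

Definition target_act (h : gT) (u : target) : target :=
  [ffun g => ((target_coef u (g ^ h)%g).1, rho h (target_coef u (g ^ h)%g).2)].

Definition G_invariant (kappa : V -> V -> target) : Prop :=
  forall h v w,
    target_act h (kappa (rho h^-1%g v) (rho h^-1%g w)) = kappa v w.

(** ** The algebra H_kappa *)

Definition target_TG (u : target) : TG :=
  mk_skew Tens_act
    [ffun g => (target_coef u g).1%:A + tensX (target_coef u g).2].

Definition vTG (v : V) : TG := skewU Tens_act (tensX v) 1%g.

Definition relation (kappa : V -> V -> target) : TG -> Prop := fun x =>
  exists v w, x = vTG v * vTG w - vTG w * vTG v - target_TG (kappa v w).

(* T(V) # G in degrees at most m, for deg v = 1 and deg g = 0. *)
Definition TG_le (m : nat) : {pred TG} :=
  fun x => [forall g, skew_coef x g \in Tens_le m].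

Lemma TG_leP m (x : TG) :
  reflect (forall g, skew_coef x g \in Tens_le m) (x \in TG_le m).
Proof. exact: forallP. Qed.

Lemma TG_le_submod m : submod_closed (TG_le m).
Proof.
split=> [|c x y /TG_leP hx /TG_leP hy]; apply/TG_leP => g.
  by rewrite [skew_coef _ _]ffunE rpred0.
by rewrite skew_coefD skew_coefZ rpredD ?rpredZ.
Qed.

HB.instance Definition _ m :=
  GRing.isSubmodClosed.Build k TG (TG_le m) (TG_le_submod m).

Lemma TG_leM m n (x y : TG) :
  x \in TG_le m -> y \in TG_le n -> x * y \in TG_le (m + n).
Proof.
move=> /TG_leP hx /TG_leP hy; apply/TG_leP => z; rewrite skew_mulE.
by apply: rpred_sum => g _; apply: Tens_leM => //; apply: Tens_map_le.
Qed.

Section Hkappa.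
Variable kappa : V -> V -> target.

Definition Halg : kalg k := quotalg (relation kappa).

Definition H_pi (x : TG) : Halg := qm_pi (ideal_gen (relation kappa)) x.

Definition H_fil (m : nat) : {pred Halg} :=
  fun a => `[< exists2 x, x \in TG_le m & a = H_pi x >].

Lemma H_fil_submod m : submod_closed (H_fil m).
Proof.
split.
  by apply/asboolP; exists 0 => //; apply: rpred0.
move=> c a b /asboolP [x hx ->] /asboolP [y hy ->]; apply/asboolP.
exists (c *: x + y); first by rewrite rpredD ?rpredZ.
by rewrite /H_pi -qm_piD -qm_piZ.
Qed.

HB.instance Definition _ m :=
  GRing.isSubmodClosed.Build k Halg (H_fil m) (H_fil_submod m).

Lemma H_fil_mono m : {subset H_fil m <= H_fil m.+1}.
Proof.
move=> a /asboolP [x /TG_leP hx ->]; apply/asboolP; exists x => //.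
by apply/TG_leP => g; apply: Tens_le_trans (hx g).
Qed.

Lemma H_fil1 : ka1 Halg \in H_fil 0%N.
Proof.
apply/asboolP; exists 1 => //; apply/TG_leP => g; rewrite skew1E.
by case: (g == 1%g); rewrite ?rpred0 // Tens_le1.
Qed.

Lemma H_filM m n (a b : Halg) :
  a \in H_fil m -> b \in H_fil n -> kaM a b \in H_fil (m + n).
Proof.
move=> /asboolP [x hx ->] /asboolP [y hy ->]; apply/asboolP.
by exists (x * y); [apply: TG_leM | apply: qa_mulE].
Qed.

Definition Hfilt : filtalg k := FiltAlg H_fil_mono H_fil1 H_filM.

End Hkappa.

(** ** The graded algebra S # G *)

Definition SG_hom (m : nat) : {pred SG} :=
  fun x => [forall g, (skew_coef x g : {mpoly k[_]}) \is m.-homog].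

Lemma SG_homP m (x : SG) :
  reflect (forall g, (skew_coef x g : {mpoly k[_]}) \is m.-homog)
          (x \in SG_hom m).
Proof. exact: forallP. Qed.

Lemma SG_hom_submod m : submod_closed (SG_hom m).
Proof.
split=> [|c x y /SG_homP hx /SG_homP hy]; apply/SG_homP => g.
  by rewrite [skew_coef _ _]ffunE rpred0.
by rewrite skew_coefD skew_coefZ rpredD ?rpredZ.
Qed.

HB.instance Definition _ m :=
  GRing.isSubmodClosed.Build k SG (SG_hom m) (SG_hom_submod m).

Lemma SG_hom1 : 1 \in SG_hom 0.
Proof.
apply/SG_homP => g; rewrite skew1E.
by case: (g == 1%g); rewrite ?rpred0 // dhomog1.
Qed.

Lemma SG_homM m n (x y : SG) :
  x \in SG_hom m -> y \in SG_hom n -> x * y \in SG_hom (m + n).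
Proof.
move=> /SG_homP hx /SG_homP hy; apply/SG_homP => z; rewrite skew_mulE.
apply: rpred_sum => g _; apply: dhomogM; first exact: hx.
exact: Sym_map_homog.
Qed.

Definition SG_graded : gralg k :=
  @GrAlg k (fun m => subm (SG_hom m)) (SubM SG_hom1)
    (fun m n x y => SubM (SG_homM (sm_valP x) (sm_valP y))).

(* The PBW condition. *)
Definition Drinfeld_orbifold (kappa : V -> V -> target) : Prop :=
  graded_iso (gr (Hfilt kappa)) SG_graded.

(** ** Cochains *)

(* C^p consists of the alternating multilinear maps of this type. *)
Definition cochain (p : nat) : Type := {ffun 'I_p -> V} -> SG.

Definition vSG (v : V) : SG := skewU Sym_act (symX v) 1%g.

Definition dstar p (alpha : cochain p) : cochain p.+1 := fun v =>
  \sum_(i < p.+1)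
    let a := alpha [ffun j => v (lift i j)] in
    (-1) ^+ i *: (vSG (v i) * a - a * vSG (v i)).

(* k (+) V as the polynomials of degree at most 1 *)
Definition kV_Sym (u : k^o * V) : Sym V := u.1%:A + symX u.2.

(* kappa regarded as an element of C^2 *)
Definition cochain_of (kappa : V -> V -> target) : cochain 2 := fun v =>
  mk_skew Sym_act [ffun g => kV_Sym (target_coef (kappa (v 0) (v 1)) g)].

Definition Vfix (g : gT) : {vspace V} := fixedSpace (rho g).

Definition codim (g : gT) : nat := (\dim {:V} - \dim (Vfix g))%N.

(* (V^g)^\perp, the sum of the eigenspaces for the eigenvalues other than 1 *)
Definition Vperp (g : gT) (v : V) : Prop :=
  exists (n : nat) (a : 'I_n -> k) (u : 'I_n -> V),
    (forall i, a i != 1 /\ rho g (u i) = a i *: u i) /\ v = \sum_i u i.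

(* f_1 /\ ... /\ f_p as a function of v_1, ..., v_p *)
Definition wedge p (f : 'I_p -> 'Hom(V, k^o)) (v : {ffun 'I_p -> V}) : k :=
  \det (\matrix_(i, j) (f i (v j) : k)).

Definition Vfix_incl (g : gT) : 'Hom(subvs_of (Vfix g), V) := linfun vsval.

(* The g-component of H^p. With c = codim V^g, the first p - c linear forms
   below lie in (V^g)^* (they vanish on (V^g)^\perp) and the last c ones in
   ((V^g)^\perp)^* (they vanish on V^g). *)
Definition in_Hg p (g : gT) (alpha_g : {ffun 'I_p -> V} -> Sym V) : Prop :=
  if (codim g <= p)%N then
    exists (n : nat) (s : 'I_n -> Sym (subvs_of (Vfix g)))
           (f : 'I_n -> 'I_p -> 'Hom(V, k^o)),
      [/\ forall r (i : 'I_p), (i < p - codim g)%N ->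
            forall v, Vperp g v -> f r i v = 0,
          forall r (i : 'I_p), (p - codim g <= i)%N ->
            forall v, v \in Vfix g -> f r i v = 0
        & forall v, alpha_g v =
            \sum_r wedge (f r) v *: Sym_map (Vfix_incl g) (s r)]
  else forall v, alpha_g v = 0.

Definition in_H p (alpha : cochain p) : Prop :=
  forall g, in_Hg g (fun v => skew_coef (alpha v) g).

(** ** The bracket of cochains of polynomial degree at most 1 *)

(* \sum_(h, sigma) alpha_{g h^-1} (beta^L_h (v_s1 /\ v_s2) /\ v_s3) *)
Definition insertion (alpha beta : V -> V -> target) (v : {ffun 'I_3 -> V})
    (g : gT) : Sym V :=
  \sum_(h : gT) \sum_(s in ('Alt_('I_3))%g)
    kV_Sym (target_coef
      (alpha (target_coef (beta (v (s 0)) (v (s 1))) h).2 (v (s 2)))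
      (g * h^-1)%g).

(* A cochain of degree at most 1 is the same thing as a parameter. The outer
   argument of insertion may have both parts, but only the linear part of the
   inner one enters: for alpha constant and beta linear the second term
   vanishes, and for both constant both do. *)
Definition bracket (alpha beta : V -> V -> target) : cochain 3 := fun v =>
  mk_skew Sym_act
    [ffun g => insertion alpha beta v g + insertion beta alpha v g].

End Main.

(* Main.v *)
Require Import Defs.
From HB Require Import structures.
From mathcomp Require Import all_boot all_order all_fingroup all_algebra.
From mathcomp Require Import all_solvable generic_quotient boolp.
From mathcomp Require finmap monalg.
Import -(notations) monalg.
From mathcomp Require Import mpoly zify ring.

Set Implicit Arguments.
Unset Strict Implicit.
Unset Printing Implicit Defensive.

Import GRing.Theory.
Local Open Scope ring_scope.
Local Open Scope quotient_scope.

(** Write R for the ideal of relations in T(V) # G and, for x of degree at most m,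
    call the degree m part of the image of x in S # G the symbol of x in degree m.
    There is always a graded surjection from S # G onto the associated graded algebra
    of H_kappa. It is injective exactly when every element of R of degree at most m has
    zero symbol in degree m ([PBW]). Since the homogeneous components of S # G are
    finite-dimensional, the existence of some graded isomorphism already forces this
    ([Drinfeld_PBW], [PBW_Drinfeld]).

    The Jacobi identity for v1, v2, v3 expresses the cyclic sum of the commutators
    [kappa(v1, v2), v3] through the relations. Moving group elements to the right splits
    each commutator into a quadratic part [Jquad], the sum over g of
    kappa^L_g(v1, v2) (g v3 - v3) g, and a part [Jlow] of degree at most 1, which is the
    image of an explicit element [Jtarget] of (k + V) (x) kG; the rest lies in R. The
    cyclic sum of [Jtarget] vanishes if and only if both bracket conditions hold
    ([bracket_conditions]). PBW then has three consequences: kappa is G-invariant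
    ([PBW_invariant]), the image of the cyclic sum of [Jquad] in S # G vanishes
    ([PBW_cocycle]), and, if the cyclic sum of [Jquad] vanishes in T(V) # G itself, so
    does that of [Jtarget] ([PBW_low]). Conversely, if kappa is G-invariant and the two
    cyclic sums cancel in T(V) # G, then PBW holds ([PBW_sufficient]): one constructs,
    by induction on the degree and by sorting words, linear maps T(V) # G -> S # G that
    kill more and more of R and preserve leading symbols. The consistency of the sorting
    is the usual resolution of the ambiguities of two overlapping or disjoint inversions.

    The gap between the two directions is that the cocycle identity is an identity
    between symmetric tensors, while [Jquad] has values in plain tensors. Membership of
    kappa^L in H^2 closes it. If g acts trivially, then g v3 - v3 = 0. Otherwise an
    invariant kappa^L in H^2 has a component at g that takes values in V^g, vanishes as
    soon as one argument lies in V^g, and is zero unless V^g has codimension 2. The cyclic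
    sum of kappa^L_g(v1, v2) (x) (g v3 - v3) is then an alternating trilinear function on
    V / V^g, a space of dimension at most 2, so it is zero ([in_H_tensor]). This gives the
    implication from right to left.

    For the other implication, let H_kt satisfy PBW. For linear forms r_g on V with
    r_(h g h^-1)(h v) = r_g(v), the substitution v -> v + sum_g r_g(v) g is a filtered
    automorphism of T(V) # G. It carries the relations of kt to those of a parameter
    whose linear part differs from kt^L by the coboundary of r ([shifted_iso]). For each
    single g, linear algebra with the cocycle identity provides an r_g for which the
    component at g becomes V^g-valued and vanishes on V^g ([normal_form]); averaging over
    G makes the family equivariant and keeps this property ([average_normalized]). The
    new parameter again satisfies PBW, so it is invariant and its linear part is a
    cocycle; the cocycle identity then forces the components with codim V^g other than
    0 and 2 to vanish ([support_codim1], [support_codim3]). Hence the new linear part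
    lies in H^2 ([in_H_normalized]), the cyclic sum of [Jquad] vanishes, and the
    bracket conditions follow. *)

(** * Words in the tensor algebra *)

Section Words.
Context (k : fieldType) (V : vectType k).
Local Notation I := 'I_(\dim {:V}).

Fact wordT_key : unit. Proof. by []. Qed.

(** The monomials of T(V) are locked: unfolding the monoid algebra when two of them are
    compared is prohibitively slow. *)
Definition wordT : seq I -> Tens V :=
  locked_with wordT_key (fun s => monalg.mkmalgU (monalg.FMonom s) 1).

Lemma wordT_def s : wordT s = monalg.mkmalgU (monalg.FMonom s) 1.
Proof. by rewrite /wordT unlock. Qed.

Lemma wordT_nil : wordT [::] = 1.
Proof. by rewrite wordT_def -monalg.fmoneE. Qed.

Lemma wordT_cat s t : wordT (s ++ t) = wordT s * wordT t.
Proof.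
rewrite !wordT_def [RHS]monalg.fgmulUU mulr1; congr (monalg.mkmalgU _ _).
by apply/eqP; rewrite -val_eqE /= monalg.fmM.
Qed.

Lemma wordT_seq1 i : wordT [:: i] = tensX (vbasis {:V})`_i.
Proof.
rewrite /tensX (bigD1 i) //= big1 ?addr0 => [|j ji].
  rewrite coord_free ?eqxx; last exact: basis_free (vbasisP _).
  by rewrite wordT_def monalg.fmuE.
rewrite coord_free ?(basis_free (vbasisP _)) // eq_sym (negPf ji).
by rewrite tensU_scale scale0r.
Qed.

Lemma wordT_cons i s : wordT (i :: s) = tensX (vbasis {:V})`_i * wordT s.
Proof. by rewrite -cat1s wordT_cat wordT_seq1. Qed.

Lemma wordTE (x : Tens V) :
  x = \sum_(w <- finmap.enum_fset (monalg.msupp x)) monalg.mcoeff w x *: wordT (fmonom_val w).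
Proof.
rewrite {1}[x]monalg.monalgE; apply: eq_bigr => w _.
apply/monalg.malgP => u; rewrite wordT_def monalg.mcoeffZ !monalg.mcoeffU.
by rewrite monalg.fmK mulr_natr.
Qed.

Lemma wordT_le s : wordT s \in @Tens_le k V (size s).
Proof. by rewrite wordT_def; apply: (Tens_leU (monalg.FMonom s)). Qed.

Lemma Tens_le_ind (P : Tens V -> Prop) m :
    P 0 -> (forall c x y, P x -> P y -> P (c *: x + y)) ->
    (forall s, (size s <= m)%N -> P (wordT s)) ->
  forall x, x \in @Tens_le k V m -> P x.
Proof.
move=> P0 PD Pw x /asboolP hx; rewrite [x]wordTE.
have: forall w, w \in finmap.enum_fset (monalg.msupp x) -> (size (fmonom_val w) <= m)%N.
  by move=> w; rewrite -monalg.mcoeff_neq0 => /hx.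
elim: (finmap.enum_fset _) => [|w r IH] hr; first by rewrite big_nil.
rewrite big_cons; apply: PD; first by apply: Pw; apply: hr; rewrite mem_head.
by apply: IH => u ur; apply: hr; rewrite inE ur orbT.
Qed.

(** Every element has finitely many monomials, so statements proved by [Tens_le_ind] in
    each filtration degree hold everywhere. *)
Lemma Tens_le_ex (x : Tens V) : exists m, x \in @Tens_le k V m.
Proof.
exists (\max_(w <- finmap.enum_fset (monalg.msupp x)) size (fmonom_val w))%N.
apply/asboolP => w; rewrite monalg.mcoeff_neq0 => wx.
exact: (leq_bigmax_seq (F := fun w => size (fmonom_val w))).
Qed.

Lemma Tens_ind (P : Tens V -> Prop) :
    P 0 -> (forall c x y, P x -> P y -> P (c *: x + y)) ->
    (forall s, P (wordT s)) ->
  forall x, P x.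
Proof. by move=> P0 PD Pw x; have [m] := Tens_le_ex x; apply: Tens_le_ind. Qed.

Section Extension.
Context (M : lmodType k) (f : seq I -> M).

(** The linear map on T(V) with prescribed values on monomials. *)
Definition word_ext (x : Tens V) : M :=
  \sum_(w <- finmap.enum_fset (monalg.msupp x)) monalg.mcoeff w x *: f (fmonom_val w).

(** The sum may run over any finite set containing the support; this allows one index set
    for two elements and their combination. *)
Lemma word_extEw (d : seq (monalg.fmonom I)) x :
    uniq d -> {subset finmap.enum_fset (monalg.msupp x) <= d} ->
  word_ext x = \sum_(w <- d) monalg.mcoeff w x *: f (fmonom_val w).
Proof.
move=> ud sd; rewrite [RHS](bigID (mem (finmap.enum_fset (monalg.msupp x)))) /=.
rewrite [X in _ + X]big1 ?addr0 => [|w wx]; last first.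
  by rewrite (eqP (_ : monalg.mcoeff w x == 0)) ?scale0r // monalg.mcoeff_eq0.
rewrite -big_filter; apply: perm_big; apply: uniq_perm.
- exact: finmap.fset_uniq.
- exact: filter_uniq.
by move=> w; rewrite mem_filter andb_idr // => /sd.
Qed.

Lemma word_ext_is_linear : linear word_ext.
Proof.
move=> c x y.
(* A common index set for the three supports. *)
pose d := undup (finmap.enum_fset (monalg.msupp x) ++
  finmap.enum_fset (monalg.msupp y) ++
  finmap.enum_fset (monalg.msupp (c *: x + y))).
rewrite !(@word_extEw d) ?undup_uniq // => [|w|w|w]; last 3 first.
- by rewrite mem_undup !mem_cat => ->; rewrite !orbT.
- by rewrite mem_undup !mem_cat => ->.
- by rewrite mem_undup !mem_cat => ->; rewrite !orbT.
rewrite scaler_sumr -big_split; apply: eq_bigr => w _ /=.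
by rewrite monalg.mcoeffD monalg.mcoeffZ scalerDl scalerA.
Qed.

HB.instance Definition _ :=
  GRing.isLinear.Build k (Tens V) M _ word_ext word_ext_is_linear.

Lemma word_extE s : word_ext (wordT s) = f s.
Proof.
rewrite wordT_def (@word_extEw [:: monalg.FMonom s]) // => [|w].
  by rewrite big_seq1 monalg.mcoeffUU scale1r.
have [<-|ne] := eqVneq (monalg.FMonom s) w; first by rewrite inE eqxx.
by rewrite -monalg.mcoeff_neq0 monalg.mcoeffU (negPf ne) eqxx.
Qed.

End Extension.
End Words.

(** * Skew group algebras and the universal property of T(V) # G *)

Section SkewFacts.
Context (k : fieldType) (gT : finGroupType) (A : algType k).
Variable act : algact gT A.

(** [skewU] with its arguments exchanged, to carry the linear structure. *)
Definition skewUr g a := skewU act a g.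

Lemma skewUr_is_linear g : linear (skewUr g).
Proof.
move=> c a b; apply/skewP => z; rewrite skew_coefD skew_coefZ !skewUE.
by case: ifP => _; rewrite ?scaler0 ?addr0.
Qed.

HB.instance Definition _ (g : gT) :=
  GRing.isLinear.Build k A (Defs.skew act) _ (skewUr g) (skewUr_is_linear g).

(** [skew_coef] with its arguments exchanged, to carry the linear structure. *)
Definition coefr g (x : Defs.skew act) := skew_coef x g.

Lemma coefr_is_linear g : linear (coefr g).
Proof. by move=> c x y; rewrite /coefr skew_coefD skew_coefZ. Qed.

HB.instance Definition _ (g : gT) :=
  GRing.isLinear.Build k (Defs.skew act) A _ (coefr g) (coefr_is_linear g).

Lemma skewU0 g : skewU act 0 g = 0. Proof. exact: (raddf0 (skewUr g)). Qed.
Lemma skewUN a g : skewU act (- a) g = - skewU act a g.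
Proof. exact: (raddfN (skewUr g)). Qed.
Lemma skewUD a b g : skewU act (a + b) g = skewU act a g + skewU act b g.
Proof. exact: (raddfD (skewUr g)). Qed.
Lemma skewUZ c a g : skewU act (c *: a) g = c *: skewU act a g.
Proof. exact: (linearZZ (skewUr g)). Qed.

Lemma skew_coef_sum (J : Type) (r : seq J) (P : pred J) (F : J -> Defs.skew act) g :
  skew_coef (\sum_(j <- r | P j) F j) g = \sum_(j <- r | P j) skew_coef (F j) g.
Proof. exact: (raddf_sum (coefr g)). Qed.

Lemma skewU_sum (x : Defs.skew act) : x = \sum_g skewU act (skew_coef x g) g.
Proof.
apply/skewP => z; rewrite skew_coef_sum (bigD1 z) //= skewUE eqxx.
by rewrite big1 ?addr0 // => g /negPf gz; rewrite skewUE eq_sym gz.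
Qed.

Lemma skewU_1 : skewU act 1 1%g = 1.
Proof. by apply/skewP => z; rewrite skewUE skew1E; case: (z == 1%g). Qed.

Definition skewg (g : gT) : Defs.skew act := skewU act 1 g.

Lemma skewgM g h : skewg (g * h)%g = skewg g * skewg h.
Proof. by rewrite /skewg skewUM rmorph1 mulr1. Qed.

Lemma skewU_mulg a g h : skewU act a (g * h)%g = skewU act a g * skewg h.
Proof. by rewrite /skewg skewUM rmorph1 mulr1. Qed.

Lemma skewUg a g : skewU act a g = skewU act a 1%g * skewg g.
Proof. by rewrite -skewU_mulg mul1g. Qed.

Lemma skewgU g a : skewg g * skewU act a 1%g = skewU act (act g a) 1%g * skewg g.
Proof. by rewrite /skewg !skewUM mul1r rmorph1 mulr1 mul1g mulg1. Qed.

Lemma skewg_mulV g : skewg g * skewg g^-1 = 1.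
Proof. by rewrite -skewgM mulgV; exact: skewU_1. Qed.

Lemma skewU_mul1 a b g : skewU act (a * b) g = skewU act a 1%g * skewU act b g.
Proof. by rewrite skewUM alg_act1 mul1g. Qed.

Lemma skew_coef_mulg (x : Defs.skew act) g z :
  skew_coef (x * skewg g) z = skew_coef x (z * g^-1)%g.
Proof.
rewrite [LHS]skew_mulE (bigD1 (z * g^-1)%g) //= big1 => [|h hz].
  by rewrite invMg invgK mulgKV /skewg skewUE eqxx rmorph1 mulr1 addr0.
rewrite /skewg skewUE; case: eqP => [e|_]; last by rewrite raddf0 mulr0.
by case/eqP: hz; rewrite -e invMg invgK mulKVg.
Qed.

Lemma skew_coef_gmul (x : Defs.skew act) g z :
  skew_coef (skewg g * x) z = act g (skew_coef x (g^-1 * z)%g).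
Proof.
rewrite [LHS]skew_mulE (bigD1 g) //= big1 => [|h /negPf hg].
  by rewrite /skewg skewUE eqxx mul1r addr0.
by rewrite /skewg skewUE hg mul0r.
Qed.
End SkewFacts.

Section Lift.
Context (k : fieldType) (gT : finGroupType) (V : vectType k).
Variable rho : linrep gT V.
Local Notation TG := (TG rho).
Local Notation TU := (skewU (Tens_act rho)).
Local Notation Tg := (skewg (Tens_act rho)).
Local Notation vT := (vTG rho).

Lemma rho1 v : rho 1%g v = v. Proof. by rewrite lrep1 lfunE. Qed.
Lemma rhoM g h v : rho (g * h)%g v = rho g (rho h v).
Proof. by rewrite lrepM lfunE. Qed.
Lemma rhoK g v : rho g^-1%g (rho g v) = v. Proof. by rewrite -rhoM mulVg rho1. Qed.
Lemma rhoVK g v : rho g (rho g^-1%g v) = v. Proof. by rewrite -rhoM mulgV rho1. Qed.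

Lemma vTG_is_linear : linear vT.
Proof. by move=> c u v; rewrite /vTG linearP skewUD skewUZ. Qed.
HB.instance Definition _ := GRing.isLinear.Build k V TG _ vT vTG_is_linear.

Lemma Tens_actX g v : Tens_act rho g (tensX v) = tensX (rho g v).
Proof. exact: Tens_mapX. Qed.

Lemma Tens_act_mul g x y :
  Tens_act rho g (x * y) = Tens_act rho g x * Tens_act rho g y.
Proof. exact: rmorphM. Qed.

Lemma Tens_actP g c x y :
  Tens_act rho g (c *: x + y) = c *: Tens_act rho g x + Tens_act rho g y.
Proof. exact: linearP. Qed.

Lemma Tg_vT g v : Tg g * vT v = vT (rho g v) * Tg g.
Proof. by rewrite skewgU /= Tens_mapX. Qed.

Lemma TG_le_ind (P : TG -> Prop) m :
    P 0 -> (forall c x y, P x -> P y -> P (c *: x + y)) ->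
    (forall s g, (size s <= m)%N -> P (TU (wordT s) g)) ->
  forall x, x \in @TG_le k gT V rho m -> P x.
Proof.
move=> P0 PD Pw x /TG_leP hx; rewrite [x]skewU_sum.
elim/big_ind: _ => // [y z Py Pz|g _]; first by rewrite -[y]scale1r; apply: PD.
move: (skew_coef x g) (hx g); apply: (@Tens_le_ind k V (fun a => P (TU a g)) m).
- by rewrite skewU0.
- by move=> c a b Pa Pb; rewrite skewUD skewUZ; apply: PD.
- by move=> s; apply: Pw.
Qed.

Lemma TG_le_trans m n (x : TG) :
  (m <= n)%N -> x \in TG_le m -> x \in @TG_le k gT V rho n.
Proof.
by move=> mn /TG_leP hx; apply/TG_leP => g; apply: Tens_le_trans mn (hx g).
Qed.

Lemma TG_le_ex (x : TG) : exists m, x \in @TG_le k gT V rho m.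
Proof.
have /choice [d hd] : forall g, exists m, skew_coef x g \in @Tens_le k V m.
  by move=> g; apply: Tens_le_ex.
exists (\max_g d g)%N; apply/TG_leP => g.
by apply: Tens_le_trans (hd g); apply: leq_bigmax.
Qed.

Lemma TG_ind (P : TG -> Prop) :
    P 0 -> (forall c x y, P x -> P y -> P (c *: x + y)) ->
    (forall s g, P (TU (wordT s) g)) ->
  forall x, P x.
Proof. by move=> P0 PD Pw x; have [m] := TG_le_ex x; apply: TG_le_ind. Qed.

Lemma TG_le_word s g : TU (wordT s) g \in @TG_le k gT V rho (size s).
Proof.
apply/TG_leP => h; rewrite skewUE; case: ifP => _; last exact: rpred0.
exact: wordT_le.
Qed.

Lemma TG_le_g g : Tg g \in @TG_le k gT V rho 0.
Proof. by rewrite /skewg -wordT_nil; apply: (TG_le_word [::]). Qed.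

Lemma TG_le_v v : vT v \in @TG_le k gT V rho 1.
Proof.
apply/TG_leP => h; rewrite skewUE; case: ifP => _; last exact: rpred0.
exact: tensX_le.
Qed.

Lemma TU_word_nil g : TU (wordT [::]) g = Tg g.
Proof. by rewrite wordT_nil. Qed.

Lemma TU_word_cons i s g :
  TU (wordT (i :: s)) g = vT (vbasis {:V})`_i * TU (wordT s) g.
Proof. by rewrite wordT_cons skewU_mul1. Qed.

Section Universal.
Context (B : algType k) (phi : {linear V -> B}) (gam : gT -> B).
Hypothesis gam1 : gam 1%g = 1.
Hypothesis gamM : forall g h, gam (g * h)%g = gam g * gam h.
Hypothesis gam_phi : forall g v, gam g * phi v = phi (rho g v) * gam g.

Definition Tlift : Tens V -> B :=
  word_ext (fun s => \prod_(i <- s) phi (vbasis {:V})`_i).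

HB.instance Definition _ := GRing.Linear.on Tlift.

Lemma TliftP c x y : Tlift (c *: x + y) = c *: Tlift x + Tlift y.
Proof. exact: linearP. Qed.

(** T(V) # G is generated by V and G subject only to g v = (g v) g, so a linear map on V and a
    multiplicative map on G that satisfy the same commutation rule extend to an algebra
    morphism. *)
Definition TGlift (x : TG) : B := \sum_g Tlift (skew_coef x g) * gam g.

Lemma TliftX v : Tlift (tensX v) = phi v.
Proof.
rewrite /tensX linear_sum [in RHS](coord_vbasis (memvf v)) linear_sum.
apply: eq_bigr => i _; rewrite tensU_scale !linearZ /= monalg.fmuE.
by congr (_ *: _); rewrite -wordT_def /Tlift word_extE big_seq1.
Qed.

Lemma TliftM x y : Tlift (x * y) = Tlift x * Tlift y.
Proof.
elim/Tens_ind: x => [|c a b IHa IHb|s].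
- by rewrite mul0r linear0 mul0r.
- by rewrite mulrDl -scalerAl !TliftP mulrDl -scalerAl; congr (_ *: _ + _).
elim/Tens_ind: y => [|c a b IHa IHb|t].
- by rewrite mulr0 linear0 mulr0.
- by rewrite mulrDr -scalerAr !TliftP mulrDr -scalerAr; congr (_ *: _ + _).
by rewrite -wordT_cat /Tlift !word_extE big_cat.
Qed.

Lemma Tlift1 : Tlift 1 = 1.
Proof. by rewrite -wordT_nil /Tlift word_extE big_nil. Qed.

Lemma Tlift_act g x : gam g * Tlift x = Tlift (Tens_act rho g x) * gam g.
Proof.
elim/Tens_ind: x => [|c a b IHa IHb|s].
- by rewrite !(linear0, mulr0, mul0r).
- by rewrite Tens_actP !TliftP mulrDr mulrDl IHb -scalerAr IHa scalerAl.
elim: s => [|i s IH].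
  by rewrite wordT_nil rmorph1 Tlift1 mul1r mulr1.
rewrite wordT_cons Tens_act_mul Tens_actX [in LHS]TliftM [in RHS]TliftM.
rewrite [in LHS]TliftX [in RHS]TliftX mulrA gam_phi -!mulrA; congr (_ * _).
exact: IH.
Qed.

Lemma TGlift_is_linear : linear TGlift.
Proof.
move=> c x y; rewrite /TGlift scaler_sumr -big_split; apply: eq_bigr => g _.
by rewrite skew_coefD skew_coefZ linearP mulrDl scalerAl.
Qed.
HB.instance Definition _ := GRing.isLinear.Build k TG B _ TGlift TGlift_is_linear.

Lemma TGliftU a g : TGlift (TU a g) = Tlift a * gam g.
Proof.
rewrite /TGlift (bigD1 g) //= skewUE eqxx big1 ?addr0 // => h /negPf hg.
by rewrite skewUE hg linear0 mul0r.
Qed.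

Lemma TGliftM x y : TGlift (x * y) = TGlift x * TGlift y.
Proof.
rewrite [x]skewU_sum [y]skewU_sum mulr_suml !linear_sum mulr_suml.
apply: eq_bigr => g _; rewrite mulr_sumr !linear_sum mulr_sumr.
apply: eq_bigr => h _; rewrite skewUM /= !TGliftU TliftM gamM.
by rewrite -!mulrA; congr (_ * _); rewrite !mulrA Tlift_act.
Qed.

Lemma TGlift_v v : TGlift (vT v) = phi v.
Proof. by rewrite TGliftU TliftX gam1 mulr1. Qed.

Lemma TGlift_g g : TGlift (Tg g) = gam g.
Proof. by rewrite TGliftU Tlift1 mul1r. Qed.

Lemma TGlift1 : TGlift 1 = 1.
Proof. by rewrite -skewU_1 TGlift_g. Qed.
End Universal.

Lemma TG_ext (B : algType k) (f1 f2 : {linear TG -> B}) :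
    {morph f1 : x y / x * y} -> {morph f2 : x y / x * y} ->
    (forall v, f1 (vT v) = f2 (vT v)) -> (forall g, f1 (Tg g) = f2 (Tg g)) ->
  forall x, f1 x = f2 x.
Proof.
move=> M1 M2 hv hg; elim/TG_ind => [|c x y IHx IHy|s g].
- by rewrite !linear0.
- by rewrite !linearP /= IHx IHy.
elim: s => [|i s IH]; first by rewrite TU_word_nil.
by rewrite TU_word_cons M1 M2 hv; congr (_ * _).
Qed.

End Lift.

(** * Leading symbols of elements of T(V) # G *)

Section Symbol.
Context (k : fieldType) (gT : finGroupType) (V : vectType k).
Variable rho : linrep gT V.
Local Notation TG := (TG rho).
Local Notation SG := (SG rho).
Local Notation I := 'I_(\dim {:V}).
Local Notation TU := (skewU (Tens_act rho)).
Local Notation Tg := (skewg (Tens_act rho)).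
Local Notation SU := (skewU (Sym_act rho)).
Local Notation Sg := (skewg (Sym_act rho)).
Local Notation vT := (vTG rho).
Local Notation vS := (vSG rho).
Local Notation TG_le := (@TG_le k gT V rho).
Local Notation SG_hom := (@SG_hom k gT V rho).

Lemma vSG_is_linear : linear vS.
Proof. by move=> c u v; rewrite /vSG linearP skewUD skewUZ. Qed.
HB.instance Definition _ := GRing.isLinear.Build k V SG _ vS vSG_is_linear.

Lemma Sym_actX g v : Sym_act rho g (symX v) = symX (rho g v).
Proof. exact: Sym_mapX. Qed.

Lemma Sg_vS g v : Sg g * vS v = vS (rho g v) * Sg g.
Proof. by rewrite skewgU Sym_actX. Qed.

Lemma symX_vbasis (i : I) : symX (vbasis {:V})`_i = 'X_i.
Proof.
rewrite /symX (bigD1 i) //= big1 ?addr0 => [|j ji].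
  by rewrite coord_free ?eqxx ?scale1r //; apply: basis_free (vbasisP _).
by rewrite coord_free ?(basis_free (vbasisP _)) // eq_sym (negPf ji) scale0r.
Qed.

(** The degree 1 part of S(V) is V: coordinates are read off as coefficients of variables. *)
Lemma symX_inj : injective (@symX k V).
Proof.
move=> u v e; rewrite (coord_vbasis (memvf u)) (coord_vbasis (memvf v)).
apply: eq_bigr => i _; congr (_ *: _).
have cE w : mcoeff U_(i) (symX w : {mpoly k[_]}) = coord (vbasis {:V}) i w.
  rewrite /symX raddf_sum (bigD1 i) //= big1 ?addr0 => [|j /negPf ji].
    by rewrite mcoeffZ mcoeffXU eqxx mulr1.
  by rewrite mcoeffZ mcoeffXU ji mulr0.
by rewrite -!cE e.
Qed.

(** Strict degree bound, so that it makes sense for the zero element and m = 0. *)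
Definition SG_lt m (x : SG) : Prop :=
  forall g, (msize (skew_coef x g : {mpoly k[_]}) <= m)%N.

Lemma SG_lt0 m : SG_lt m 0.
Proof. by move=> g; rewrite [skew_coef _ _]ffunE msize0. Qed.

Lemma SG_ltP m c x y : SG_lt m x -> SG_lt m y -> SG_lt m (c *: x + y).
Proof.
move=> hx hy g; rewrite skew_coefD skew_coefZ.
apply: leq_trans (msizeD_le _ _) _; rewrite geq_max hy andbT.
exact: leq_trans (msizeZ_le _ _) (hx g).
Qed.

Lemma SG_ltD m x y : SG_lt m x -> SG_lt m y -> SG_lt m (x + y).
Proof. by move=> hx hy; rewrite -[x]scale1r; apply: SG_ltP. Qed.

Lemma SG_ltN m x : SG_lt m x -> SG_lt m (- x).
Proof. by move=> hx; rewrite -[- x]addr0 -scaleN1r; apply: SG_ltP => //; apply: SG_lt0. Qed.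

Lemma SG_lt_trans m n x : (m <= n)%N -> SG_lt m x -> SG_lt n x.
Proof. by move=> mn hx g; apply: leq_trans (hx g) mn. Qed.

Lemma SG_ltMg m x g : SG_lt m x -> SG_lt m (x * Sg g).
Proof. by move=> hx z; rewrite skew_coef_mulg. Qed.

Lemma SG_hom_lt m x : x \in SG_hom m -> SG_lt m.+1 x.
Proof.
move=> /SG_homP hx g; rewrite msizeE; apply/bigmax_leqP_seq => w ws _.
by rewrite (dhomog_mf (hx g) ws).
Qed.

Definition SG_part m (x : SG) : SG :=
  mk_skew (Sym_act rho) [ffun g => pihomog mdeg m (skew_coef x g)].

Lemma SG_partE m x g :
  skew_coef (SG_part m x) g = pihomog mdeg m (skew_coef x g).
Proof. exact: ffunE. Qed.

Lemma SG_part_is_linear m : linear (SG_part m).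
Proof.
move=> c x y; apply/skewP => g; rewrite skew_coefD skew_coefZ !SG_partE.
by rewrite skew_coefD skew_coefZ; apply: (linearP (pihomog mdeg m)).
Qed.
HB.instance Definition _ m :=
  GRing.isLinear.Build k SG SG _ (SG_part m) (SG_part_is_linear m).

Lemma SG_part_hom m x : SG_part m x \in SG_hom m.
Proof. by apply/SG_homP => g; rewrite SG_partE; apply: pihomogP. Qed.

Lemma SG_part_id m x : x \in SG_hom m -> SG_part m x = x.
Proof. by move=> /SG_homP hx; apply/skewP => g; rewrite SG_partE pihomog_dE. Qed.

Lemma SG_part_ne m n x : m != n -> x \in SG_hom m -> SG_part n x = 0.
Proof.
move=> mn /SG_homP hx; apply/skewP => g.
by rewrite SG_partE (pihomog_ne0 mn (hx g)) [RHS]ffunE.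
Qed.

Lemma SG_part_lt m x : SG_lt m x -> SG_part m x = 0.
Proof.
move=> hx; apply/skewP => g; rewrite SG_partE [RHS]ffunE.
rewrite pihomogE big_seq_cond big1 // => w /andP [/msize_mdeg_lt ws /eqP e].
by have := leq_trans ws (hx g); rewrite e ltnn.
Qed.

(** The quotient map T(V) # G -> S # G. *)
Definition TGpi : TG -> SG := @TGlift _ _ _ rho SG vS Sg.
HB.instance Definition _ := GRing.Linear.on TGpi.

Lemma TGpiM x y : TGpi (x * y) = TGpi x * TGpi y.
Proof.
apply: TGliftM; [exact: skewgM|exact: Sg_vS].
Qed.
Lemma TGpiP c x y : TGpi (c *: x + y) = c *: TGpi x + TGpi y.
Proof. exact: linearP. Qed.
Lemma TGpi_v v : TGpi (vT v) = vS v.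
Proof. by apply: TGlift_v; exact: skewU_1. Qed.
Lemma TGpi_g g : TGpi (Tg g) = Sg g.
Proof. exact: TGlift_g. Qed.

(** The exponent vector of the commutative image of a word. *)
Definition wmnm (s : seq I) : 'X_{1.. \dim {:V}} := [multinom count_mem i s | i < _].

Lemma wmnmE s i : wmnm s i = count_mem i s.
Proof. exact: mnmE. Qed.

Lemma mdeg_wmnm s : mdeg (wmnm s) = size s.
Proof.
rewrite mdegE; under eq_bigr do rewrite wmnmE.
elim: s => [|i s IH] /=; first by rewrite big1.
rewrite big_split /= IH (bigD1 i) //= eqxx big1 ?addn0 // => j /negPf ji.
by rewrite eq_sym ji.
Qed.

Lemma TGpi_word s g : TGpi (TU (wordT s) g) = SU 'X_[wmnm s] g.
Proof.
elim: s => [|i s IH].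
  rewrite TU_word_nil TGpi_g /skewg; congr (SU _ _).
  by rewrite -mpolyX0; congr 'X_[_].
rewrite TU_word_cons TGpiM TGpi_v /vSG IH -skewU_mul1 symX_vbasis -mpolyXD.
congr (SU 'X_[_] _); apply/mnmP => j; by rewrite mnmDE mnm1E !wmnmE.
Qed.

Lemma SU_hom m a g : (a : {mpoly k[_]}) \is m.-homog -> SU a g \in SG_hom m.
Proof.
by move=> ha; apply/SG_homP => h; rewrite skewUE; case: ifP => // _; rewrite rpred0.
Qed.

Lemma TGpi_word_hom s g : TGpi (TU (wordT s) g) \in SG_hom (size s).
Proof. by rewrite TGpi_word; apply: SU_hom; rewrite dhomogX /= mdeg_wmnm. Qed.

Definition symbol m (x : TG) : SG := SG_part m (TGpi x).
HB.instance Definition _ m := GRing.Linear.copy (symbol m) (SG_part m \o TGpi).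

Lemma symbolP m c x y : symbol m (c *: x + y) = c *: symbol m x + symbol m y.
Proof. exact: linearP. Qed.

Lemma symbol0 m : symbol m 0 = 0. Proof. exact: linear0. Qed.

Lemma symbolD m x y : symbol m (x + y) = symbol m x + symbol m y.
Proof. exact: linearD. Qed.

Lemma symbolB m x y : symbol m (x - y) = symbol m x - symbol m y.
Proof. exact: linearB. Qed.

Lemma symbol_hom m x : symbol m x \in SG_hom m.
Proof. exact: SG_part_hom. Qed.

Lemma symbol_word s g : symbol (size s) (TU (wordT s) g) = TGpi (TU (wordT s) g).
Proof. by rewrite /symbol SG_part_id // TGpi_word_hom. Qed.

(** Symbols only see the top degree: words of length other than m contribute to other
    homogeneous components. *)
Lemma symbol_lt m n x : (n < m)%N -> x \in TG_le n -> symbol m x = 0.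
Proof.
move=> nm; elim/TG_le_ind => [|c a b IHa IHb|s g sn]; first exact: symbol0.
  by rewrite symbolP IHa IHb scaler0 addr0.
rewrite /symbol (@SG_part_ne (size s)) ?TGpi_word_hom //.
by rewrite neq_ltn (leq_ltn_trans sn nm).
Qed.

(** Both sides are bilinear, so the identity is checked on words, where a word shorter than
    the nominal degree has symbol zero on either side. *)
Lemma symbolM m n x y : x \in TG_le m -> y \in TG_le n ->
  symbol (m + n) (x * y) = symbol m x * symbol n y.
Proof.
move=> hx hy; move: x hx; apply: TG_le_ind => [|c a b IHa IHb|s g].
- by rewrite mul0r !symbol0 mul0r.
- rewrite mulrDl -scalerAl [LHS]symbolP (symbolP m c a b) mulrDl -scalerAl.
  by congr (_ *: _ + _); [exact: IHa | exact: IHb].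
rewrite leq_eqVlt => /orP [/eqP <-{m}|sm]; last first.
  rewrite (symbol_lt sm (TG_le_word rho s g)) mul0r.
  apply: (@symbol_lt _ (size s + n)); first by rewrite ltn_add2r.
  by apply: TG_leM hy; apply: TG_le_word.
move: y hy; apply: TG_le_ind => [|c a b IHa IHb|t h].
- by rewrite mulr0 !symbol0 mulr0.
- rewrite mulrDr -scalerAr [LHS]symbolP (symbolP n c a b) mulrDr -scalerAr.
  by congr (_ *: _ + _); [exact: IHa | exact: IHb].
rewrite leq_eqVlt => /orP [/eqP <-{n}|tn]; last first.
  rewrite (symbol_lt tn (TG_le_word rho t h)) mulr0.
  apply: (@symbol_lt _ (size s + size t)); first by rewrite ltn_add2l.
  by apply: TG_leM; apply: TG_le_word.
rewrite !symbol_word {1}/symbol TGpiM SG_part_id //.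
by apply: SG_homM; apply: TGpi_word_hom.
Qed.

Lemma TGpi_symbol m x : x \in TG_le m -> SG_lt m (TGpi x - symbol m x).
Proof.
move: x; apply: TG_le_ind => [|c a b IHa IHb|s g].
- by rewrite symbol0 linear0 subr0; apply: SG_lt0.
- rewrite symbolP TGpiP opprD addrACA -scalerBr; apply: SG_ltP; [exact: IHa | exact: IHb].
rewrite leq_eqVlt => /orP [/eqP <-{m}|sm].
  by rewrite symbol_word subrr; apply: SG_lt0.
rewrite (symbol_lt sm (TG_le_word rho s g)) subr0.
exact: SG_lt_trans sm (SG_hom_lt (TGpi_word_hom s g)).
Qed.

(** A monomial spelt as a word with letters in increasing order: the standard monomials. *)
Definition mword (mu : 'X_{1.. \dim {:V}}) : seq I :=
  flatten [seq nseq (mu i) i | i <- enum I].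

Lemma count_mword mu i : count_mem i (mword mu) = mu i.
Proof.
rewrite /mword count_flatten -map_comp sumnE big_map big_enum /= (bigD1 i) //=.
rewrite big1 ?addn0 => [|j /negPf ji]; rewrite count_nseq /= ?eqxx ?mul1n //.
by rewrite ji mul0n.
Qed.

Lemma wmnm_mword mu : wmnm (mword mu) = mu.
Proof. by apply/mnmP => i; rewrite wmnmE count_mword. Qed.

Lemma perm_mword s : perm_eq s (mword (wmnm s)).
Proof. by apply/allP => i _ /=; rewrite count_mword wmnmE eqxx. Qed.

Lemma size_mword mu : size (mword mu) = mdeg mu.
Proof. by rewrite -mdeg_wmnm wmnm_mword. Qed.

(** Linear section of the symbol map, through standard monomials. *)
Definition symlift m (x : SG) : TG :=
  \sum_g \sum_(mu : bmultinom (\dim {:V}) m.+1)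
    mcoeff mu (skew_coef x g) *: TU (wordT (mword mu)) g.

Lemma symlift_is_linear m : linear (symlift m).
Proof.
move=> c x y; rewrite /symlift scaler_sumr -big_split; apply: eq_bigr => g _.
rewrite scaler_sumr -big_split; apply: eq_bigr => mu _.
by rewrite skew_coefD skew_coefZ mcoeffD mcoeffZ scalerDl scalerA.
Qed.
HB.instance Definition _ m :=
  GRing.isLinear.Build k SG TG _ (symlift m) (symlift_is_linear m).

Lemma symliftP m c x y :
  symlift m (c *: x + y) = c *: symlift m x + symlift m y.
Proof. exact: linearP. Qed.

Lemma symlift_le m x : symlift m x \in TG_le m.
Proof.
apply: rpred_sum => g _; apply: rpred_sum => mu _; apply: rpredZ.
apply: TG_le_trans (TG_le_word _ _ _).
by rewrite size_mword -ltnS bmdeg.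
Qed.

Lemma symliftK m x : x \in SG_hom m -> symbol m (symlift m x) = x.
Proof.
move=> hx; rewrite /symbol -[RHS](SG_part_id hx); congr SG_part.
rewrite [RHS]skewU_sum /symlift linear_sum; apply: eq_bigr => g _.
rewrite linear_sum [in RHS](mpolywE (k := m.+1) (p := skew_coef x g)); last first.
  exact: SG_hom_lt hx g.
rewrite -[RHS]/(skewUr _ _ _) linear_sum; apply: eq_bigr => mu _.
by rewrite linearZ /= TGpi_word wmnm_mword linearZ.
Qed.

Lemma symlift_word s g :
  symlift (size s) (TGpi (TU (wordT s) g)) = TU (wordT (mword (wmnm s))) g.
Proof.
rewrite TGpi_word /symlift (bigD1 g) //= [X in _ + X]big1 ?addr0; last first.
  move=> h /negPf hg; rewrite big1 // => mu _.
  by rewrite skewUE hg mcoeff0 scale0r.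
have h : (mdeg (wmnm s) < (size s).+1)%N by rewrite mdeg_wmnm.
rewrite (bigD1 (BMultinom h)) //= big1 ?addr0 => [|mu ne].
  by rewrite skewUE eqxx mcoeffX eqxx scale1r.
rewrite skewUE eqxx mcoeffX; case: eqP => [e|_]; last by rewrite scale0r.
by case/eqP: ne; apply: val_inj.
Qed.
End Symbol.

(** * The PBW condition as a statement on leading symbols *)

(** The space X is finite-dimensional through the coordinates i and j, but need not carry
    a [vectType] structure itself. *)
Lemma surj_endo_inj (k : fieldType) (W : vectType k) (X : lmodType k)
    (i : {linear X -> W}) (j : {linear W -> X}) (f : X -> X) :
    cancel i j -> cancel j i -> linear f -> (forall y, exists x, f x = y) ->
  injective f.
Proof.
move=> ij ji fl fs.
have gl : linear (i \o f \o j).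
  by move=> c a b; rewrite /= [j _]linearP fl [LHS]linearP.
pose g : 'End(W) := linfun (HB.pack_for {linear W -> W} (i \o f \o j)
  (GRing.isLinear.Build k W W _ (i \o f \o j) gl)).
have gE w : g w = i (f (j w)) by rewrite lfunE.
have gs : limg g = fullv.
  apply/eqP; rewrite eqEsubv subvf; apply/subvP => w _.
  have [x fx] := fs (j w); apply/memv_imgP; exists (i x); rewrite ?memvf //.
  by rewrite gE ij fx ji.
have g0 : lker g == 0%VS.
  have := limg_ker_dim g fullv; rewrite capfv gs -[in RHS](add0n (\dim _)).
  by move/addIn/eqP; rewrite dimv_eq0.
move=> x y fxy; rewrite -[x]ij -[y]ij; congr (j _).
by apply: (lker0P g0); rewrite !gE !ij fxy.
Qed.

Lemma qm_pi_linear (k : pzRingType) (M : lmodType k) (N : submodClosed M) c x y :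
  qm_pi N (c *: x + y) = c *: qm_pi N x + qm_pi N y.
Proof.
by rewrite -[RHS]/(qm_add (qm_scale c (qm_pi N x)) (qm_pi N y)) qm_scaleE qm_addE.
Qed.

Section Graded.
Context (k : fieldType) (gT : finGroupType) (V : vectType k).
Variable rho : linrep gT V.
Local Notation TG := (TG rho).
Local Notation SG := (SG rho).
Local Notation TU := (skewU (Tens_act rho)).
Local Notation Tg := (skewg (Tens_act rho)).
Local Notation vT := (vTG rho).
Local Notation TG_le := (@TG_le k gT V rho).
Local Notation SG_hom := (@SG_hom k gT V rho).
Local Notation symbol := (@symbol k gT V rho).
Local Notation symlift := (@symlift k gT V rho).

Variable kappa : V -> V -> target gT V.
Local Notation idl := (ideal_gen (@relation k gT V rho kappa)).
Local Notation Hpi := (@H_pi k gT V rho kappa).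

(** Filtration degree below m, with only 0 below degree 0, as in the definition of the
    associated graded algebra. *)
Definition TG_lt m (x : TG) : Prop :=
  if m is m'.+1 then x \in TG_le m' else x = 0.

(** The elements of degree at most m whose class in the degree m component of the
    associated graded algebra is zero. *)
Definition lower m (x : TG) : Prop := exists2 y, TG_lt m y & x - y \in idl.

Lemma TG_ltP m c x y : TG_lt m x -> TG_lt m y -> TG_lt m (c *: x + y).
Proof.
case: m => [-> ->|m] /=; first by rewrite scaler0 addr0.
by move=> hx hy; rewrite rpredD ?rpredZ.
Qed.

Lemma TG_lt0 m : TG_lt m 0.
Proof. by case: m => [|m] //=; apply: rpred0. Qed.

Lemma TG_lt_trans m n x : (m <= n)%N -> TG_lt m x -> TG_lt n x.
Proof.
case: m n => [|m] [|n] //=; first by move=> _ ->; apply: rpred0.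
by rewrite ltnS; apply: TG_le_trans.
Qed.

Lemma TG_ltM m n x y : x \in TG_le m -> TG_lt n y -> TG_lt (m + n) (x * y).
Proof.
case: n => [|n] /=; first by move=> _ ->; rewrite mulr0; apply: TG_lt0.
by move=> hx hy; rewrite addnS; apply: TG_leM.
Qed.

Lemma TG_ltMr m n x y : TG_lt m x -> y \in TG_le n -> TG_lt (m + n) (x * y).
Proof.
case: m => [|m] /=; first by move=> -> _; rewrite mul0r; apply: TG_lt0.
by move=> hx hy; apply: TG_leM.
Qed.

Lemma lowerP m c x y : lower m x -> lower m y -> lower m (c *: x + y).
Proof.
move=> [x' hx ix] [y' hy iy]; exists (c *: x' + y'); first exact: TG_ltP.
by rewrite opprD addrACA -scalerBr rpredD ?rpredZ.
Qed.

Lemma lower0 m : lower m 0.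
Proof. by exists 0; [apply: TG_lt0 | rewrite subrr rpred0]. Qed.

Lemma lowerD m x y : lower m x -> lower m y -> lower m (x + y).
Proof. by move=> hx; rewrite -[x]scale1r; apply: lowerP. Qed.

Lemma lower_lt m x : TG_lt m x -> lower m x.
Proof. by exists x; rewrite ?subrr ?rpred0. Qed.

Lemma lower_idl m x : x \in idl -> lower m x.
Proof. by exists 0; [apply: TG_lt0 | rewrite subr0]. Qed.

Lemma lowerMl m n a x : a \in TG_le m -> lower n x -> lower (m + n) (a * x).
Proof.
move=> ha [y hy i]; exists (a * y); first exact: TG_ltM.
by rewrite -mulrBr; apply: ideal_genMl.
Qed.

Lemma lowerMr m n a x : lower m x -> a \in TG_le n -> lower (m + n) (x * a).
Proof.
move=> [y hy i] ha; exists (y * a); first exact: TG_ltMr.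
by rewrite -mulrBl; apply: ideal_genMr.
Qed.

Lemma ideal_genX (A : algType k) (X : A -> Prop) x : X x -> x \in ideal_gen X.
Proof.
move=> Xx; apply/asboolP; exists [:: (1, x, 1)]; split.
  by move=> t; rewrite inE => /eqP ->.
by rewrite big_seq1 /= mul1r mulr1.
Qed.

Lemma target_TG_le u : target_TG rho u \in TG_le 1.
Proof.
apply/TG_leP => g; rewrite [skew_coef _ _]ffunE; apply: rpredD; last exact: tensX_le.
by apply: rpredZ; apply: Tens_le_trans (Tens_le1 V).
Qed.

(** Commutators of vectors equal kappa modulo the relations, so they lose one degree. This
    is why the associated graded algebra is a quotient of S # G. *)
Lemma lower_comm v w : lower 2 (vT v * vT w - vT w * vT v).
Proof.
exists (target_TG rho (kappa v w)); first exact: target_TG_le.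
by apply: ideal_genX; exists v, w.
Qed.

Local Notation W s := (TU (wordT s) 1%g).

Lemma lower_move i s t :
  lower (size s + size t).+1 (W (i :: s ++ t) - W (s ++ i :: t)).
Proof.
elim: s => [|j s IH]; first by rewrite subrr; apply: lower0.
rewrite -[X in X - _](subrK (W (j :: i :: s ++ t))) -addrA.
apply: lowerD; last first.
  rewrite /= (TU_word_cons _ j (i :: s ++ t)) (TU_word_cons _ j (s ++ i :: t)).
  by rewrite -mulrBr; apply: (@lowerMl 1) IH; apply: TG_le_v.
rewrite (TU_word_cons _ i (j :: s ++ t)) (TU_word_cons _ j (s ++ t)).
rewrite (TU_word_cons _ j (i :: s ++ t)) (TU_word_cons _ i (s ++ t)).
rewrite [X in lower _ (X - _)]mulrA [X in lower _ (_ - X)]mulrA -mulrBl.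
have -> : (size (j :: s) + size t).+1 = (2 + size (s ++ t))%N by rewrite size_cat.
apply: lowerMr; first exact: lower_comm.
exact: TG_le_word.
Qed.

(** Permuting the letters of a word does not change its class in the associated graded
    algebra. *)
Lemma lower_perm s t : perm_eq s t -> lower (size s) (W s - W t).
Proof.
elim: s t => [|i s IH] t st.
  by move: st; rewrite perm_sym => /perm_nilP ->; rewrite subrr; apply: lower0.
have ti : i \in t by rewrite -(perm_mem st) mem_head.
case/splitPr: ti st => t1 t2 st.
have {}st : perm_eq s (t1 ++ t2).
  rewrite -(perm_cons i); apply: (perm_trans st).
  by rewrite -cat_cons perm_catC /= perm_cons perm_catC.
rewrite -[X in X - _](subrK (W (i :: t1 ++ t2))) -addrA; apply: lowerD.
  rewrite (TU_word_cons _ i s) (TU_word_cons _ i (t1 ++ t2)) -mulrBr.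
  by apply: (@lowerMl 1) (IH _ st); apply: TG_le_v.
rewrite /= (perm_size st) size_cat; exact: lower_move.
Qed.

Lemma lower_section m x : x \in TG_le m -> lower m (symlift m (symbol m x) - x).
Proof.
move: x; apply: TG_le_ind => [|c a b IHa IHb|s g].
- by rewrite symbol0 linear0 subrr; apply: lower0.
- rewrite symbolP symliftP opprD addrACA -scalerBr.
  by apply: lowerP; [exact: IHa | exact: IHb].
rewrite leq_eqVlt => /orP [/eqP <-{m}|sm].
  rewrite symbol_word symlift_word !(skewUg _ _ g) -mulrBl.
  rewrite -[X in lower X]addn0; apply: lowerMr; last exact: TG_le_g.
  rewrite [in X in lower X](perm_size (perm_mword s)).
  by apply: lower_perm; rewrite perm_sym perm_mword.
rewrite (symbol_lt sm (TG_le_word rho s g)) linear0 sub0r.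
apply: lower_lt; apply: (@TG_lt_trans (size s).+1) => //=.
by rewrite rpredN; apply: TG_le_word.
Qed.

Local Notation HF := (Hfilt rho kappa).

Lemma H_pi_eq x y : (Hpi x = Hpi y) <-> (x - y \in idl).
Proof. exact: qm_piE. Qed.

Lemma H_piD x y : Hpi (x + y) = Hpi x + Hpi y.
Proof. by rewrite /H_pi qm_piD. Qed.
Lemma H_piZ c x : Hpi (c *: x) = c *: Hpi x.
Proof. by rewrite /H_pi qm_piZ. Qed.

Lemma H_piB x y : Hpi (x - y) = Hpi x - Hpi y.
Proof. by rewrite H_piD -(scaleN1r y) H_piZ scaleN1r. Qed.

Lemma H_pi_eq0 x : (Hpi x = 0) <-> (x \in idl).
Proof. by rewrite -[0]/(Hpi 0) H_pi_eq subr0. Qed.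

Lemma H_filP m x : x \in TG_le m -> Hpi x \in fil HF m.
Proof. by move=> hx; apply/asboolP; exists x. Qed.

Definition gcl m x (hx : x \in TG_le m) : gr_comp HF m :=
  @gr_pi k HF m (@SubM k HF (fil HF m) (Hpi x) (H_filP hx)).

Lemma gcl_surj m (a : gr_comp HF m) : exists x, exists hx : x \in TG_le m, a = gcl hx.
Proof.
elim/qm_ind: a => -[a ha]; have /asboolP [x hx e] := ha.
exists x, hx; congr (qm_pi _ _); exact: val_inj.
Qed.

Lemma gcl_eq m x y (hx : x \in TG_le m) (hy : y \in TG_le m) :
  gcl hx = gcl hy <-> lower m (x - y).
Proof.
rewrite /gcl /gr_pi; split => [/qm_piE|].
  case: m hx hy => [|m] hx hy; rewrite unfold_in /=.
    by rewrite -[X in X == 0]H_piB => /eqP /H_pi_eq0; apply: lower_idl.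
  rewrite -[X in X \in _]H_piB => /asboolP [z hz /H_pi_eq i].
  by exists z.
move=> [z hz i]; apply/qm_piE.
have e : Hpi (x - y) = Hpi z by apply/H_pi_eq.
case: m hx hy hz => [|m] hx hy /= hz; rewrite unfold_in /=.
  by rewrite -[X in X == _]H_piB e; apply/eqP/H_pi_eq0; rewrite hz rpred0.
by rewrite -[X in X \in _]H_piB e; apply/asboolP; exists z.
Qed.

Lemma gcl_linear m c x y (hx : x \in TG_le m) (hy : y \in TG_le m)
    (h : c *: x + y \in TG_le m) :
  gcl h = c *: gcl hx + gcl hy.
Proof.
rewrite /gcl /gr_pi -[RHS]qm_pi_linear; congr (qm_pi _ _).
by apply: val_inj; rewrite /= H_piD H_piZ.
Qed.

(** The canonical map from S # G to the associated graded algebra, defined on the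
    standard monomials. *)
Definition gr_of m (s : subm (SG_hom m)) : gr_comp HF m := gcl (symlift_le m (val s)).

Lemma gr_of_linear m : linear (@gr_of m).
Proof.
move=> c s t; rewrite -gcl_linear; first by rewrite rpredD ?rpredZ ?symlift_le.
by move=> h; apply/gcl_eq; rewrite /= linearP subrr; apply: lower0.
Qed.

Lemma gr_of_symbol m x (hx : x \in TG_le m) :
  gr_of (SubM (symbol_hom m x)) = gcl hx.
Proof. by apply/gcl_eq; apply: lower_section. Qed.

Lemma gr_of_surj m a : exists s, @gr_of m s = a.
Proof.
have [x [hx ->]] := gcl_surj a; exists (SubM (symbol_hom m x)); exact: gr_of_symbol.
Qed.

Lemma gcl_mul m n x y (hx : x \in TG_le m) (hy : y \in TG_le n) :
  gr_mul (gcl hx) (gcl hy) = gcl (TG_leM hx hy).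
Proof.
rewrite /gcl gr_mulE; congr (gr_pi _); apply: val_inj => /=.
by rewrite [LHS]qa_mulE.
Qed.

(** The canonical surjection from S # G is injective, stated without quotients. *)
Definition PBW : Prop := forall m x, x \in TG_le m -> x \in idl -> symbol m x = 0.

Lemma PBW_lower m x : PBW -> x \in TG_le m -> lower m x -> symbol m x = 0.
Proof.
move=> pbw hx [y hy i].
have y0 : symbol m y = 0.
  case: m hy {hx} => [-> |m hy]; first exact: symbol0.
  exact: symbol_lt hy.
have yle : y \in TG_le m.
  case: m hy {hx y0} => [-> |m hy]; first exact: rpred0.
  exact: TG_le_trans hy.
have hxy : x - y \in TG_le m by apply: rpredB.
by have := pbw m _ hxy i; rewrite symbolB y0 subr0.
Qed.

Lemma gr_of_inj m : PBW -> injective (@gr_of m).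
Proof.
move=> pbw s t /gcl_eq l; apply: val_inj; apply/eqP; rewrite -subr_eq0; apply/eqP.
have hst : symlift m (val s) - symlift m (val t) \in TG_le m.
  by apply: rpredB; apply: symlift_le.
rewrite -(PBW_lower pbw hst l) symbolB.
by congr (_ - _); apply: esym; apply: symliftK; apply: sm_valP.
Qed.

(** A bijective canonical map is a graded isomorphism because symbols are multiplicative. *)
Lemma PBW_Drinfeld : PBW -> Drinfeld_orbifold rho kappa.
Proof.
move=> pbw.
have bij m : bijective (@gr_of m).
  have /boolp.choice [f fK] : forall a, exists s, @gr_of m s = a by exact: gr_of_surj.
  by exists f => // s; apply: (gr_of_inj pbw); rewrite fK.
have fex m : {f : {linear gr_comp HF m -> subm (SG_hom m)} |
    cancel (@gr_of m) f /\ cancel f (@gr_of m)}.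
  apply: cid; have [f fK Kf] := bij m.
  have fl : linear f.
    by move=> c a b; apply: (can_inj fK); rewrite Kf gr_of_linear !Kf.
  by exists (HB.pack_for {linear gr_comp HF m -> subm (SG_hom m)} f
    (GRing.isLinear.Build k _ _ _ f fl)).
pose f m := sval (fex m); have hf m := svalP (fex m).
have fcl m x (hx : x \in TG_le m) : f m (gcl hx) = SubM (symbol_hom m x).
  by rewrite -gr_of_symbol; apply: (hf m).1.
exists f; split.
- by move=> m; exists (@gr_of m); have [] := hf m.
- have h1 : 1 \in TG_le 0 by rewrite -(skewU_1 (Tens_act rho)); apply: TG_le_g.
  have -> : gone (gr HF) = gcl h1 by congr (gr_pi _); apply: val_inj.
  rewrite fcl; apply: val_inj => /=.
  rewrite -(skewU_1 (Tens_act rho)) -[skewU _ _ _]/(Tg 1%g) -TU_word_nil.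
  rewrite (symbol_word rho [::] 1%g) TU_word_nil TGpi_g; exact: skewU_1.
move=> m n a b.
have [x [hx ->]] := gcl_surj a; have [y [hy ->]] := gcl_surj b.
rewrite [gmul _ _]gcl_mul !fcl; apply: val_inj => /=.
exact: symbolM.
Qed.

Section Dimension.
Variable m : nat.

Local Notation CI := {p : gT * bmultinom (\dim {:V}) m.+1 | mdeg p.2 == m}.
Local Notation CW := {ffun CI -> k^o}.

(** Components of S # G are finite-dimensional: coordinates are the coefficients of the
    monomials of degree m at the group elements. *)
Definition to_coords (s : subm (SG_hom m)) : CW :=
  [ffun p : CI => (mcoeff (val p).2 (skew_coef (val s) (val p).1) : k^o)].

Definition of_coords_SG (c : CW) : SG := mk_skew (Sym_act rho)
  [ffun g => \sum_(p : CI | (val p).1 == g)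
    c p *: 'X_[(val p).2]].

Lemma of_coords_hom c : of_coords_SG c \in SG_hom m.
Proof.
apply/SG_homP => g; rewrite [skew_coef _ _]ffunE; apply: rpred_sum => p _.
by apply: rpredZ; rewrite dhomogX /= (eqP (valP p)).
Qed.

Definition of_coords (c : CW) : subm (SG_hom m) := SubM (of_coords_hom c).

Lemma to_coords_is_linear : linear to_coords.
Proof.
move=> c s t; apply/ffunP => p; rewrite !ffunE /= skew_coefD skew_coefZ.
by rewrite mcoeffD mcoeffZ.
Qed.
HB.instance Definition _ :=
  GRing.isLinear.Build k (subm (SG_hom m)) CW _ to_coords to_coords_is_linear.

Lemma of_coords_is_linear : linear of_coords.
Proof.
move=> c s t; apply: val_inj; apply/skewP => g /=.
rewrite skew_coefD skew_coefZ ![skew_coef _ g]ffunE scaler_sumr -big_split.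
by apply: eq_bigr => p _ /=; rewrite !ffunE scalerDl scalerA.
Qed.
HB.instance Definition _ :=
  GRing.isLinear.Build k CW (subm (SG_hom m)) _ of_coords of_coords_is_linear.

Lemma to_coordsK : cancel to_coords of_coords.
Proof.
move=> s; apply: val_inj; apply/skewP => g /=; rewrite [skew_coef _ _]ffunE.
have /SG_homP /(_ g) hg := valP s.
apply/mpolyP => mu; rewrite raddf_sum /=.
have [e|ne] := eqVneq (mdeg mu) m; last first.
  rewrite [RHS](dhomog_nemf_coeff hg ne) big1 // => p _.
  rewrite mcoeffZ mcoeffX; case: eqP => [e|]; last by rewrite mulr0.
  by case/eqP: ne; rewrite -e (eqP (valP p)).
have mul : (mdeg mu < m.+1)%N by rewrite e.
have pP : mdeg (g, BMultinom mul).2 == m by rewrite /= e.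
rewrite (bigD1 (exist _ (g, BMultinom mul) pP)) //= ffunE mcoeffZ mcoeffX eqxx mulr1.
rewrite big1 ?addr0 // => -[[h nu] hp] /= /andP [/eqP hg' ne].
rewrite mcoeffZ mcoeffX; case: eqP => [e'|]; last by rewrite mulr0.
by case/eqP: ne; apply: val_inj => /=; rewrite hg'; congr (_, _); apply: val_inj.
Qed.

Lemma of_coordsK : cancel of_coords to_coords.
Proof.
move=> c; apply/ffunP => p; rewrite ffunE /= [skew_coef _ _]ffunE raddf_sum /=.
rewrite (bigD1 p) //= mcoeffZ mcoeffX eqxx mulr1 big1 ?addr0 // => q /andP [/eqP e ne].
rewrite mcoeffZ mcoeffX; case: eqP => [e'|]; last by rewrite mulr0.
case/eqP: ne; apply: val_inj.
rewrite [LHS]surjective_pairing [RHS]surjective_pairing e; congr (_, _).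
exact: val_inj.
Qed.
End Dimension.

(** Composing the canonical surjection with a graded isomorphism gives a surjective
    endomorphism of each homogeneous component; it is injective since the component has
    finite dimension. So the isomorphism itself may be arbitrary. *)
Lemma Drinfeld_PBW : Drinfeld_orbifold rho kappa -> PBW.
Proof.
move=> [phi [bij _ _]] m x hx i.
have inj : injective (phi m \o @gr_of m).
  apply: (surj_endo_inj (@to_coordsK m) (@of_coordsK m)).
    by move=> c s t; rewrite /= gr_of_linear linearP.
  move=> t; have [f fK Kf] := bij m; have [s es] := gr_of_surj (f t).
  by exists s; rewrite /= es Kf.
have h0 : 0 \in TG_le m by rewrite rpred0.
have e : gcl hx = gcl h0 by apply/gcl_eq; rewrite subr0; apply: lower_idl.
have e2 : gr_of (SubM (symbol_hom m x)) = gr_of (SubM (symbol_hom m 0)).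
  by apply: etrans (gr_of_symbol hx) (etrans e _); apply: esym; apply: gr_of_symbol.
apply: etrans (symbol0 rho m).
exact: (congr1 (@sm_val _ _ _) (inj _ _ (congr1 (phi m) e2))).
Qed.
End Graded.

(** * Filtered isomorphisms and associated graded algebras *)

Lemma filtered_iso_sym (k : pzRingType) (A B : filtalg k) :
  filtered_iso A B -> filtered_iso B A.
Proof.
move=> [phi [[psi pK Kp] p1 pM pf]].
have pl : linear psi by move=> c x y; apply: (can_inj pK); rewrite Kp linearP !Kp.
exists (HB.pack_for {linear B -> A} psi (GRing.isLinear.Build k B A _ psi pl)); split.
- by exists phi.
- by rewrite /= -p1 pK.
- by move=> x y; rewrite /= -[x in LHS]Kp -[y in LHS]Kp -pM pK.
by move=> m x; rewrite /= -[x in RHS]Kp pf.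
Qed.

Section GrMap.
Context (k : pzRingType) (A B : filtalg k) (phi : {linear A -> B}).
Hypothesis phi_fil : forall m x, x \in fil A m -> phi x \in fil B m.

Definition fil_map m (x : subm (fil A m)) : subm (fil B m) :=
  SubM (phi_fil (sm_valP x)).

Definition gr_map m (a : gr_comp A m) : gr_comp B m := gr_pi (fil_map (gr_repr a)).

Lemma fil_map_pred m (x : subm (fil A m)) :
  x \in @fil_pred k A m -> fil_map x \in @fil_pred k B m.
Proof.
case: m x => [|m] x; rewrite !unfold_in /=.
  by move=> /eqP ->; rewrite linear0.
exact: phi_fil.
Qed.

Lemma gr_mapE m (x : subm (fil A m)) : gr_map (gr_pi x) = gr_pi (fil_map x).
Proof.
apply/qm_piE; have -> : fil_map (gr_repr (gr_pi x)) - fil_map x =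
    fil_map (gr_repr (gr_pi x) - x) by apply: val_inj; rewrite /= linearB.
by apply: fil_map_pred; apply: qm_repr_pi.
Qed.

Lemma gr_map_is_linear m : linear (@gr_map m).
Proof.
move=> c; elim/qm_ind=> x; elim/qm_ind=> y; rewrite -qm_pi_linear.
rewrite -![qm_pi _ _]/(gr_pi _) !gr_mapE -[RHS]qm_pi_linear; congr (qm_pi _ _).
by apply: val_inj; rewrite /= linearP.
Qed.
HB.instance Definition _ m :=
  GRing.isLinear.Build k (gr_comp A m) (gr_comp B m) _ (@gr_map m) (@gr_map_is_linear m).
End GrMap.

Lemma filtered_iso_gr (k : pzRingType) (A B : filtalg k) :
  filtered_iso A B -> graded_iso (gr A) (gr B).
Proof.
move=> [phi [[psi' pK Kp] p1 pM pf]].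
have pl : linear psi' by move=> c x y; apply: (can_inj pK); rewrite Kp linearP !Kp.
pose q : {linear B -> A} :=
  HB.pack_for {linear B -> A} psi' (GRing.isLinear.Build k B A _ psi' pl).
have qf m x : x \in fil B m -> q x \in fil A m by rewrite -pf /= Kp.
have pf' m x : x \in fil A m -> phi x \in fil B m by rewrite pf.
exists (fun m => @gr_map k A B phi pf' m : {linear _ -> _}); split.
- move=> m; exists (@gr_map k B A q qf m); elim/qm_ind=> x;
    rewrite -[qm_pi _ _]/(gr_pi x) /= !gr_mapE; congr (gr_pi _);
    by apply: val_inj; rewrite /= ?pK ?Kp.
- by rewrite /= gr_mapE; congr (gr_pi _); apply: val_inj.
move=> m n; elim/qm_ind=> x; elim/qm_ind=> y.
rewrite -![qm_pi _ _]/(gr_pi _) /= gr_mulE !gr_mapE gr_mulE; congr (gr_pi _).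
by apply: val_inj; rewrite /= pM.
Qed.

Lemma graded_iso_trans (k : pzRingType) (A B C : gralg k) :
  graded_iso A B -> graded_iso B C -> graded_iso A C.
Proof.
move=> [f [fb f1 fM]] [g [gb g1 gM]].
exists (fun m => (g m \o f m : {linear _ -> _})); split.
- by move=> m; apply: (bij_comp (gb m) (fb m)).
- by rewrite /= f1 g1.
by move=> m n a b; rewrite /= fM gM.
Qed.

(** * Straightening of words *)

Section Straightening.
Context (n : nat) (M : zmodType) (N : nat).
Local Notation I := 'I_n.
Variables (c : seq I -> I -> I -> seq I -> M) (P : M -> Prop).
Hypothesis P0 : P 0.
Hypothesis PD : forall x y, P x -> P y -> P (x + y).
Hypothesis Pc : forall a i j b, (size a + size b).+2 = N -> P (c a i j b).
Hypothesis c_anti : forall a i j b, c a i j b = - c a j i b.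
Hypothesis c_diag : forall a i b, c a i i b = 0.
Hypothesis c_comm : forall a i j b l m e,
  (size a + size b + size e + 4 = N)%N ->
  c a i j (b ++ l :: m :: e) + c (a ++ j :: i :: b) l m e =
  c (a ++ i :: j :: b) l m e + c a i j (b ++ m :: l :: e).
Hypothesis c_braid : forall a i j l b, (size a + size b + 3 = N)%N ->
  c a i j (l :: b) + c (rcons a j) i l b + c a j l (i :: b) =
  c (rcons a i) j l b + c a i l (j :: b) + c (rcons a l) i j b.

(** Returned as prefix, the two letters of the descent, and suffix. *)
Fixpoint first_descent (s : seq I) : option (seq I * I * I * seq I) :=
  if s is i :: s' then
    if s' is j :: b then
      if (j < i)%N then Some ([::], i, j, b)
      else omap (fun t => (i :: t.1.1.1, t.1.1.2, t.1.2, t.2)) (first_descent s')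
    else None
  else None.

Lemma first_descent_cons x y s : first_descent (x :: y :: s) =
  if (y < x)%N then Some ([::], x, y, s)
  else omap (fun t => (x :: t.1.1.1, t.1.1.2, t.1.2, t.2)) (first_descent (y :: s)).
Proof. by []. Qed.

Lemma first_descent_some s a i j b :
  first_descent s = Some (a, i, j, b) -> s = a ++ i :: j :: b /\ (j < i)%N.
Proof.
elim: s a => [|x [|y s] IH] a //; rewrite first_descent_cons; case: ltnP => [lt|_].
  by case=> <- <- <- <-.
case E: (first_descent _) IH => [[[[a' i'] j'] b']|] // IH [<- ei ej eb].
by have [|-> ?] := IH a'; rewrite ?ei ?ej ?eb.
Qed.

Lemma first_descent_min (a b : seq I) (i j : I) : (j < i)%N ->
  exists a' i' j' b', first_descent (a ++ i :: j :: b) = Some (a', i', j', b')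
    /\ (size a' <= size a)%N.
Proof.
move=> ji; elim: a => [|x a [a' [i' [j' [b' [IH le]]]]]].
  by exists [::], i, j, b; rewrite first_descent_cons ji.
have [y [s e]] : exists y s, a ++ i :: j :: b = y :: s.
  by case: (a) => [|y a'']; [exists i, (j :: b) | exists y, (a'' ++ i :: j :: b)].
rewrite cat_cons e first_descent_cons; rewrite e in IH.
case: ltnP => _; first by exists [::], x, y, s.
by exists (x :: a'), i', j', b'; rewrite IH.
Qed.

(** The number of exchanges that sorting needs; it serves as the fuel of [straighten]. *)
Fixpoint inversions (s : seq I) : nat :=
  if s is i :: s' then (count (fun j : I => (j < i)%N) s' + inversions s')%N else 0%N.

Lemma inversions_swap (a b : seq I) (i j : I) : (j < i)%N ->
  inversions (a ++ i :: j :: b) = (inversions (a ++ j :: i :: b)).+1.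
Proof.
move=> ji; elim: a => [|x a IH] /=.
  by rewrite ji ltnNge (ltnW ji) /= add0n -addnA add1n addnCA.
rewrite IH addnS; congr (_ + _).+1; rewrite !count_cat /=.
by congr (_ + _)%N; rewrite addnCA.
Qed.

Fixpoint straighten_rec (d : nat) (s : seq I) : M :=
  if d is d'.+1 then
    if first_descent s is Some (a, i, j, b) then
      straighten_rec d' (a ++ j :: i :: b) + c a i j b
    else 0
  else 0.

(** Corrections accumulated while sorting a word by removing its first descent repeatedly.
    The parameter [c a i j b] stands for the correction picked up when the adjacent letters
    [i], [j] between [a] and [b] are exchanged. *)
Definition straighten s := straighten_rec (inversions s) s.

Lemma straighten_first s a i j b : first_descent s = Some (a, i, j, b) ->
  straighten s = straighten (a ++ j :: i :: b) + c a i j b.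
Proof.
move=> fd; have [es ji] := first_descent_some fd.
have ei : inversions s = (inversions (a ++ j :: i :: b)).+1.
  by rewrite es inversions_swap.
by rewrite /straighten ei /= fd.
Qed.

(** Any descent may be removed first. Two descents that do not overlap commute by the
    hypothesis [c_comm]; two overlapping ones lead to a word with three decreasing letters,
    whose two sorting orders agree by [c_braid]. Induction on the number of inversions. *)
Lemma straighten_descent (a b : seq I) (i j : I) : (size a + size b).+2 = N -> (j < i)%N ->
  straighten (a ++ i :: j :: b) = straighten (a ++ j :: i :: b) + c a i j b.
Proof.
have [d] := ubnP (inversions (a ++ i :: j :: b)).
elim: d a b i j => // d IH a b i j ltd sz ji.
have [a' [i' [j' [b' [fd le]]]]] := first_descent_min a b ji.
have [es ji'] := first_descent_some fd.
rewrite (straighten_first fd).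
have ltd' : (inversions (a' ++ j' :: i' :: b') < d)%N.
  by rewrite -ltnS (leq_trans _ ltd) // es (inversions_swap _ _ ji').
have ltd2 : (inversions (a ++ j :: i :: b) < d)%N.
  by rewrite -ltnS (leq_trans _ ltd) // (inversions_swap _ _ ji).
(* The first descent starts at or before the given one; compare their positions. *)
have ea : a = a' ++ drop (size a') a.
  rewrite -{1}(cat_take_drop (size a') a); congr (_ ++ _).
  have := congr1 (take (size a')) es; rewrite [in RHS]take_size_cat // => e.
  by rewrite -[RHS]e takel_cat.
case: (drop _ _) ea => [|x [|y m]] ea; rewrite ea -?catA /= in es *;
  move/eqP: es; rewrite eqseq_cat // eqxx /= ?cats0 => /eqP [].
(* The two descents coincide. *)
- by move=> <- <- <-.
(* They overlap in one letter. *)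
- move=> ex ei eb; subst x j' b'; rewrite ea cats1 in ltd2 sz *.
  have sz' : (size a' + size b + 3 = N)%N by rewrite -sz size_rcons addn3.
  rewrite -(cat_rcons i) (IH (rcons a' i)) ?cat_rcons ?(ltn_trans ji) //; last first.
    by rewrite -sz !size_rcons.
  rewrite (IH a' (i' :: b)) //; last first.
  + by rewrite -sz' addn3 /= addnS.
  + apply: ltn_trans ltd'.
    rewrite -(cat_rcons i a' [:: i', j & b]) -(cat_rcons i a' [:: j, i' & b]).
    by rewrite (inversions_swap _ _ (ltn_trans ji ji')).
  rewrite (IH a' (i :: b)) ?(ltn_trans ji) //; last first.
  + by rewrite -sz' addn3 /= addnS.
  + by rewrite cat_rcons in ltd2.
  rewrite -(cat_rcons j a' [:: i', i & b]) (IH (rcons a' j) b i' i) ?cat_rcons //; last first.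
  + by rewrite -sz !size_rcons.
  + rewrite cat_rcons in ltd2; apply: ltn_trans ltd2.
    by rewrite (inversions_swap a' (i :: b) (ltn_trans ji ji')).
  rewrite -!addrA; congr (_ + _); have H := c_braid i' i j sz'.
  by rewrite [LHS]addrC (addrC (c (rcons a' i) _ _ _)) H [RHS]addrC (addrC (c a' i' j _)).
(* They are disjoint. *)
move=> ex ey eb; subst x y b'; rewrite ea -catA /= in ltd2 sz *.
have sz' : (size a' + size m + size b + 4 = N)%N.
  by rewrite -sz size_cat /= !addnS addn0.
rewrite -[a' ++ j' :: i' :: _]/(a' ++ (j' :: i' :: m) ++ _) catA.
rewrite (IH (a' ++ j' :: i' :: m)) -?catA //; last first.
  by rewrite -sz !size_cat.
rewrite (IH a' (m ++ j :: i :: b)) //; last first.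
  by rewrite -sz' size_cat /= !addnS addn0 addnA.
by rewrite -!addrA; congr (_ + _); rewrite addrC c_comm // addrC.
Qed.

(** Diamond lemma: the corrections are realized as differences of values of a single
    function on words. *)
Lemma straighten_swap (a b : seq I) (i j : I) : (size a + size b).+2 = N ->
  straighten (a ++ i :: j :: b) - straighten (a ++ j :: i :: b) = c a i j b.
Proof.
move=> sz; case: (ltngtP i j) => [ij|ji|/val_inj ->].
- by rewrite (straighten_descent sz ij) opprD addrA subrr sub0r -c_anti.
- by rewrite (straighten_descent sz ji) addrAC subrr add0r.
by rewrite subrr c_diag.
Qed.

Lemma straighten_in s : size s = N -> P (straighten s).
Proof.
rewrite /straighten; move: (inversions s) => d.
elim: d s => [|d IH] s sz //=.
case fd: (first_descent s) => [[[[a i] j] b]|] //.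
have [es ji] := first_descent_some fd; rewrite es in sz.
apply: PD; first by apply: IH; rewrite -sz !size_cat.
by apply: Pc; rewrite -sz size_cat /= !addnS.
Qed.
End Straightening.

(** * The Jacobi identity modulo the relations *)

Lemma commutator_jacobi (R : pzRingType) (x y z : R) :
  (x * y - y * x) * z - z * (x * y - y * x)
  + ((y * z - z * y) * x - x * (y * z - z * y))
  + ((z * x - x * z) * y - y * (z * x - x * z)) = 0.
Proof.
rewrite !mulrBl !mulrBr !mulrA.
set a1 := x * y * z; set a2 := y * x * z; set a3 := z * x * y.
set a4 := z * y * x; set a5 := y * z * x; set a6 := x * z * y.
rewrite !opprB !addrA.
rewrite (ACl ((1*8)*(2*11)*(3*6)*(4*9)*(5*12)*(7*10))%AC) /=.
by rewrite !subrr !addNr !addr0.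
Qed.

(** The Jacobi identity read modulo r1, r2, r3: if k1, k2, k3 are commutators up to the r's,
    their own Jacobi sum is a combination of commutators with the r's. *)
Lemma commutator_jacobi_mod (R : pzRingType) (x y z k1 k2 k3 r1 r2 r3 : R) :
    k1 = x * y - y * x - r1 -> k2 = y * z - z * y - r2 -> k3 = z * x - x * z - r3 ->
  k1 * z - z * k1 + (k2 * x - x * k2) + (k3 * y - y * k3) =
  - (r1 * z - z * r1 + (r2 * x - x * r2) + (r3 * y - y * r3)).
Proof.
have E u (r w : R) : (u - r) * w - w * (u - r) = (u * w - w * u) - (r * w - w * r).
  by rewrite mulrBl mulrBr !opprB addrACA [RHS]addrACA; congr (_ + _); rewrite addrC.
have Z (a b c d e f : R) : (a - d) + (b - e) + (c - f) = (a + b + c) - (d + e + f).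
  by rewrite (addrACA a) (addrACA (a + b)) !opprD.
by move=> -> -> ->; rewrite (E _ r1) (E _ r2) (E _ r3) Z commutator_jacobi sub0r.
Qed.

Definition cyc3 (V : Type) (T : zmodType) (f : V -> V -> V -> T) v1 v2 v3 : T :=
  f v1 v2 v3 + f v2 v3 v1 + f v3 v1 v2.

Lemma cyc3D (V : Type) (T : zmodType) (f g h : V -> V -> V -> T) v1 v2 v3 :
    (forall u v w, f u v w = g u v w + h u v w) ->
  cyc3 f v1 v2 v3 = cyc3 g v1 v2 v3 + cyc3 h v1 v2 v3.
Proof.
by move=> e; rewrite /cyc3 !e (addrACA (g v1 v2 v3)) (addrACA (_ + g v2 v3 v1)).
Qed.

Section Jacobi.
Context (k : fieldType) (gT : finGroupType) (V : vectType k).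
Variable rho : linrep gT V.
Local Notation TG := (TG rho).
Local Notation Tg := (skewg (Tens_act rho)).
Local Notation vT := (vTG rho).
Local Notation TG_le := (@TG_le k gT V rho).
Local Notation tT := (target_TG rho).
Variable kappa : {bilinear V -> V -> target gT V}.
Local Notation idl := (ideal_gen (@relation k gT V rho kappa)).

Lemma target_coefP c (x y : target gT V) g :
  target_coef (c *: x + y) g = c *: target_coef x g + target_coef y g.
Proof. by rewrite /target_coef !ffunE. Qed.

Lemma target_TG_coef u g :
  skew_coef (tT u) g = (target_coef u g).1%:A + tensX (target_coef u g).2.
Proof. exact: ffunE. Qed.

Lemma target_TG_is_linear : linear tT.
Proof.
move=> c x y; apply/skewP => g.
have ex := target_TG_coef x g; have ey := target_TG_coef y g.
have E : skew_coef (c *: tT x + tT y) g =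
    c *: ((target_coef x g).1%:A + tensX (target_coef x g).2)
    + ((target_coef y g).1%:A + tensX (target_coef y g).2).
  apply: etrans (skew_coefD _ _ _) _; apply: (congr2 _ _ ey).
  by apply: etrans (skew_coefZ _ _ _) _; apply: congr1 ex.
apply: etrans (target_TG_coef _ _) (etrans _ (esym E)); move: {ex ey E} (target_coefP c x y g).
case: (target_coef x g) (target_coef y g) => a u [b v] ->.
rewrite /= (linearP (@tensX k V)) scalerDl (scalerDr c a%:A) -scalerA.
exact: addrACA.
Qed.
HB.instance Definition _ :=
  GRing.isLinear.Build k (target gT V) TG _ tT target_TG_is_linear.

Lemma target_TG_sum u : tT u =
  \sum_g ((target_coef u g).1 *: Tg g + vT (target_coef u g).2 * Tg g).
Proof.
rewrite [LHS]skewU_sum; apply: eq_bigr => g _.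
rewrite target_TG_coef skewUD skewUZ /skewg; congr (_ + _).
exact: skewUg.
Qed.

Definition klin v w g : V := (target_coef (kappa v w) g).2.
Definition kcst v w g : k := (target_coef (kappa v w) g).1.

Lemma klinPl c u v w g : klin (c *: u + v) w g = c *: klin u w g + klin v w g.
Proof. by rewrite /klin /target_coef linearPl !ffunE. Qed.
Definition kT v w : TG := tT (kappa v w).

Lemma kTE v w : kT v w =
  \sum_g (kcst v w g *: Tg g + vT (klin v w g) * Tg g).
Proof. exact: target_TG_sum. Qed.

Lemma kTPl c u v w : kT (c *: u + v) w = c *: kT u w + kT v w.
Proof. by rewrite /kT linearPl [LHS]linearP. Qed.
Definition krel v w : TG := vT v * vT w - vT w * vT v - kT v w.

Lemma krel_ideal v w : krel v w \in idl.
Proof. by apply: ideal_genX; exists v, w. Qed.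

(** Moving the group elements of [kappa(v1, v2), v3] to the right leaves three parts: this
    one of degree 2, then [Jlow] of degree at most 1 and [Jrel] in the ideal of relations. *)
Definition Jquad v1 v2 v3 : TG :=
  \sum_g vT (klin v1 v2 g) * vT (rho g v3 - v3) * Tg g.
Definition Jlow v1 v2 v3 : TG :=
  \sum_g (kcst v1 v2 g *: (vT (rho g v3 - v3) * Tg g) + kT (klin v1 v2 g) v3 * Tg g).
Definition Jrel v1 v2 v3 : TG := \sum_g krel (klin v1 v2 g) v3 * Tg g.

Lemma commutator_split (R : algType k) (c : k) (t w w' g : R) (a b : R) :
    g * w = w' * g ->
  (c *: g + a * g) * w - w * (c *: g + a * g) =
  a * (w' - w) * g + (c *: ((w' - w) * g) + b * g) + (a * w - w * a - b) * g.
Proof.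
move=> gw; rewrite mulrDl -scalerAl -(mulrA a g) gw mulrDr -scalerAr !mulrA.
rewrite !mulrBr !mulrBl scalerBr !opprD !addrA.
rewrite [RHS](ACl (3*1*4*7*(6*2)*(5*8))%AC) /=.
by rewrite !subrr !addr0.
Qed.

Lemma vT_B u v : vT (u - v) = vT u - vT v.
Proof. exact: linearB. Qed.

Lemma commutator_sum (R : algType k) (J : finType) (c : J -> k) (w : R)
    (a b d g : J -> R) : (forall j, g j * w = (w + d j) * g j) ->
  (\sum_j (c j *: g j + a j * g j)) * w - w * (\sum_j (c j *: g j + a j * g j)) =
  \sum_j a j * d j * g j + \sum_j (c j *: (d j * g j) + b j * g j)
  + \sum_j (a j * w - w * a j - b j) * g j.
Proof.
move=> gw; rewrite mulr_suml mulr_sumr -sumrB -!big_split; apply: eq_bigr => j _ /=.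
have -> : d j = (w + d j) - w by rewrite addrAC subrr add0r.
exact: commutator_split.
Qed.

Lemma kT_comm v1 v2 v3 : kT v1 v2 * vT v3 - vT v3 * kT v1 v2 =
  Jquad v1 v2 v3 + Jlow v1 v2 v3 + Jrel v1 v2 v3.
Proof.
rewrite kTE; apply: commutator_sum => g.
by apply: etrans (Tg_vT _ _ _) _; rewrite vT_B [vT v3 + _]addrC subrK.
Qed.

Lemma cyc_kT_ideal v1 v2 v3 :
  cyc3 (fun u v w => kT u v * vT w - vT w * kT u v) v1 v2 v3 \in idl.
Proof.
have E u v : kT u v = (vT u * vT v - vT v * vT u) - krel u v by rewrite /krel subKr.
have R u v w : krel u v * vT w - vT w * krel u v \in idl.
  by apply: rpredB; [apply: ideal_genMr | apply: ideal_genMl]; apply: krel_ideal.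
rewrite /cyc3 (commutator_jacobi_mod (E v1 v2) (E v2 v3) (E v3 v1)).
by apply: submodN; apply: rpredD; [apply: rpredD|]; apply: R.
Qed.

Lemma Jrel_ideal v1 v2 v3 : Jrel v1 v2 v3 \in idl.
Proof. by apply: rpred_sum => g _; apply: ideal_genMr; apply: krel_ideal. Qed.

Lemma cyc_kT_split v1 v2 v3 :
  cyc3 (fun u v w => kT u v * vT w - vT w * kT u v) v1 v2 v3 =
  cyc3 Jquad v1 v2 v3 + cyc3 Jlow v1 v2 v3 + cyc3 Jrel v1 v2 v3.
Proof.
rewrite -(@cyc3D _ _ (fun u v w => Jquad u v w + Jlow u v w)) //.
by apply: cyc3D => u v w; apply: kT_comm.
Qed.

(** The Jacobi identity makes the cyclic sum of [kappa(v1, v2), v3] vanish modulo relations;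
    the part [Jrel] is itself made of relations. *)
Lemma Jacobi_ideal v1 v2 v3 : cyc3 Jquad v1 v2 v3 + cyc3 Jlow v1 v2 v3 \in idl.
Proof.
have := cyc_kT_ideal v1 v2 v3; rewrite cyc_kT_split => h.
have R : cyc3 Jrel v1 v2 v3 \in idl.
  by apply: rpredD; [apply: rpredD|]; apply: Jrel_ideal.
by rewrite -[X in X \in _](addrK (cyc3 Jrel v1 v2 v3)); apply: rpredB.
Qed.

Lemma kT_le v w : kT v w \in TG_le 1. Proof. exact: target_TG_le. Qed.

Lemma krel_le v w : krel v w \in TG_le 2.
Proof.
apply: rpredB; last by apply: TG_le_trans (kT_le v w).
by apply: rpredB; apply: (@TG_leM _ _ _ rho 1 1); apply: TG_le_v.
Qed.

Lemma TG_leMg m x g : x \in TG_le m -> x * Tg g \in TG_le m.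
Proof. by move=> hx; rewrite -[m]addn0; apply: TG_leM hx (TG_le_g rho g). Qed.

Lemma Jquad_le v1 v2 v3 : Jquad v1 v2 v3 \in TG_le 2.
Proof.
apply: rpred_sum => g _; apply: TG_leMg.
by apply: (@TG_leM _ _ _ rho 1 1); apply: TG_le_v.
Qed.

(** The coefficients of [Jlow]; the constant part of kappa contributes through the action of
    g on v3, the linear part through composition of kappa with itself. *)
Definition Jtarget v1 v2 v3 : target gT V :=
  [ffun x => (\sum_g kcst (klin v1 v2 g) v3 (x * g^-1)%g : k^o,
    \sum_g klin (klin v1 v2 g) v3 (x * g^-1)%g + kcst v1 v2 x *: (rho x v3 - v3))].

Lemma Jlow_target v1 v2 v3 : Jlow v1 v2 v3 = tT (Jtarget v1 v2 v3).
Proof.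
apply/skewP => z; apply: etrans (esym (target_TG_coef _ _)).
rewrite /Jtarget /target_coef ffunE /= /Jlow big_split skew_coefD !skew_coef_sum.
rewrite linearD /= addrA addrC; congr (_ + _).
  rewrite (bigD1 z) //= big1 ?addr0 => [|g /negPf gz].
    rewrite skew_coefZ skew_coef_mulg mulgV skewUE eqxx.
    by rewrite linearZ.
  rewrite skew_coefZ skew_coef_mulg skewUE -eq_mulgV1 eq_sym gz.
  exact: scaler0.
rewrite scaler_suml linear_sum -big_split; apply: eq_bigr => g _ /=.
by rewrite skew_coef_mulg; apply: target_TG_coef.
Qed.
End Jacobi.

(** * Invariance and the Jacobi condition imply PBW *)

Section Functional.
Context (k : fieldType) (B : algType k) (M : lmodType k) (n N : nat).
Local Notation I := 'I_n.
Variables (F : {linear B -> M}) (v : I -> B) (kap : I -> I -> B).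
Local Notation W s := (\prod_(i <- s) v i).
Local Notation r i j := (v i * v j - v j * v i - kap i j).

Hypothesis kap_anti : forall i j, kap i j = - kap j i.
Hypothesis F_left : forall a i j b l m e, (size a + size b + size e + 4 = N)%N ->
  F (W a * r i j * (W b * kap l m * W e)) = 0.
Hypothesis F_right : forall a i j b l m e, (size a + size b + size e + 4 = N)%N ->
  F (W a * kap i j * W b * r l m * W e) = 0.
Hypothesis F_jac : forall a i j l b, (size a + size b + 3 = N)%N ->
  F (W a * ((kap i j * v l - v l * kap i j) + (kap j l * v i - v i * kap j l)
    + (kap l i * v j - v j * kap l i)) * W b) = 0.

(** When a functional F on words of length N - 1 is to be extended to length N so as to kill
    the relations, F(W a kap(i, j) W b) is the required difference of the values on
    a i j b and a j i b. *)
Definition correction a i j b : M := F (W a * kap i j * W b).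

Lemma prodW_cat s t : W (s ++ t) = W s * W t. Proof. exact: big_cat. Qed.
Lemma prodW_cons i s : W (i :: s) = v i * W s. Proof. exact: big_cons. Qed.
Lemma prodW_rcons i s : W (rcons s i) = W s * v i.
Proof. by rewrite -cats1 prodW_cat prodW_cons big_nil mulr1. Qed.

Lemma correction_anti a i j b : correction a i j b = - correction a j i b.
Proof. by rewrite /correction kap_anti mulrN mulNr linearN. Qed.

(** Both sides compute the effect of two disjoint exchanges; they differ by values of F on
    relations of smaller degree. *)
Lemma correction_comm a i j b l m e : (size a + size b + size e + 4 = N)%N ->
  correction a i j (b ++ l :: m :: e) + correction (a ++ j :: i :: b) l m e =
  correction (a ++ i :: j :: b) l m e + correction a i j (b ++ m :: l :: e).
Proof.
move=> sz; have L := F_left i j l m sz; have R := F_right i j l m sz.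
rewrite /correction !prodW_cat !prodW_cons.
have {}R : F (W a * kap i j * (W b * (v l * (v m * W e)))) =
    F (W a * kap i j * (W b * (v m * (v l * W e)))) + F (W a * kap i j * W b * kap l m * W e).
  apply/eqP; rewrite -subr_eq0 opprD addrA -!linearB /= -R; apply/eqP; congr (F _).
  by rewrite !mulrBr !mulrBl !mulrA.
have {}L : F (W a * (v i * (v j * W b)) * kap l m * W e) =
    F (W a * (v j * (v i * W b)) * kap l m * W e) + F (W a * kap i j * W b * kap l m * W e).
  apply/eqP; rewrite -subr_eq0 opprD addrA -!linearB /= -L; apply/eqP; congr (F _).
  by rewrite !mulrBr !mulrBl !mulrA.
by rewrite R L -addrA [RHS]addrC; congr (_ + _); rewrite addrC.
Qed.

(** The two ways to reverse i j l differ by F of the Jacobi sum of kap. *)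
Lemma correction_braid a i j l b : (size a + size b + 3 = N)%N ->
  correction a i j (l :: b) + correction (rcons a j) i l b + correction a j l (i :: b) =
  correction (rcons a i) j l b + correction a i l (j :: b) + correction (rcons a l) i j b.
Proof.
move=> sz; have J := F_jac i j l sz; rewrite /correction !prodW_rcons !prodW_cons.
apply/eqP; rewrite -subr_eq0 -!linearD -linearB /= -J; apply/eqP; congr (F _).
rewrite (kap_anti l i) !(mulNr, mulrN) !(mulrDr, mulrBr, mulrN, mulrDl, mulrBl, mulNr) !mulrA.
rewrite !opprD !opprK !addrA.
by rewrite [LHS](ACl (1*6*3*4*5*2)%AC).
Qed.
End Functional.

Section PBWproof.
Context (k : fieldType) (gT : finGroupType) (V : vectType k).
Variable rho : linrep gT V.
Local Notation TG := (TG rho).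
Local Notation SG := (SG rho).
Local Notation I := 'I_(\dim {:V}).
Local Notation TU := (skewU (Tens_act rho)).
Local Notation Tg := (skewg (Tens_act rho)).
Local Notation Sg := (skewg (Sym_act rho)).
Local Notation vT := (vTG rho).
Local Notation TG_le := (@TG_le k gT V rho).
Local Notation e_ i := ((vbasis {:V})`_i).
Local Notation pi := (@TGpi k gT V rho).

Definition wordTG (s : seq I) : TG := \prod_(i <- s) vT (e_ i).
Local Notation W := wordTG.

Lemma TU_prod1 s : TU (wordT s) 1%g = W s.
Proof.
elim: s => [|i s IH]; first by rewrite /W big_nil wordT_nil; apply: skewU_1.
by rewrite /W big_cons TU_word_cons; congr (_ * _).
Qed.

Lemma TU_prod s g : TU (wordT s) g = W s * Tg g.
Proof. by rewrite skewUg TU_prod1. Qed.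

Lemma W_le s : W s \in TG_le (size s).
Proof. by rewrite -TU_prod1; apply: TG_le_word. Qed.

Lemma pi_W_perm s t : perm_eq s t -> pi (W s) = pi (W t).
Proof.
move=> st; rewrite -(TU_prod1 s) -(TU_prod1 t).
rewrite !TGpi_word; congr (skewU _ 'X_[_] _).
by apply/mnmP => i; rewrite !wmnmE; have /seq.permP -> := st.
Qed.

(** The extension of a function on words to T(V) # G that is linear for the right action of G. *)
Definition word_functional (f : seq I -> SG) (x : TG) : SG :=
  \sum_g word_ext f (skew_coef x g) * Sg g.

Section FunctionalFacts.
Variable f : seq I -> SG.
Local Notation F := (word_functional f).

Lemma word_functional_is_linear : linear F.
Proof.
move=> c x y; rewrite /F scaler_sumr -big_split; apply: eq_bigr => g _ /=.
rewrite skew_coefD skew_coefZ [word_ext f _]linearP mulrDl.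
by congr (_ + _); rewrite -scalerAl.
Qed.
HB.instance Definition _ :=
  GRing.isLinear.Build k TG SG _ F word_functional_is_linear.

Lemma word_functionalP c x y : F (c *: x + y) = c *: F x + F y.
Proof. exact: linearP. Qed.
Lemma word_functional0 : F 0 = 0.
Proof. exact: linear0. Qed.
Lemma word_functionalE s g : F (TU (wordT s) g) = f s * Sg g.
Proof.
rewrite /F (bigD1 g) //= skewUE eqxx word_extE big1 ?addr0 // => h /negPf hg.
by rewrite skewUE hg linear0 mul0r.
Qed.

Lemma word_functional_W s : F (W s) = f s.
Proof.
rewrite -TU_prod1 word_functionalE.
by apply: etrans (congr1 (fun x => f s * x) (skewU_1 _)) _; rewrite mulr1.
Qed.

Lemma word_functional_g x h : F (x * Tg h) = F x * Sg h.
Proof.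
elim/TG_ind: x => [|c x y IHx IHy|s g].
- by rewrite mul0r word_functional0 mul0r.
- rewrite mulrDl -scalerAl [LHS]word_functionalP (word_functionalP c x y).
  by rewrite mulrDl -scalerAl; congr (_ *: _ + _); [exact: IHx | exact: IHy].
by rewrite -skewU_mulg !word_functionalE skewgM mulrA.
Qed.

Hypothesis f_top : forall s, SG_lt (size s) (f s - pi (W s)).

(** If f has the leading terms of the quotient map to S # G on words, so has its extension. *)
Lemma word_functional_top m x : x \in TG_le m -> SG_lt m (F x - pi x).
Proof.
move: x; apply: TG_le_ind => [|c x y IHx IHy|s g sm].
- by rewrite word_functional0 linear0 subr0; apply: SG_lt0.
- rewrite word_functionalP TGpiP opprD addrACA -scalerBr.
  by apply: SG_ltP; [exact: IHx | exact: IHy].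
apply: (SG_lt_trans sm); rewrite word_functionalE TU_prod TGpiM TGpi_g -mulrBl.
exact: SG_ltMg.
Qed.

Lemma pi_lt m x : x \in TG_le m -> SG_lt m.+1 (pi x).
Proof.
move=> hx; rewrite -[pi x](subrK (symbol m x)); apply: SG_ltD.
  by apply: SG_lt_trans (TGpi_symbol hx).
by apply: SG_hom_lt; apply: symbol_hom.
Qed.

Lemma word_functional_lt m x : x \in TG_le m -> SG_lt m.+1 (F x).
Proof.
move=> hx; rewrite -[F x](subrK (pi x)); apply: SG_ltD; last exact: pi_lt.
by apply: SG_lt_trans (word_functional_top hx).
Qed.
End FunctionalFacts.

Lemma word_functional_eq f1 f2 m x :
    (forall s, (size s <= m)%N -> f1 s = f2 s) -> x \in TG_le m ->
  word_functional f1 x = word_functional f2 x.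
Proof.
move=> e; move: x; apply: TG_le_ind => [|c x y IHx IHy|s g sm].
- by rewrite !word_functional0.
- rewrite (word_functionalP f1) (word_functionalP f2).
  by congr (_ *: _ + _); [exact: IHx | exact: IHy].
by rewrite !word_functionalE e.
Qed.
End PBWproof.

Section Sufficiency.
Context (k : fieldType) (gT : finGroupType) (V : vectType k).
Variable rho : linrep gT V.
Local Notation TG := (TG rho).
Local Notation SG := (SG rho).
Local Notation I := 'I_(\dim {:V}).
Local Notation Tg := (skewg (Tens_act rho)).
Local Notation vT := (vTG rho).
Local Notation TG_le := (@TG_le k gT V rho).
Local Notation e_ i := ((vbasis {:V})`_i).
Local Notation W := (@wordTG k gT V rho).
Local Notation pi := (@TGpi k gT V rho).
Local Notation F := (@word_functional k gT V rho).
Variable kappa : {bilinear V -> V -> target gT V}.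
Local Notation idl := (ideal_gen (@relation k gT V rho kappa)).
Local Notation kT := (@kT k gT V rho kappa).
Local Notation krel := (@krel k gT V rho kappa).

Hypothesis kalt : alternating kappa.
Hypothesis kinv : forall h v w, Tg h * kT v w = kT (rho h v) (rho h w) * Tg h.
Hypothesis kjac : forall v1 v2 v3,
  cyc3 (Jquad rho kappa) v1 v2 v3 + cyc3 (Jlow rho kappa) v1 v2 v3 = 0.

Lemma kT_alt v : kT v v = 0.
Proof. by rewrite /kT kalt; apply: linear0. Qed.

Lemma kappa_anti v w : kappa v w = - kappa w v.
Proof.
have := kalt (1 *: v + w); rewrite linearPl !linearPr !kalt !scale1r add0r addr0.
by move=> /eqP; rewrite addr_eq0 => /eqP.
Qed.

Lemma kT_anti v w : kT v w = - kT w v.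
Proof. by rewrite /kT kappa_anti; apply: (linearN (@target_TG k gT V rho)). Qed.

Lemma conj_rel (R : pzRingType) (g v w v' w' x x' : R) :
    g * v = v' * g -> g * w = w' * g -> g * x = x' * g ->
  g * (v * w - w * v - x) = (v' * w' - w' * v' - x') * g.
Proof.
move=> gv gw gx; rewrite !mulrBr !mulrBl gx !mulrA gv gw -!mulrA.
by rewrite gv gw !mulrA.
Qed.

Lemma Tg_krel h v w : Tg h * krel v w = krel (rho h v) (rho h w) * Tg h.
Proof. by apply: conj_rel; [apply: Tg_vT | apply: Tg_vT | apply: kinv]. Qed.

Lemma commutator_linear (R : algType k) c (a b d x y : R) :
  (c *: a + b) * d - d * (c *: a + b) - (c *: x + y) =
  c *: (a * d - d * a - x) + (b * d - d * b - y).
Proof.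
rewrite mulrDl mulrDr -scalerAl -scalerAr !scalerBr !opprD !addrA.
by rewrite [LHS](ACl (1*3*5*2*4*6)%AC).
Qed.

Lemma krel_Pl c u v w : krel (c *: u + v) w = c *: krel u w + krel v w.
Proof.
rewrite /krel kTPl [vT (c *: u + v)](linearP (@vTG k gT V rho)).
exact: commutator_linear.
Qed.

Lemma commutator_anti (R : pzRingType) (a b x x' : R) :
  x = - x' -> a * b - b * a - x = - (b * a - a * b - x').
Proof. by move=> ->; rewrite opprK [RHS]opprB addrC [in RHS]opprB. Qed.

Lemma krel_anti v w : krel v w = - krel w v.
Proof. by apply: commutator_anti; apply: kT_anti. Qed.

Lemma krel_Pr c u v w : krel w (c *: u + v) = c *: krel w u + krel w v.
Proof.
apply: etrans (krel_anti _ _) (etrans (congr1 -%R (krel_Pl c u v w)) _).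
rewrite opprD -scalerN; apply: (congr2 (fun x y : TG => c *: x + y)).
  by apply: esym; apply: krel_anti.
by apply: esym; apply: krel_anti.
Qed.

Lemma krel0 w : krel 0 w = 0.
Proof.
have := krel_Pl 1 0 0 w; rewrite !scale1r addr0 => /(congr1 (fun x => x - krel 0 w)).
by rewrite subrr addrK => /esym.
Qed.

Lemma mul_conj (R : pzRingType) (a g x x' b : R) :
  g * x = x' * g -> a * g * x * b = a * x' * (g * b).
Proof. by move=> gx; rewrite -(mulrA a) gx !mulrA. Qed.

Lemma mul_regroup (R : pzRingType) (x y z t : R) : x * (y * z) * t = x * y * (z * t).
Proof. by rewrite !mulrA. Qed.

Lemma mulr_cyc0 (M : lmodType k) (R : algType k) (h : {linear R -> M}) (a x y z b : R) :
    h (a * x * b) = 0 -> h (a * y * b) = 0 -> h (a * z * b) = 0 ->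
  h (a * (x + y + z) * b) = 0.
Proof. by move=> hx hy hz; rewrite !mulrDr !mulrDl !linearD /= hx hy hz !addr0. Qed.

Lemma prodr_cat2 (R : pzRingType) (J : Type) (h : J -> R) a i j b :
  \prod_(l <- a ++ i :: j :: b) h l = \prod_(l <- a) h l * (h i * h j) * \prod_(l <- b) h l.
Proof. by rewrite big_cat !big_cons /= -!mulrA. Qed.

Lemma linear_split (M : lmodType k) (R : algType k) (h : {linear R -> M}) (a x y z b : R) :
  h (a * (x - y - z) * b) = h (a * x * b) - h (a * y * b) - h (a * z * b).
Proof. by rewrite !mulrBr !mulrBl !linearB. Qed.

Lemma lincomb0 (M : lmodType k) c (x y : M) : x = 0 -> y = 0 -> c *: x + y = 0.
Proof. by move=> -> ->; rewrite scaler0 addr0. Qed.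

Lemma basis_ind (P : V -> Prop) :
    P 0 -> (forall c u v, P u -> P v -> P (c *: u + v)) -> (forall i : I, P (e_ i)) ->
  forall v, P v.
Proof.
move=> P0 PD Pe v; rewrite (coord_vbasis (memvf v)).
elim/big_rec: _ => // i u _ Pu; exact: PD.
Qed.

(** The existence of such an f shows that a combination of relations of degree at most N has
    no leading term. *)
Definition straightens N (f : seq I -> SG) : Prop :=
  (forall s, SG_lt (size s) (f s - pi (W s))) /\
  (forall a (i j : I) b, (size a + size b + 2 <= N)%N ->
    F f (W a * krel (e_ i) (e_ j) * W b) = 0).

(** G-invariance of kappa is what lets a group element be moved across a relation, which
    reduces arbitrary left factors to words. *)
Lemma straightens_rel N f : straightens N f -> forall p q a v w b,
    (p + q + 2 <= N)%N -> a \in TG_le p -> b \in TG_le q ->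
  F f (a * krel v w * b) = 0.
Proof.
move=> [_ fr] p q a v w b pq ha hb.
have step1 s t v' w' : (size s <= p)%N -> (size t <= q)%N ->
    F f (W s * krel v' w' * W t) = 0.
  move=> sp tq.
  have le : (size s + size t + 2 <= N)%N.
    by apply: leq_trans pq; rewrite leq_add2r leq_add.
  elim/basis_ind: v' => [|c x y IHx IHy|i].
  - by rewrite krel0 mulr0 mul0r word_functional0.
  - rewrite krel_Pl mulrDr mulrDl -scalerAr -scalerAl word_functionalP.
    by apply: lincomb0; [exact: IHx | exact: IHy].
  elim/basis_ind: w' => [|c x y IHx IHy|j].
  - by rewrite krel_anti krel0 oppr0 mulr0 mul0r word_functional0.
  - rewrite krel_Pr mulrDr mulrDl -scalerAr -scalerAl word_functionalP.
    by apply: lincomb0; [exact: IHx | exact: IHy].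
  exact: fr.
have step2 s v' w' b' : (size s <= p)%N -> b' \in TG_le q -> F f (W s * krel v' w' * b') = 0.
  move=> sp; move: b'; apply: TG_le_ind => [|c x y IHx IHy|t g tq].
  - by rewrite mulr0 word_functional0.
  - rewrite mulrDr -scalerAr word_functionalP.
    by apply: lincomb0; [exact: IHx | exact: IHy].
  rewrite TU_prod mulrA word_functional_g step1 //; exact: mul0r.
move: a ha; apply: TG_le_ind => [|c x y IHx IHy|s g sp].
- by rewrite !mul0r word_functional0.
- rewrite !mulrDl -!scalerAl word_functionalP.
  by apply: lincomb0; [exact: IHx | exact: IHy].
rewrite TU_prod; apply: etrans (congr1 (F f) (mul_conj _ _ (Tg_krel g v w))) _.
apply: step2 => //.
by rewrite -[q]add0n; apply: TG_leM hb; apply: TG_le_g.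
Qed.

(** Under the Jacobi condition the cyclic sum is made of relations, which earlier
    straightening functionals kill. This is the input of the overlap ambiguity. *)
Lemma cyc_kT_krel v1 v2 v3 :
  cyc3 (fun u v w => kT u v * vT w - vT w * kT u v) v1 v2 v3 =
  cyc3 (Jrel rho kappa) v1 v2 v3.
Proof. by rewrite cyc_kT_split kjac add0r. Qed.

Section Step.
Variables (N : nat) (f : seq I -> SG).
Hypothesis fN : straightens N f.
Local Notation c := (correction (F f) (fun i : I => vT (e_ i)) (fun i j : I => kT (e_ i) (e_ j))).

Lemma cE a i j b : c a i j b = F f (W a * kT (e_ i) (e_ j) * W b).
Proof. by []. Qed.

Lemma W_kT_le a v w b : W a * kT v w * W b \in TG_le (size a + 1 + size b).
Proof. by apply: TG_leM (W_le _ _); apply: TG_leM (kT_le _ _ _ _); apply: W_le. Qed.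

Lemma c_diag a i b : c a i i b = 0.
Proof. by rewrite cE kT_alt mulr0 mul0r word_functional0. Qed.

Lemma c_anti a i j b : c a i j b = - c a j i b.
Proof. apply: correction_anti => *; exact: kT_anti. Qed.

Lemma c_comm a i j b l m e : (size a + size b + size e + 4 = N.+1)%N ->
  c a i j (b ++ l :: m :: e) + c (a ++ j :: i :: b) l m e =
  c (a ++ i :: j :: b) l m e + c a i j (b ++ m :: l :: e).
Proof.
apply: correction_comm => {}a {}i {}j {}b {}l {}m {}e sz.
- apply: (@straightens_rel N f fN (size a) (size b + 1 + size e)).
  + by move: sz; lia.
  + exact: W_le.
  exact: W_kT_le.
apply: (@straightens_rel N f fN (size a + 1 + size b) (size e)).
+ by move: sz; lia.
+ exact: W_kT_le.
exact: W_le.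
Qed.

Lemma c_braid a i j l b : (size a + size b + 3 = N.+1)%N ->
  c a i j (l :: b) + c (rcons a j) i l b + c a j l (i :: b) =
  c (rcons a i) j l b + c a i l (j :: b) + c (rcons a l) i j b.
Proof.
apply: correction_braid => [i' j'|{}a {}i {}j {}l {}b sz]; first exact: kT_anti.
rewrite -/(cyc3 (fun u v w => kT u v * vT w - vT w * kT u v) (e_ i) (e_ j) (e_ l)).
rewrite -/(W a) -/(W b).
have szN : (size a + size b + 2 <= N)%N by move: sz; lia.
have J u v w : F f (W a * Jrel rho kappa u v w * W b) = 0.
  rewrite /Jrel mulr_sumr mulr_suml linear_sum big1 // => g _.
  rewrite (mul_regroup (W a)) -[LHS]/(F f _).
  apply: (@straightens_rel N f fN (size a) (size b) _ _ _ _ szN); first exact: W_le.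
  by rewrite -[size b]add0n; apply: TG_leM (W_le _ _); apply: TG_le_g.
rewrite cyc_kT_krel; apply: mulr_cyc0; exact: J.
Qed.

Lemma c_lt a i j b : (size a + size b).+2 = N.+1 -> SG_lt N.+1 (c a i j b).
Proof.
move=> [sz]; apply: (word_functional_lt fN.1).
have := W_kT_le a (e_ i) (e_ j) b.
by rewrite -addnA add1n addnS sz.
Qed.

(** The relations of degree N + 1 only prescribe differences of values on words of length N + 1,
    which sorting realizes; shorter words keep their values, so that relations of smaller
    degree are still killed. *)
Definition extended s : SG :=
  if size s == N.+1 then pi (W s) + straighten c s else f s.

Lemma extended_eq m x : (m <= N)%N -> x \in TG_le m -> F extended x = F f x.
Proof.
move=> mN; apply: word_functional_eq => s sm; rewrite /extended.
by rewrite ltn_eqF // ltnS (leq_trans sm mN).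
Qed.

Lemma straightens_extended : straightens N.+1 extended.
Proof.
split=> [s|a i j b].
  rewrite /extended; case: eqP => [e|_]; last exact: fN.1.
  rewrite addrAC subrr add0r e; apply: straighten_in e; first exact: SG_lt0.
    exact: SG_ltD.
  exact: c_lt.
rewrite leq_eqVlt => /orP [/eqP sz|]; last first.
  rewrite ltnS => sz; rewrite (extended_eq sz); first exact: (fN.2).
  rewrite addnAC; apply: TG_leM (W_le _ _); apply: TG_leM (krel_le _ _ _ _); exact: W_le.
have {}sz : (size a + size b).+2 = N.+1 by rewrite -sz addn2.
have hk : F extended (W a * kT (e_ i) (e_ j) * W b) = c a i j b.
  rewrite cE; apply: (@extended_eq N) => //.
  by have := W_kT_le a (e_ i) (e_ j) b; case: sz => <-; rewrite addnAC addn1.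
have Ws (i' j' : I) : W a * (vT (e_ i') * vT (e_ j')) * W b = W (a ++ i' :: j' :: b).
  exact: esym (prodr_cat2 _ _ _ _ _).
have E (i' j' : I) : F extended (W a * (vT (e_ i') * vT (e_ j')) * W b) =
    pi (W (a ++ i' :: j' :: b)) + straighten c (a ++ i' :: j' :: b).
  rewrite Ws word_functional_W /extended size_cat /= !addnS sz eqxx.
  by [].
apply: etrans (linear_split (F extended) _ _ _ _ _) _.
apply: etrans (congr2 (fun x y : SG => x - y)
  (congr2 (fun x y : SG => x - y) (E i j) (E j i)) hk) _.
rewrite (@pi_W_perm _ _ _ rho (a ++ j :: i :: b) (a ++ i :: j :: b)); last first.
  rewrite perm_cat2l -[j :: i :: b]/([:: j; i] ++ b) -[i :: j :: b]/([:: i; j] ++ b).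
  by rewrite perm_cat2r; apply/permPl; apply: (perm_catC [:: j] [:: i]).
rewrite opprD addrACA subrr add0r.
have S := straighten_swap c_anti c_diag c_comm c_braid i j sz.
exact: etrans (congr1 (fun x => x - c a i j b) S) (subrr _).
Qed.
End Step.

Lemma straightens_ex N : exists f, straightens N f.
Proof.
elim: N => [|N [f fN]]; last by exists (extended N f); apply: straightens_extended.
exists (fun s => pi (W s)); split=> [s|a i j b]; last by rewrite addn2.
by rewrite subrr; apply: SG_lt0.
Qed.

(** An element of the ideal is a finite combination of relations, so it is killed as soon as
    N is large. *)
Lemma ideal_bound x : x \in idl -> exists N, forall f, straightens N f -> F f x = 0.
Proof.
move=> /asboolP [s [Xs ->]]; elim: s Xs => [|t s IH] Xs.
  by exists 0%N => f _; rewrite big_nil word_functional0.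
have [|N1 h1] := IH; first by move=> u us; apply: Xs; rewrite inE us orbT.
have [v [w e]] := Xs t (mem_head _ _).
have [p hp] := TG_le_ex t.1.1; have [q hq] := TG_le_ex t.2.
have mono N M f : (N <= M)%N -> straightens M f -> straightens N f.
  move=> NM [f1 f2]; split=> // a i j b le; apply: f2; exact: leq_trans le NM.
exists (maxn N1 (p + q + 2)) => f fN; rewrite big_cons linearD /=.
rewrite [X in _ + X](h1 f (mono _ _ _ (leq_maxl _ _) fN)) addr0 e.
have fpq := mono _ _ _ (leq_maxr N1 (p + q + 2)) fN.
exact: (@straightens_rel _ f fpq p q _ v w _ (leqnn _) hp hq).
Qed.

(** A functional that kills x and preserves leading terms shows that x has no leading term. *)
Theorem PBW_sufficient : PBW rho kappa.
Proof.
move=> m x hx /ideal_bound [N hN]; have [f fN] := straightens_ex N.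
have := word_functional_top fN.1 hx; rewrite (hN f fN) sub0r => /SG_ltN.
by rewrite opprK => /SG_part_lt.
Qed.
End Sufficiency.

(** * What PBW implies *)

Lemma mulrK_inv (R : pzRingType) (x g g' : R) : g * g' = 1 -> x * g * g' = x.
Proof. by move=> e; rewrite -mulrA e mulr1. Qed.

Lemma subr_cancel_left (W : zmodType) (a b c : W) : a - b - (a - c) = c - b.
Proof. by rewrite opprB addrC addrA subrK. Qed.

Section Necessity.
Context (k : fieldType) (gT : finGroupType) (V : vectType k).
Variable rho : linrep gT V.
Local Notation Tg := (skewg (Tens_act rho)).
Local Notation vT := (vTG rho).
Local Notation TG_le := (@TG_le k gT V rho).
Local Notation pi := (@TGpi k gT V rho).
Local Notation tT := (@target_TG k gT V rho).
Variable kappa : {bilinear V -> V -> target gT V}.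
Local Notation idl := (ideal_gen (@relation k gT V rho kappa)).
Local Notation krel := (@krel k gT V rho kappa).
Local Notation klin := (@klin k gT V kappa).

Lemma TGpi_target u g : skew_coef (pi (tT u)) g = kV_Sym (target_coef u g).
Proof.
have -> : pi (tT u) = mk_skew (Sym_act rho) [ffun g => kV_Sym (target_coef u g)].
  rewrite [RHS]skewU_sum target_TG_sum linear_sum; apply: eq_bigr => h _.
  rewrite [skew_coef _ _]ffunE -[LHS]/(pi _) TGpiP TGpi_g.
  rewrite TGpiM TGpi_v TGpi_g /kV_Sym skewUD skewUZ; congr (_ + _).
  by rewrite /vSG -skewUg.
exact: ffunE.
Qed.

Lemma pihomog1_kV (u : k^o * V) : pihomog mdeg 1 (kV_Sym u : {mpoly k[_]}) = symX u.2.
Proof.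
rewrite /kV_Sym pihomogD (pihomog_dE (symX_homog _)) (pihomog_ne0 (d := 0%N)) ?add0r //.
by apply: rpredZ; apply: dhomog1.
Qed.

Lemma pihomog0_kV c : pihomog mdeg 0 (kV_Sym (c : k^o, 0 : V) : {mpoly k[_]}) = c%:A.
Proof.
rewrite /kV_Sym linear0 addr0 pihomog_dE //.
by apply: rpredZ; apply: dhomog1.
Qed.

Lemma scaleA_inj (c : k) : c%:A = 0 :> Defs.Sym V -> c = 0.
Proof. by move/eqP; rewrite scaler_eq0 oner_eq0 orbF => /eqP. Qed.

Hypothesis pbw : PBW rho kappa.

(** Under PBW, the space (k + V) (x) kG embeds in H_kappa: the symbols in degrees 1 and 0
    recover the linear and the constant parts. *)
Lemma PBW_target0 u : tT u \in idl -> u = 0.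
Proof.
move=> hu.
have u2 g : (target_coef u g).2 = 0.
  apply: (@symX_inj k V); rewrite linear0 -pihomog1_kV -TGpi_target -SG_partE.
  rewrite -[SG_part _ _]/(symbol 1 (tT u)) (pbw (target_TG_le _ _) hu).
  by rewrite [LHS]ffunE.
have h0 : tT u \in TG_le 0.
  rewrite target_TG_sum; apply: rpred_sum => g _; rewrite u2 linear0 mul0r addr0.
  by apply: rpredZ; apply: TG_le_g.
apply/ffunP => g; rewrite ffunE -/(target_coef u g).
rewrite [LHS]surjective_pairing u2; congr (_, _).
apply: scaleA_inj; rewrite -pihomog0_kV -(u2 g) -surjective_pairing.
rewrite -TGpi_target -SG_partE -[SG_part _ _]/(symbol 0 (tT u)) (pbw h0 hu).
by rewrite [LHS]ffunE.
Qed.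

Lemma Tg_target h u : Tg h * tT u = tT (target_act rho h u) * Tg h.
Proof.
apply/skewP => z.
have e1 := target_TG_coef rho u (h^-1 * z)%g.
have e2 := target_TG_coef rho (target_act rho h u) (z * h^-1)%g.
apply: etrans (skew_coef_gmul _ _ _) (etrans _ (esym (skew_coef_mulg _ _ _))).
apply: etrans (congr1 (Tens_act rho h) e1) (etrans _ (esym e2)) => {e1 e2}.
have -> : target_coef (target_act rho h u) (z * h^-1)%g =
    ((target_coef u (h^-1 * z)%g).1, rho h (target_coef u (h^-1 * z)%g).2).
  by rewrite [LHS]ffunE conjgE !mulgA mulgKV.
case: (target_coef u _) => c w; apply: etrans (Tens_actP _ _ _ _ _) _.
apply: (congr2 (fun x y : Tens V => c *: x + y)); first exact: rmorph1.
exact: Tens_actX.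
Qed.

(** Conjugating the relation of v, w by h gives a relation for hv, hw with another right-hand
    side; the difference of the two right-hand sides lies in the ideal, hence is zero. *)
Lemma PBW_act h v w : target_act rho h (kappa v w) = kappa (rho h v) (rho h w).
Proof.
apply/eqP; rewrite -subr_eq0; apply/eqP; apply: PBW_target0.
have e1 : Tg h * krel v w = (vT (rho h v) * vT (rho h w) - vT (rho h w) * vT (rho h v)
    - tT (target_act rho h (kappa v w))) * Tg h.
  by apply: conj_rel; [apply: Tg_vT | apply: Tg_vT | apply: Tg_target].
have e2 : (vT (rho h v) * vT (rho h w) - vT (rho h w) * vT (rho h v)
    - tT (target_act rho h (kappa v w))) \in idl.
  rewrite -[X in X \in _](mulrK_inv _ (skewg_mulV (Tens_act rho) h)) -e1.
  by apply: ideal_genMr; apply: ideal_genMl; apply: krel_ideal.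
have := rpredB (krel_ideal rho kappa (rho h v) (rho h w)) e2.
by rewrite /krel subr_cancel_left -(linearB tT).
Qed.

Lemma PBW_invariant : G_invariant rho kappa.
Proof. by move=> h v w; rewrite PBW_act !rhoVK. Qed.

Lemma Jlow_le v1 v2 v3 : Jlow rho kappa v1 v2 v3 \in TG_le 1.
Proof. by rewrite Jlow_target; apply: target_TG_le. Qed.

Lemma TGpi_Jquad v1 v2 v3 g : skew_coef (pi (Jquad rho kappa v1 v2 v3)) g =
  symX (klin v1 v2 g) * symX (rho g v3 - v3).
Proof.
have -> : pi (Jquad rho kappa v1 v2 v3) =
    mk_skew (Sym_act rho) [ffun g => symX (klin v1 v2 g) * symX (rho g v3 - v3)].
  rewrite [RHS]skewU_sum linear_sum; apply: eq_bigr => h _.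
  rewrite [skew_coef _ _]ffunE -[LHS]/(pi _).
  apply: etrans (TGpiM _ _) _; rewrite TGpi_g [RHS]skewUg [in RHS]skewU_mul1.
  congr (_ * _); apply: etrans (TGpiM _ _) _.
  by congr (_ * _); apply: TGpi_v.
exact: ffunE.
Qed.

Lemma TGpiD x y : pi (x + y) = pi x + pi y.
Proof. exact: linearD. Qed.

(** The symbol in degree 2 of the Jacobi element. The identity lives in the symmetric square,
    so it is weaker than the vanishing of the cyclic sum of [Jquad]. *)
Lemma PBW_cocycle g v1 v2 v3 :
  cyc3 (fun u v w => symX (klin u v g) * symX (rho g w - w)) v1 v2 v3 = 0.
Proof.
have i := Jacobi_ideal rho kappa v1 v2 v3.
have le : cyc3 (Jquad rho kappa) v1 v2 v3 + cyc3 (Jlow rho kappa) v1 v2 v3 \in TG_le 2.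
  apply: rpredD; first by do 2?apply: rpredD; apply: Jquad_le.
  by apply: (@TG_le_trans _ _ _ _ 1) => //; do 2?apply: rpredD; apply: Jlow_le.
have low : symbol 2 (cyc3 (Jlow rho kappa) v1 v2 v3) = 0.
  by apply: (@symbol_lt _ _ _ _ 2 1) => //; do 2?apply: rpredD; apply: Jlow_le.
have E : pi (cyc3 (Jquad rho kappa) v1 v2 v3) =
    cyc3 (fun u v w => pi (Jquad rho kappa u v w)) v1 v2 v3.
  by apply: etrans (TGpiD _ _) _; congr (_ + _); apply: TGpiD.
have {}E : skew_coef (pi (cyc3 (Jquad rho kappa) v1 v2 v3)) g =
    cyc3 (fun u v w => symX (klin u v g) * symX (rho g w - w)) v1 v2 v3.
  by rewrite E /cyc3 !skew_coefD; congr (_ + _ + _); apply: TGpi_Jquad.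
have := pbw le i; rewrite symbolD low addr0 => /(congr1 (fun x => skew_coef x g)).
rewrite [RHS]ffunE => <-; rewrite /symbol SG_partE E pihomog_dE //.
by do 2?apply: rpredD; apply: (dhomogM (d := 1%N) (e := 1%N)); apply: symX_homog.
Qed.

(** Once the quadratic part vanishes, the Jacobi element is the image of an element of
    (k + V) (x) kG, and [PBW_target0] applies. *)
Lemma PBW_low v1 v2 v3 :
    cyc3 (Jquad rho kappa) v1 v2 v3 = 0 ->
  cyc3 (Jtarget rho kappa) v1 v2 v3 = 0.
Proof.
move=> q; apply: PBW_target0; have := Jacobi_ideal rho kappa v1 v2 v3.
by rewrite q add0r /cyc3 !Jlow_target !(linearD tT).
Qed.
End Necessity.

(** * The bracket conditions as a vanishing cyclic sum *)

(** The elements of the alternating group are the identity and two 3-cycles, found by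
    cardinality. *)
Lemma sum_Alt3 (M : nmodType) (F : 'I_3 -> 'I_3 -> 'I_3 -> M) :
  \sum_(s in ('Alt_('I_3))%g) F (s 0) (s 1) (s 2) = F 0 1 2 + F 1 2 0 + F 2 0 1.
Proof.
pose c : {perm 'I_3} := (tperm 0%R 1%R * tperm 0%R 2%R)%g.
have c0 : c 0 = 1 by rewrite permM tpermL tpermD.
have c1 : c 1 = 2 by rewrite permM tpermR tpermL.
have c2 : c 2 = 0 by rewrite permM (@tpermD _ 0 1 2) // tpermR.
pose d := (c * c)%g.
have d0 : d 0 = 2 by rewrite permM c0 c1.
have d1 : d 1 = 0 by rewrite permM c1 c2.
have d2 : d 2 = 1 by rewrite permM c2 c0.
have cE : c \in ('Alt_('I_3))%g by rewrite Alt_even odd_permM !odd_tperm.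
have dE : d \in ('Alt_('I_3))%g by rewrite groupM.
have c1' : c != 1%g by apply/eqP => e; have := c0; rewrite e perm1.
have d1' : d != 1%g by apply/eqP => e; have := d0; rewrite e perm1.
have dc : d != c by apply/eqP => e; have := c0; rewrite -e d0.
have AE : ('Alt_('I_3))%g = [set 1%g; c; d] :> {set _}.
  apply/eqP; rewrite eq_sym eqEcard; apply/andP; split.
    by apply/subsetP => s /setUP [/set2P [] -> | /set1P ->] //; apply: group1.
  rewrite -ltnS -(ltn_pmul2l (isT : 0 < 2)%N) card_Alt ?card_ord //.
  by rewrite setUC cardsU1 !inE negb_or d1' dc cards2 eq_sym c1'.
rewrite AE setUC big_setU1 ?inE ?negb_or ?d1' ?dc //= big_setU1 ?inE 1?eq_sym //=.
by rewrite big_set1 !perm1 c0 c1 c2 d0 d1 d2 addrC.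
Qed.

Lemma sum_ord3 (M : nmodType) (F : 'I_3 -> M) : \sum_i F i = F 0 + F 1 + F 2.
Proof.
rewrite !big_ord_recl big_ord0 addr0 addrA.
by congr (F _ + F _ + F _); apply: val_inj.
Qed.

Section Bracket.
Context (k : fieldType) (gT : finGroupType) (V : vectType k).
Variable rho : linrep gT V.
Hypothesis char_not2 : 2%N \notin [pchar k].
Local Notation SG := (SG rho).
Local Notation SU := (skewU (Sym_act rho)).
Local Notation vS := (vSG rho).
Variable kappa : {bilinear V -> V -> target gT V}.
Hypothesis kalt : alternating kappa.
Local Notation klin := (@klin k gT V kappa).
Local Notation kcst := (@kcst k gT V kappa).

Lemma kcst_anti u v g : kcst u v g = - kcst v u g.
Proof. by rewrite /kcst (kappa_anti kalt) /target_coef ffunE. Qed.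

Lemma klin_anti u v g : klin u v g = - klin v u g.
Proof. by rewrite /klin (kappa_anti kalt) /target_coef ffunE. Qed.

Definition low_cst x u v w : k := \sum_g kcst (klin u v g) w (x * g^-1)%g.
Definition low_lin x u v w : V := \sum_g klin (klin u v g) w (x * g^-1)%g.
(** Together with [low_lin] and [low_cst] these are the coefficients of [Jtarget]; each of
    them matches one of the terms of the bracket conditions. *)
Definition low_act x u v w : V := kcst u v x *: (rho x w - w).

Lemma Jtarget_coef u v w x : target_coef (Jtarget rho kappa u v w) x =
  (low_cst x u v w : k^o, low_lin x u v w + low_act x u v w).
Proof. exact: ffunE. Qed.

Lemma target_coefD (x y : target gT V) g :
  target_coef (x + y) g = target_coef x g + target_coef y g.
Proof. exact: ffunE. Qed.

Lemma cyc_Jtarget_coef u v w x : target_coef (cyc3 (Jtarget rho kappa) u v w) x =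
  (cyc3 (low_cst x) u v w : k^o, cyc3 (low_lin x) u v w + cyc3 (low_act x) u v w).
Proof.
rewrite /cyc3 !target_coefD !Jtarget_coef.
congr (_, _); rewrite /= [RHS]addrACA; congr (_ + _); exact: addrACA.
Qed.

Lemma target_coef_lin u v g : target_coef (lin_part kappa u v) g = (0, klin u v g).
Proof. exact: ffunE. Qed.
Lemma target_coef_cst u v g : target_coef (const_part kappa u v) g = (kcst u v g : k^o, 0).
Proof. exact: ffunE. Qed.

Lemma kV_Sym_lin u : kV_Sym (0, u) = symX u :> Defs.Sym V.
Proof. by rewrite /kV_Sym /= scale0r add0r. Qed.
Lemma kV_Sym_cst c : kV_Sym (c : k^o, 0) = c%:A :> Defs.Sym V.
Proof. by rewrite /kV_Sym /= linear0 addr0. Qed.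

Lemma cyc3_linear (T T' : zmodType) (f : {additive T -> T'}) (h : V -> V -> V -> T) u v w :
  cyc3 (fun a b c => f (h a b c)) u v w = f (cyc3 h u v w).
Proof. by rewrite /cyc3 !raddfD. Qed.

Lemma insertion_sum alpha beta (f : V -> V -> V -> Defs.Sym V) (v : {ffun 'I_3 -> V}) x :
    (forall a b c, \sum_h kV_Sym (target_coef
      (alpha (target_coef (beta a b) h).2 c) (x * h^-1)%g) = f a b c) ->
  @insertion k gT V alpha beta v x = cyc3 f (v 0) (v 1) (v 2).
Proof.
move=> e; rewrite /insertion exchange_big /=.
rewrite (eq_bigr (fun s : {perm 'I_3} => f (v (s 0)) (v (s 1)) (v (s 2)))).
  exact: (sum_Alt3 (fun a b c => f (v a) (v b) (v c))).
by move=> s _; apply: e.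
Qed.

Lemma insertion_ll v x : insertion (lin_part kappa) (lin_part kappa) v x =
  symX (cyc3 (low_lin x) (v 0) (v 1) (v 2)).
Proof.
rewrite -(cyc3_linear (@symX k V)); apply: insertion_sum => a b c.
rewrite /low_lin raddf_sum; apply: eq_bigr => h _.
by rewrite !target_coef_lin kV_Sym_lin.
Qed.

Lemma insertion_cl v x : insertion (const_part kappa) (lin_part kappa) v x =
  (cyc3 (low_cst x) (v 0) (v 1) (v 2))%:A.
Proof.
apply: etrans _ (cyc3_linear (in_alg (Defs.Sym V)) (low_cst x) _ _ _).
apply: insertion_sum => a b c; rewrite /= /low_cst scaler_suml; apply: eq_bigr => h _.
by rewrite target_coef_cst target_coef_lin kV_Sym_cst.
Qed.

Lemma insertion_lc v x : insertion (lin_part kappa) (const_part kappa) v x = 0.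
Proof.
rewrite (@insertion_sum _ _ (fun _ _ _ => 0)) => [|a b c]; first by rewrite /cyc3 !addr0.
rewrite big1 // => h _; rewrite target_coef_cst target_coef_lin kV_Sym_lin /=.
have -> : klin 0 c (x * h^-1)%g = 0.
  by have := klinPl kappa (-1) 0 0 c (x * h^-1)%g; rewrite scaler0 addr0 scaleN1r addNr.
exact: linear0.
Qed.

Lemma vSG_commutator u (c : k) g :
  vS u * SU c%:A g - SU c%:A g * vS u = - SU (symX (c *: (rho g u - u))) g.
Proof.
have -> : symX (c *: (rho g u - u)) = c *: (symX (rho g u) - symX u) :> Defs.Sym V.
  by rewrite linearZ linearB.
rewrite /vSG !skewUM alg_act1 mul1g mulg1 -[in RHS]skewUN -[in LHS]skewUN -skewUD; congr (SU _ g).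
rewrite Sym_actX [symX u * _]mulrC -!scalerAl !mul1r.
by rewrite -scalerBr -scalerN opprB.
Qed.

(** The commutator of v with the constant c g is c (v - g v) g, hence the sign. *)
Lemma dstar_const_coef (v : {ffun 'I_3 -> V}) x :
  skew_coef (dstar (cochain_of rho (const_part kappa)) v) x =
  - symX (cyc3 (low_act x) (v 0) (v 1) (v 2)).
Proof.
have E (a b u : V) : vS u * mk_skew (Sym_act rho) [ffun g => (kcst a b g)%:A]
    - mk_skew (Sym_act rho) [ffun g => (kcst a b g)%:A] * vS u =
    mk_skew (Sym_act rho) [ffun g => - symX (low_act g a b u)].
  rewrite [X in _ * X - _]skewU_sum [X in _ - X * _]skewU_sum [RHS]skewU_sum.
  rewrite mulr_sumr mulr_suml -sumrB; apply: eq_bigr => g _.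
  by rewrite ![skew_coef _ _]ffunE vSG_commutator -skewUN.
have cE (w : {ffun 'I_2 -> V}) : cochain_of rho (const_part kappa) w =
    mk_skew (Sym_act rho) [ffun g => (kcst (w 0) (w 1) g)%:A].
  by apply/ffunP => g; rewrite !ffunE target_coef_cst kV_Sym_cst.
have G (i : 'I_3) : skew_coef
    (let a := cochain_of rho (const_part kappa) [ffun j => v (lift i j)] in
     (-1) ^+ i *: (vS (v i) * a - a * vS (v i))) x =
    (-1) ^+ i *: - symX (low_act x (v (lift i 0)) (v (lift i 1)) (v i)).
  rewrite /= skew_coefZ; congr (_ *: _); rewrite cE !ffunE E.
  exact: ffunE.
rewrite /dstar skew_coef_sum; apply: etrans (eq_bigr _ (fun i _ => G i)) _.
rewrite sum_ord3 /= expr0 expr1 scale1r scaleN1r opprK.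
have -> : (-1) ^+ (1 + 1) = 1 :> k by rewrite -signr_odd.
rewrite scale1r.
have -> : lift 0 (0 : 'I_2) = 1 :> 'I_3 by apply: val_inj.
have -> : lift 0 (1 : 'I_2) = 2 :> 'I_3 by apply: val_inj.
have -> : lift 1 (0 : 'I_2) = 0 :> 'I_3 by apply: val_inj.
have -> : lift 1 (1 : 'I_2) = 2 :> 'I_3 by apply: val_inj.
have -> : lift 2 (0 : 'I_2) = 0 :> 'I_3 by apply: val_inj.
have -> : lift 2 (1 : 'I_2) = 1 :> 'I_3 by apply: val_inj.
rewrite -!(linearN (@symX k V)) -!(linearD (@symX k V)); congr symX.
rewrite /cyc3 /low_act (kcst_anti (v 0) (v 2)) scaleNr.
by rewrite !opprD -[RHS]addrA [RHS]addrC.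
Qed.

Lemma bracketE alpha beta (v : {ffun 'I_3 -> V}) x : skew_coef (bracket rho alpha beta v) x =
  insertion alpha beta v x + insertion beta alpha v x.
Proof. exact: ffunE. Qed.

Lemma mulr2_inj : injective (fun u : Defs.Sym V => u *+ 2).
Proof.
move=> u w /eqP; rewrite -subr_eq0 -mulrnBl -scaler_nat scaler_eq0 subr_eq0.
move/negPf: char_not2; rewrite inE /= => ->; exact/eqP.
Qed.

(** The linear coefficients of the cyclic sum give the condition on the square bracket, after
    division by 2, and the constant ones give the mixed condition. *)
Lemma bracket_conditions :
  ((forall v, bracket rho (lin_part kappa) (lin_part kappa) v
               = dstar (cochain_of rho (const_part kappa)) v *+ 2)
   /\ (forall v, bracket rho (const_part kappa) (lin_part kappa) v = 0))
  <-> (forall v1 v2 v3, cyc3 (Jtarget rho kappa) v1 v2 v3 = 0).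
Proof.
have triple (a b c : V) : exists v : {ffun 'I_3 -> V}, [/\ v 0 = a, v 1 = b & v 2 = c].
  by exists [ffun i : 'I_3 => if i == 0 then a else if i == 1 then b else c]; rewrite !ffunE.
have mul2_coef (y : SG) x : skew_coef (y *+ 2) x = skew_coef y x *+ 2.
  by rewrite !mulr2n skew_coefD.
have z0 x : skew_coef (0 : SG) x = 0 by exact: (raddf0 (coefr x)).
split=> [[h1 h2] a b c|h].
  have [v [<- <- <-]] := triple a b c; apply/ffunP => x.
  rewrite -/(target_coef _ x) cyc_Jtarget_coef [RHS]ffunE; congr (_, _).
    apply: (@scaleA_inj k V); apply: etrans (esym (insertion_cl v x)) _.
    have := congr1 (fun y => skew_coef y x) (h2 v).
    by rewrite bracketE insertion_lc addr0 z0.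
  apply: (@symX_inj k V); rewrite linear0 linearD; apply/eqP; rewrite addr_eq0; apply/eqP.
  have := congr1 (fun y => skew_coef y x) (h1 v).
  by rewrite bracketE insertion_ll mul2_coef dstar_const_coef -mulr2n => /mulr2_inj.
have h' (v : {ffun 'I_3 -> V}) x : cyc3 (low_cst x) (v 0) (v 1) (v 2) = 0 /\
    cyc3 (low_lin x) (v 0) (v 1) (v 2) = - cyc3 (low_act x) (v 0) (v 1) (v 2).
  have := congr1 (fun y => target_coef y x) (h (v 0) (v 1) (v 2)).
  rewrite cyc_Jtarget_coef [RHS]ffunE => -[-> /eqP]; rewrite addr_eq0 => /eqP ->.
  by [].
split=> v; apply/skewP => x.
  rewrite bracketE insertion_ll mul2_coef dstar_const_coef -mulr2n; congr (_ *+ 2).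
  by rewrite (h' v x).2 linearN.
by rewrite bracketE insertion_lc insertion_cl (h' v x).1 scale0r addr0 z0.
Qed.
End Bracket.

(** * Normal form of a cocycle at one group element *)

Section LinearAlgebra.
Context (k : fieldType) (V : vectType k).

Lemma lin_hom_ex (f : V -> k^o) : linear f -> exists h : 'Hom(V, k^o), forall v, h v = f v.
Proof.
move=> fl; exists (linfun (HB.pack_for {linear V -> k^o} f
  (GRing.isLinear.Build k V k^o _ f fl))) => v.
by rewrite lfunE.
Qed.

(** The coordinate along the component in a complement of U is normalized at y. *)
Lemma functional_ex (U : {vspace V}) y : y \notin U ->
  exists e : 'Hom(V, k^o), (forall u, u \in U -> e u = 0) /\ e y = 1.
Proof.
move=> yU; pose W := (U^C)%VS.
have WU : (W :&: U = 0)%VS by rewrite capvC; apply: capv_compl.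
have UW : (U :&: W = 0)%VS by apply: capv_compl.
have sum v : daddv_pi W U v + daddv_pi U W v = v.
  by apply: daddv_pi_add => //; rewrite addvC addv_complf memvf.
have piU u : u \in U -> daddv_pi W U u = 0.
  by move=> uU; have := sum u; rewrite (daddv_pi_id UW uU) -[RHS]add0r => /addIr.
pose z := daddv_pi W U y.
have z0 : z != 0.
  apply/eqP => z0; case/negP: yU; rewrite -(sum y) -/z z0 add0r.
  exact: memv_pi.
have [i zi] : exists i, coord (vbasis {:V}) i z != 0.
  apply/existsP; apply: contra_neqT z0; rewrite negb_exists => /forallP h.
  rewrite (coord_vbasis (memvf z)) big1 // => i _.
  by move/negbNE/eqP: (h i) => ->; rewrite scale0r.
have [] := @lin_hom_ex (fun v => (coord (vbasis {:V}) i z)^-1 *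
    coord (vbasis {:V}) i (daddv_pi W U v)).
  by move=> c u v; rewrite !linearP /= mulrDr mulrCA.
move=> e eE; exists e; split=> [u uU|]; rewrite eE; last by rewrite mulVf.
by rewrite piU // linear0 mulr0.
Qed.

Lemma functional1 (y : V) : y != 0 -> exists e : 'Hom(V, k^o), e y = 1.
Proof.
move=> y0; have [] := @functional_ex 0%VS y; first by rewrite memv0.
by move=> e [_ ey]; exists e.
Qed.

(** Reduces identities between vectors with scalar coefficients to ring identities. *)
Lemma coord_ext (u v : V) :
  (forall i, coord (vbasis {:V}) i u = coord (vbasis {:V}) i v) -> u = v.
Proof.
move=> h; rewrite (coord_vbasis (memvf u)) (coord_vbasis (memvf v)).
by apply: eq_bigr => i _; rewrite h.
Qed.

End LinearAlgebra.

Ltac by_coords := apply: coord_ext => ?;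
  rewrite ?(linearD, linearB, linearN, linearZ, linear0) /=; ring.

(** Here D stands for g - 1, al for the component of kappa^L at g and e0 for the projection
    onto V^g = ker D along the image of D. The condition [coc] is the cocycle identity
    after contraction of the symmetric square with a linear form, and [al_inv] is what
    remains of the invariance of kappa under g. *)
Section NormalForm.
Context (k : fieldType) (V : vectType k).
Hypothesis two : 2%:R != 0 :> k.
Variables (D : 'End(V)) (al : V -> V -> V) (e0 : 'End(V)).
Hypothesis alP : forall c u v w, al (c *: u + v) w = c *: al u w + al v w.
Hypothesis alA : forall v, al v v = 0.
Hypothesis al_anti : forall u v, al u v = - al v u.
Hypothesis al_inv : forall w f, D f = 0 -> al (D w) f = D (al w f).
Hypothesis coc : forall (e : 'Hom(V, k^o)) u v w,
  cyc3 (fun a b c => e (al a b) *: D c + e (D c) *: al a b) u v w = 0.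
Hypothesis e0_ker : forall v, D (e0 v) = 0.
Hypothesis e0_fix : forall f, D f = 0 -> e0 f = f.
Hypothesis e0D : forall v, e0 (D v) = 0.
Hypothesis e0_im : forall v, exists w, v - e0 v = D w.

Lemma alPr c u v w : al w (c *: u + v) = c *: al w u + al w v.
Proof. by rewrite al_anti alP (al_anti w u) (al_anti w v) scalerN opprD. Qed.

Lemma double0 (x : k) : x + x = 0 -> x = 0.
Proof.
move/eqP; rewrite -mulr2n -mulr_natr mulf_eq0 (negPf two) orbF.
by move/eqP.
Qed.

(** A frame: a linear form e that vanishes on ker D and a vector p0 in the image of D with
    e (D p0) = 1. Contracting the cocycle identity with e at p0 expresses al
    through the single function al p0, see [al_frame]. *)
Section Frame.
Variables (e : 'Hom(V, k^o)) (w0 : V).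
Let p0 := D w0.
Hypothesis e_ker : forall f, D f = 0 -> e f = 0.
Hypothesis ep0 : e (D p0) = 1.

(** The e-coordinate of al(p0, -), which is removed by the coboundary of the form fs. What
    remains is [ft], with values in the kernel of e. *)
Definition fs p : k := e (al p0 p).
Definition ft q : V := al p0 q - fs q *: D p0.

Lemma fsP c u v : fs (c *: u + v) = c * fs u + fs v.
Proof. by rewrite /fs alPr linearP. Qed.

Lemma ftP c u v : ft (c *: u + v) = c *: ft u + ft v.
Proof. by rewrite /ft alPr fsP; by_coords. Qed.

Lemma e_ft q : e (ft q) = 0.
Proof. by rewrite /ft linearB linearZ /= ep0 /GRing.scale /= mulr1 subrr. Qed.

Lemma fs_p0 : fs p0 = 0. Proof. by rewrite /fs alA linear0. Qed.
Lemma ft_p0 : ft p0 = 0. Proof. by rewrite /ft alA fs_p0 scale0r subr0. Qed.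

Lemma e_al p q : e (al p q) = fs q * e (D p) - fs p * e (D q).
Proof.
have := congr1 e (coc e p q p0); rewrite linear0 /cyc3 !linearD !linearZ /= ep0.
rewrite (al_anti q p0) linearN /= /GRing.scale /= -/(fs q) -/(fs p) => h.
apply/eqP; rewrite -subr_eq0; apply/eqP; apply: double0.
by rewrite -[RHS]h; ring.
Qed.

(** The last two terms are the only ones that are not a coboundary. *)
Lemma al_frame p q : al p q =
  fs q *: D p - fs p *: D q + e (D p) *: ft q - e (D q) *: ft p.
Proof.
have h := coc e p q p0.
rewrite /cyc3 ep0 scale1r e_al (al_anti q p0) linearN /= -/(fs q) -/(fs p) in h.
apply/eqP; rewrite -subr_eq0 -[X in _ == X]h /ft; apply/eqP.
move: (al p q) (al p0 p) (al p0 q) (D p) (D q) (D p0) (e (D p)) (e (D q)) (fs p) (fs q).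
move=> *; by_coords.
Qed.

Lemma frame_identity (sp sq xp xq ap aq b : k) (X Y A B P : V) :
  (xp + sp * b) *: B + aq *: (X + sp *: P)
  + ((sq * ap - sp * aq) *: P + b *: (sq *: A - sp *: B))
  + ((- (xq + sq * b)) *: A + ap *: - (Y + sq *: P))
  = xp *: B + aq *: X - (xq *: A + ap *: Y).
Proof. by_coords. Qed.

(** The cocycle identity at p0, p, q with p, q annihilated by e o D, where only [ft]
    survives. *)
Lemma ft_coc (e1 : 'Hom(V, k^o)) p q : e (D p) = 0 -> e (D q) = 0 ->
  e1 (ft p) *: D q + e1 (D q) *: ft p = e1 (ft q) *: D p + e1 (D p) *: ft q.
Proof.
move=> ep eq.
have h := coc e1 p0 p q; apply/eqP; rewrite -subr_eq0 -[X in _ == X]h; apply/eqP.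
have alE x : al p0 x = ft x + fs x *: D p0 by rewrite subrK.
have e1E x : e1 (al p0 x) = e1 (ft x) + fs x * e1 (D p0) by rewrite alE linearD linearZ.
have pqE : al p q = fs q *: D p - fs p *: D q.
  by rewrite al_frame ep eq !scale0r addr0 subr0.
have e1pq : e1 (al p q) = fs q * e1 (D p) - fs p * e1 (D q).
  by rewrite pqE linearB !linearZ.
rewrite /cyc3 (al_anti q p0) linearN /= e1pq !e1E pqE !alE.
exact: esym (frame_identity _ _ _ _ _ _ _ _ _ _ _ _).
Qed.

Lemma D_frame v : D v = e (D v) *: D p0 + D (v - e (D v) *: p0).
Proof. by rewrite linearB linearZ /= addrC subrK. Qed.

Lemma e_frame v : e (D (v - e (D v) *: p0)) = 0.
Proof. by rewrite linearB linearZ /= linearB linearZ /= ep0 [_ *: _]mulr1 subrr. Qed.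

(** If some q with e (D q) = 0 has D q nonzero, the identity [ft_coc] for f and q gives the
    claim; otherwise D has rank 1 and the invariance [al_inv] is used. *)
Lemma ft_ker f : D f = 0 -> ft f = 0.
Proof.
move=> Df; case: (pselect (exists q, e (D q) = 0 /\ D q != 0)) => [[q [eq Dq]]|none].
  have [e1 e1q] := functional1 Dq.
  have ef : e (D f) = 0 by rewrite Df linear0.
  have := ft_coc e1 ef eq; rewrite Df e1q (linear0 e1) scaler0 scale0r addr0 scale1r => h.
  have := congr1 e1 h; rewrite linearD linearZ /= e1q (linear0 e1) [_ *: _]mulr1.
  by move/double0 => z; move: h; rewrite z scale0r add0r.
(* D has rank 1, spanned by D p0. *)
have sp y : D y = e (D y) *: D p0.
  rewrite {1}(D_frame y); have -> : D (y - e (D y) *: p0) = 0; last by rewrite addr0.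
  apply/eqP/negP => /negP h; apply: none; exists (y - e (D y) *: p0); split=> //.
  exact: e_frame.
by rewrite /ft /fs /p0 (al_inv _ Df) -sp subrr.
Qed.

(** On the kernel of e o D, the identity [ft_coc] says that ft(p) Dq = ft(q) Dp in the
    symmetric square. If D has rank at least 2 there, then ft is a multiple of D. If it has
    rank 1, say along D q0, then ft is determined by ft(q0), which is made fixed by D by
    subtracting its component in the image of D. If D vanishes there, ft does too. *)
Lemma frame_ex : exists c, forall q, e (D q) = 0 -> D (ft q - c *: D q) = 0.
Proof.
case: (pselect (exists q, e (D q) = 0 /\ D q != 0)) => [[q0 [eq0 Dq0]]|none]; last first.
  exists 0 => q eq; rewrite scale0r subr0.
  have [Dq|Dq] := eqVneq (D q) 0; first by rewrite ft_ker // linear0.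
  by case: none; exists q.
case: (pselect (exists q, e (D q) = 0 /\ D q \notin <[D q0]>%VS)) => [[q1 [eq1 Dq1]]|none].
  (* Rank at least 2: D q0 and D q1 are independent. *)
  have [e1 [e1U e1q1]] := functional_ex Dq1.
  have e1q0 : e1 (D q0) = 0 by apply: e1U; apply: memv_line.
  have h := ft_coc e1 eq0 eq1; rewrite e1q1 e1q0 scale0r addr0 scale1r in h.
  have := congr1 e1 h; rewrite linearD !linearZ /= e1q1 e1q0 [_ *: 1]mulr1 [_ *: 0]mulr0.
  move/double0 => z; rewrite z scale0r add0r in h.
  pose c := e1 (ft q1); rewrite -/c in h; exists c => q eq.
  have [e2 e2q0] := functional1 Dq0.
  have e2c : e2 (ft q0) = c by rewrite h linearZ /= e2q0 [_ *: _]mulr1.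
  have h2 := ft_coc e2 eq eq0; rewrite e2q0 scale1r e2c h in h2.
  suff -> : ft q - c *: D q = 0 by rewrite linear0.
  apply/eqP; rewrite subr_eq0; apply/eqP; move: (ft q) h2 => X h2.
  have h3 := congr1 e2 h2; rewrite !linearD !linearZ /= e2q0 /GRing.scale /= in h3.
  have z3 : e2 X = c * e2 (D q).
    apply/eqP; rewrite -subr_eq0; apply/eqP; apply: double0.
    apply: etrans (_ : _ = (e2 X * 1 + e2 X) - (c * e2 (D q) + e2 (D q) * (c * 1))) _.
      by ring.
    by rewrite h3 subrr.
  by move: h2; rewrite z3 scalerA [e2 (D q) * c]mulrC [RHS]addrC => /addrI.
(* Rank 1: every D q with e (D q) = 0 is a multiple of D q0. *)
have [y ye] := e0_im (ft q0).
have ey : e (D y) = 0.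
  by rewrite -ye linearB /= e_ft (e_ker (e0_ker _)) subr0.
have line q : e (D q) = 0 -> exists b, D q = b *: D q0.
  move=> eq; apply/vlineP; apply/negP => /negP h; apply: none; by exists q.
have [b yb] := line y ey.
exists b => q eq; have [l ql] := line q eq.
have kq : D (q - l *: q0) = 0 by rewrite linearB linearZ /= ql subrr.
have tq : ft q = l *: ft q0.
  by rewrite -[q](subrK (l *: q0)) addrC ftP (ft_ker kq) addr0.
rewrite tq ql; have -> : l *: ft q0 - b *: (l *: D q0) = l *: (ft q0 - b *: D q0) by by_coords.
by rewrite -yb -ye subKr linearZ /= e0_ker scaler0.
Qed.

(** The form r = c e o D - fs replaces al by e(Dv) sg(w) - e(Dw) sg(v), where sg corrects ft by
    c D on the kernel of e o D and vanishes at p0. Its values lie in ker D by the choice of c. *)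
Lemma frame_normal : exists r : 'Hom(V, k^o),
  let be v w := al v w + (r w *: D v - r v *: D w) in
  (forall v w, D (be v w) = 0) /\ (forall f w, D f = 0 -> be f w = 0).
Proof.
have [c hc] := frame_ex.
have [] := @lin_hom_ex k V (fun v => c * e (D v) - fs v).
  by move=> a u v; rewrite fsP !linearP /= /GRing.scale /=; ring.
move=> r rE; exists r.
pose sg q := ft q - c *: D q + (c * e (D q)) *: D p0.
have beE v w : al v w + (r w *: D v - r v *: D w) = e (D v) *: sg w - e (D w) *: sg v.
    rewrite al_frame !rE /sg.
    move: (ft v) (ft w) (D v) (D w) (D p0) (e (D v)) (e (D w)) (fs v) (fs w).
    by move=> *; by_coords.
have sgD q : D (sg q) = 0.
  have -> : sg q = ft (q - e (D q) *: p0) - c *: D (q - e (D q) *: p0).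
    have -> : ft (q - e (D q) *: p0) = ft q.
      by rewrite -scaleNr addrC ftP ft_p0 scaler0 add0r.
    by rewrite /sg; by_coords.
  by apply: hc; apply: e_frame.
have sgF f : D f = 0 -> sg f = 0.
  by move=> Df; rewrite /sg Df (linear0 e) mulr0 scaler0 scale0r ft_ker // subr0 addr0.
clearbody sg; split=> [v w|f w Df]; rewrite beE.
  by rewrite linearB !linearZ /= !sgD oppr0 !scaler0 addr0.
by rewrite (sgF f Df) Df (linear0 e) scale0r scaler0 subr0.
Qed.
End Frame.

(** After subtraction of the coboundary of a linear form the cocycle takes values in ker D and
    vanishes on ker D. If D = 0 every r will do, so the conclusion is only stated for D
    nonzero. *)
Lemma normal_form : exists r : 'Hom(V, k^o),
  let be v w := al v w + (r w *: D v - r v *: D w) in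
  (exists v, D v != 0) ->
  (forall v w, D (be v w) = 0) /\ (forall f w, D f = 0 -> be f w = 0).
Proof.
case: (pselect (exists v, D v != 0)) => [[y Dy]|none]; last by exists 0 => be /none.
(* The frame: y - e0 y = D w has the same image under D as y, and w0 = w, e = e1 o (1 - e0)
   for a form e1 with e1 (D y) = 1. *)
have [e1 e1y] := functional1 Dy; have [w yw] := e0_im y.
have [] := @lin_hom_ex k V (fun v => e1 (v - e0 v)).
  by move=> c u v; rewrite !linearB !linearP /= /GRing.scale /=; ring.
move=> e eE.
have eker f : D f = 0 -> e f = 0.
  by move=> Df; rewrite eE (e0_fix Df) subrr linear0.
have ep : e (D (D w)) = 1 by rewrite -yw linearB /= e0_ker subr0 eE e0D subr0.
by have [r hr] := frame_normal eker ep; exists r => be _; apply: hr.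
Qed.

(** A normalized cochain be is an alternating map on V / ker D, identified with the image of
    D, with values in ker D. *)
Section Support.
Variable be : V -> V -> V.
Hypothesis beP : forall c u v w, be (c *: u + v) w = c *: be u w + be v w.
Hypothesis beA : forall v, be v v = 0.
Hypothesis be_anti : forall u v, be u v = - be v u.
Hypothesis be_im : forall v w, D (be v w) = 0.
Hypothesis be_ker : forall f w, D f = 0 -> be f w = 0.

Lemma be_dep u v c : D u = c *: D v -> be u v = 0.
Proof.
move=> e; rewrite -[u](subrK (c *: v)) addrC beP beA scaler0 add0r.
by apply: be_ker; rewrite linearB linearZ /= e subrr.
Qed.

(** There are no alternating forms on a line. *)
Lemma support_codim1 : (\dim (limg D) <= 1)%N -> forall u v, be u v = 0.
Proof.
move=> d1 u v; have [Dv|Dv] := eqVneq (D v) 0; first by rewrite be_anti be_ker ?oppr0.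
have le : (<[D v]> <= limg D)%VS by rewrite -memvE memv_img ?memvf.
have eq : <[D v]>%VS = limg D by apply/eqP; rewrite eqEdim le dim_vline Dv.
have /vlineP [c e] : D u \in <[D v]>%VS by rewrite eq memv_img ?memvf.
exact: be_dep e.
Qed.

(** Contract the cocycle identity at u, v, w with a form that vanishes at Du, Dv but not at
    Dw, and project to ker D along the image of D: only the term with be(u, v) remains. *)
Lemma support_codim3 : (2 < \dim (limg D))%N ->
    (forall (e : 'Hom(V, k^o)) u v w,
      cyc3 (fun a b c => e (be a b) *: D c + e (D c) *: be a b) u v w = 0) ->
  forall u v, be u v = 0.
Proof.
move=> d3 bcoc u v.
have [Dv|Dv] := eqVneq (D v) 0; first by rewrite be_anti be_ker ?oppr0.
case: (boolP (D u \in <[D v]>%VS)) => [/vlineP [c e]|Du]; first exact: be_dep e.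
have [w Dw] : exists w, D w \notin (<[D u]> + <[D v]>)%VS.
  apply: contrapT => none; move: d3; rewrite ltnNge => /negP; apply.
  apply: (@leq_trans (\dim (<[D u]> + <[D v]>))).
    apply: dimvS; apply/subvP => _ /memv_imgP [w _ ->].
    by apply/negP => /negP h; apply: none; exists w.
  by apply: leq_trans (dimv_add_leqif _ _) _; rewrite !dim_vline; case: (_ != 0); case: (_ != 0).
have [e [eU ew]] := functional_ex Dw.
have eu : e (D u) = 0 by apply: eU; apply: subvP (addvSl _ _) _ (memv_line _).
have ev : e (D v) = 0 by apply: eU; apply: subvP (addvSr _ _) _ (memv_line _).
have := congr1 e0 (bcoc e u v w); rewrite linear0 /cyc3 !linearD !linearZ /= !e0D.
by rewrite !scaler0 !add0r eu ev ew !scale0r !addr0 scale1r e0_fix.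
Qed.
End Support.
End NormalForm.

(** * Cochains in H^2 *)

(** The bilinear map t, biadditive and balanced over k, stands for the tensor product of
    V with itself. *)
Section TensorCocycle.
Context (k : fieldType) (V : vectType k) (M : zmodType).
Variables (D : 'End(V)) (be : V -> V -> V) (t : V -> V -> M).
Hypothesis beP : forall c u v w, be (c *: u + v) w = c *: be u w + be v w.
Hypothesis be_anti : forall u v, be u v = - be v u.
Hypothesis beA : forall v, be v v = 0.
Hypothesis be_ker : forall f w, D f = 0 -> be f w = 0.
Hypothesis tD : forall u v w, t u (v + w) = t u v + t u w.
Hypothesis tZ : forall c u v, t (c *: u) v = t u (c *: v).
Hypothesis tN : forall u v, t (- u) v = - t u v.

(** The expression is alternating and depends on its arguments modulo ker D only. *)
Lemma tensor_cyc_span a b c : D c \in (<[D a]> + <[D b]>)%VS ->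
  cyc3 (fun u v w => t (be u v) (D w)) a b c = 0.
Proof.
case/memv_addP => _ /vlineP [x ->] [_ /vlineP [y ->] e].
have kc : D (c - (x *: a + y *: b)) = 0.
  by rewrite linearB linearD !linearZ /= e subrr.
have bc w : be c w = x *: be a w + y *: be b w.
  rewrite -[c](subrK (x *: a + y *: b)) -[c - _]scale1r beP be_ker // scaler0 add0r.
  have b0 : be 0 w = 0 by apply: be_ker; rewrite linear0.
  by rewrite beP -[y *: b]addr0 beP b0 addr0.
have e1 : be b c = - (x *: be a b) by rewrite be_anti bc beA scaler0 addr0.
have e2 : be c a = - (y *: be a b) by rewrite bc beA scaler0 add0r be_anti scalerN.
by rewrite /cyc3 e1 e2 !tN !tZ e tD -addrA -opprD subrr.
Qed.

Lemma cyc3_rot (f : V -> V -> V -> M) a b c : cyc3 f a b c = cyc3 f b c a.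
Proof. by rewrite /cyc3 -[LHS]addrA addrC. Qed.

(** Three vectors of a space of dimension at most 2 are dependent. *)
Lemma tensor_cyc0 a b c : (\dim (limg D) <= 2)%N ->
  cyc3 (fun u v w => t (be u v) (D w)) a b c = 0.
Proof.
move=> d2; case: (boolP (D a \in <[D b]>%VS)) => [Da|Da].
  by rewrite cyc3_rot; apply: tensor_cyc_span; apply: subvP (addvSl _ _) _ Da.
have [Db|Db] := eqVneq (D b) 0.
  by rewrite 2!cyc3_rot; apply: tensor_cyc_span; rewrite Db mem0v.
apply: tensor_cyc_span.
have -> : (<[D a]> + <[D b]>)%VS = limg D; last by rewrite memv_img ?memvf.
apply/eqP; rewrite eqEdim; apply/andP; split.
  by apply/subvP => _ /memv_addP [u /vlineP [x ->] [v /vlineP [y ->] ->]];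
    rewrite rpredD // rpredZ // memv_img ?memvf.
apply: leq_trans d2 _; rewrite addvC.
have <- : \dim <[D b]> = 1%N by rewrite dim_vline Db.
rewrite ltnNge; apply: contra Da => le.
have /eqP -> : (<[D b]> == <[D b]> + <[D a]>)%VS by rewrite eqEdim addvSl.
by apply: subvP (addvSr _ _) _ (memv_line _).
Qed.
End TensorCocycle.

Section Projection.
Context (k : fieldType) (gT : finGroupType) (V : vectType k).
Variable rho : linrep gT V.
Hypothesis card_unit : (#|[set: gT]|%:R : k) \is a GRing.unit.
Local Notation N := #|[set: gT]|.

Definition delta g : 'End(V) := (rho g - \1)%VF.

Lemma deltaE g v : delta g v = rho g v - v.
Proof. by rewrite /delta !lfunE /= !lfunE /= lfunE. Qed.

(** The projection onto V^g along the image of g - 1, by averaging over the powers of g. The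
    number of powers is the order of G, which is invertible in k, rather than that of g. *)
Definition fixproj g : 'End(V) := (N%:R^-1 *: \sum_(i < N) rho (g ^+ i)%g)%VF.

Lemma fixprojE g v : fixproj g v = N%:R^-1 *: \sum_(i < N) rho (g ^+ i)%g v.
Proof. by rewrite /fixproj lfunE /= sum_lfunE. Qed.

Lemma cyc_sum g v : \sum_(i < N) rho (g ^+ i.+1)%g v = \sum_(i < N) rho (g ^+ i)%g v.
Proof.
have : (0 < N)%N by apply/card_gt0P; exists 1%g.
move eN: N => [|n] // _; rewrite big_ord_recr [RHS]big_ord_recl /= addrC; congr (_ + _).
by rewrite -eN expg0 (@expg_cardG _ [set: gT]%G) ?inE.
Qed.

Lemma delta_fixproj g v : delta g (fixproj g v) = 0.
Proof.
rewrite deltaE fixprojE linearZ -scalerBr linear_sum; apply/eqP; rewrite scaler_eq0 subr_eq0.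
apply/orP; right; rewrite -cyc_sum; apply/eqP; apply: eq_bigr => i _.
by rewrite expgS rhoM.
Qed.

Lemma fixproj_delta g v : fixproj g (delta g v) = 0.
Proof.
rewrite deltaE linearB /= !fixprojE -scalerBr; apply/eqP; rewrite scaler_eq0 subr_eq0.
apply/orP; right; rewrite -(cyc_sum g v); apply/eqP; apply: eq_bigr => i _.
by rewrite expgSr rhoM.
Qed.

Lemma fixproj_fix g v : delta g v = 0 -> fixproj g v = v.
Proof.
rewrite deltaE => /eqP; rewrite subr_eq0 => /eqP gv; rewrite fixprojE.
rewrite (eq_bigr (fun=> v)) => [|i _]; last first.
  by elim: (nat_of_ord i) => [|m IH]; rewrite ?expg0 ?rho1 // expgS rhoM IH.
rewrite sumr_const card_ord -scaler_nat scalerA mulVr ?scale1r //.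
Qed.

Lemma fixproj_im g v : exists w, v - fixproj g v = delta g w.
Proof.
suff /memv_imgP [w _ ->] : v - fixproj g v \in limg (delta g) by exists w.
have -> : v - fixproj g v = N%:R^-1 *: \sum_(i < N) (v - rho (g ^+ i)%g v).
  rewrite sumrB sumr_const card_ord scalerBr -fixprojE; congr (_ - _).
  by rewrite -scaler_nat scalerA mulVr ?scale1r.
apply: rpredZ; apply: rpred_sum => i _; elim: (nat_of_ord i) => [|m IH].
  by rewrite expg0 rho1 subrr mem0v.
rewrite -[X in X \in _](subrKA (rho (g ^+ m)%g v)); apply: rpredD => //.
by rewrite expgS rhoM -opprB rpredN -deltaE memv_img ?memvf.
Qed.

Lemma delta_ker g v : (delta g v == 0) = (v \in Vfix rho g).
Proof. by rewrite deltaE subr_eq0; apply/eqP/fixedSpaceP. Qed.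

Lemma lker_delta g : lker (delta g) = Vfix rho g.
Proof. by apply/vspaceP => v; rewrite memv_ker delta_ker. Qed.

Lemma dim_limg_delta g : \dim (limg (delta g)) = codim rho g.
Proof.
have := limg_ker_dim (delta g) fullv; rewrite capfv lker_delta /codim => <-.
by rewrite addKn.
Qed.
End Projection.

Section InH.
Context (k : fieldType) (gT : finGroupType) (V : vectType k).
Variable rho : linrep gT V.
Hypothesis card_unit : (#|[set: gT]|%:R : k) \is a GRing.unit.
Hypothesis two : 2%:R != 0 :> k.
Variable kappa : {bilinear V -> V -> target gT V}.
Hypothesis kalt : alternating kappa.
Local Notation klin := (@klin k gT V kappa).
Local Notation delta := (@delta k gT V rho).
Local Notation fixproj := (@fixproj k gT V rho).
Local Notation I := 'I_(\dim {:V}).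
Local Notation e_ i := ((vbasis {:V})`_i).

Lemma cochain_lin_coef (v : {ffun 'I_2 -> V}) g :
  skew_coef (cochain_of rho (lin_part kappa) v) g = symX (klin (v 0) (v 1) g).
Proof. by rewrite [LHS]ffunE target_coef_lin kV_Sym_lin. Qed.

Lemma wedge2 (f : 'I_2 -> 'Hom(V, k^o)) (v : {ffun 'I_2 -> V}) :
  wedge f v = f 0 (v 0) * f 1 (v 1) - f 0 (v 1) * f 1 (v 0).
Proof.
rewrite /wedge (expand_det_row _ 0) !big_ord_recl big_ord0 addr0 /cofactor !det_mx11 !mxE /=.
rewrite expr0 expr1 mul1r mulN1r mulrN.
have -> : lift (0 : 'I_2) 0 = 1 by apply: val_inj.
have -> : lift (1 : 'I_2) 0 = 0 by apply: val_inj.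
by [].
Qed.

Lemma delta0_codim g v : codim rho g = 0%N -> delta g v = 0.
Proof.
rewrite -dim_limg_delta => /eqP; rewrite dimv_eq0 => /eqP l0.
by apply/eqP; rewrite -memv0 -l0 memv_img ?memvf.
Qed.

Lemma codim0_delta g : (forall v, delta g v = 0) -> codim rho g = 0%N.
Proof.
move=> d0; rewrite -dim_limg_delta; apply/eqP; rewrite dimv_eq0 -subv0.
by apply/subvP => _ /memv_imgP [v _ ->]; rewrite d0 mem0v.
Qed.

Lemma klin_basis u v g : klin u v g =
  \sum_(i : I) \sum_(j : I)
    (coord (vbasis {:V}) i u * coord (vbasis {:V}) j v) *: klin (e_ i) (e_ j) g.
Proof.
have suml (r : seq I) (c : I -> k) (x : I -> V) w :
    klin (\sum_(i <- r) c i *: x i) w g = \sum_(i <- r) c i *: klin (x i) w g.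
  elim: r => [|i r IH]; last by rewrite !big_cons klinPl IH.
  rewrite !big_nil; have := klinPl kappa (-1) 0 0 w g.
  by rewrite scaler0 addr0 scaleN1r addNr.
rewrite [in LHS](coord_vbasis (memvf u)) suml; apply: eq_bigr => i _.
rewrite klin_anti // [in LHS](coord_vbasis (memvf v)) suml -sumrN scaler_sumr.
by apply: eq_bigr => j _; rewrite -scalerN -(klin_anti kalt) scalerA.
Qed.

Section Expansion.
Variables (g : gT) (p : V -> V) (x : I -> 'Hom(V, k^o)).
Hypothesis xE : forall i v, x i v = coord (vbasis {:V}) i (p v).
Hypothesis klin_p : forall u v, klin (p u) (p v) g = klin u v g.
Hypothesis klin_fix : forall u v, klin u v g \in Vfix rho g.

Local Notation J := ('I_(\dim {:V}) * 'I_(\dim {:V}))%type.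

(** A cochain that only depends on the projections p(v) is a combination of products of two
    coordinate forms composed with p, indexed by the pairs of basis vectors. *)
Definition expansion_form (r : 'I_#|{: J}|) (t : 'I_2) : 'Hom(V, k^o) :=
  if t == 0 then x (enum_val r).1 else x (enum_val r).2.

(** Each unordered pair of basis vectors occurs twice in the sum, hence the factor 1/2. *)
Definition expansion_coef (r : 'I_#|{: J}|) : Defs.Sym (subvs_of (Vfix rho g)) :=
  2%:R^-1 *: symX (vsproj (Vfix rho g) (klin (e_ (enum_val r).1) (e_ (enum_val r).2) g)).

Lemma expansionE (v : {ffun 'I_2 -> V}) : symX (klin (v 0) (v 1) g) =
  \sum_r wedge (expansion_form r) v *: Sym_map (Vfix_incl rho g) (expansion_coef r).
Proof.
have coefE r : Sym_map (Vfix_incl rho g) (expansion_coef r) =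
    2%:R^-1 *: symX (klin (e_ (enum_val r).1) (e_ (enum_val r).2) g).
  rewrite linearZ /= Sym_mapX; congr (_ *: symX _).
  by rewrite /Vfix_incl lfunE /= vsprojK // klin_fix.
have wE r : wedge (expansion_form r) v =
    x (enum_val r).1 (v 0) * x (enum_val r).2 (v 1)
    - x (enum_val r).1 (v 1) * x (enum_val r).2 (v 0).
  by rewrite wedge2 /expansion_form.
pose G (q : J) : Defs.Sym V :=
  (x q.1 (v 0) * x q.2 (v 1) - x q.1 (v 1) * x q.2 (v 0)) *:
  (2%:R^-1 *: symX (klin (e_ q.1) (e_ q.2) g)).
rewrite (eq_bigr (fun r => G (enum_val r))) => [|r _]; last by rewrite coefE wE.
rewrite -(big_enum_val (A := {: J}) G) /=.
have E (a b : V) : \sum_(q : J) (x q.1 a * x q.2 b) *: klin (e_ q.1) (e_ q.2) g = klin a b g.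
  rewrite -(klin_p a b) klin_basis pair_bigA; apply: eq_bigr => q _ /=.
  by rewrite !xE.
have -> : klin (v 0) (v 1) g = 2%:R^-1 *: (klin (v 0) (v 1) g - klin (v 1) (v 0) g).
  rewrite (klin_anti kalt (v 1)) opprK -mulr2n -scaler_nat scalerA mulVf ?scale1r //.
rewrite -!E -sumrB scaler_sumr linear_sum; apply: eq_bigr => q _ /=.
by rewrite /G -scalerBl !scalerA linearZ /= mulrC.
Qed.
End Expansion.

(** In codimension 0 the two forms of a wedge product are arbitrary, in codimension 2 they are
    coordinates composed with the projection along V^g, and elsewhere the cochain is zero. *)
Lemma in_H_normalized :
    (forall g, codim rho g != 0%N -> (forall v w, delta g (klin v w g) = 0) /\
      (forall f w, delta g f = 0 -> klin f w g = 0)) ->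
    (forall g, codim rho g != 0%N -> codim rho g != 2%N -> forall v w, klin v w g = 0) ->
  in_H (cochain_of rho (lin_part kappa)).
Proof.
move=> Q S g; rewrite /in_Hg.
have [c0|c0] := eqVneq (codim rho g) 0%N; last have [c2|c2] := eqVneq (codim rho g) 2%N.
- have d0 v : delta g v = 0 by apply: delta0_codim.
  have /boolp.choice [x xE] : forall i, exists x : 'Hom(V, k^o),
      forall v, x v = coord (vbasis {:V}) i v.
    move=> i; apply: (@lin_hom_ex k V (coord (vbasis {:V}) i)).
    exact: linearP.
  have fix_ u v : klin u v g \in Vfix rho g by rewrite -delta_ker d0.
  rewrite c0 /=; exists _, (@expansion_coef g), (@expansion_form x); split.
  + move=> r i _ v [n [a [u [h ->]]]]; rewrite big1 ?linear0 // => j _.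
    have [aj uj] := h j; have := d0 (u j); rewrite deltaE uj -[X in _ - X]scale1r -scalerBl.
    by move/eqP; rewrite scaler_eq0 subr_eq0 (negPf aj) => /eqP.
  + by move=> r [[|[|i]] hi].
  by move=> v; rewrite cochain_lin_coef; apply: (@expansionE g id).
- have [Q1 Q2] := Q g c0.
  have /boolp.choice [x xE] : forall i, exists x : 'Hom(V, k^o),
      forall v, x v = coord (vbasis {:V}) i (v - fixproj g v).
    move=> i; apply: (@lin_hom_ex k V (fun v => coord (vbasis {:V}) i (v - fixproj g v))).
    by move=> c u v; rewrite !linearB !linearP /= /GRing.scale /=; ring.
  have fix_ u v : klin u v g \in Vfix rho g by rewrite -delta_ker Q1.
  rewrite c2 /=; exists _, (@expansion_coef g), (@expansion_form x); split.
  + by [].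
  + move=> r i _ v; rewrite -delta_ker => /eqP dv.
    have vv : v - fixproj g v = 0 by rewrite (fixproj_fix card_unit dv) subrr.
    by rewrite /expansion_form; case: ifP => _; rewrite xE vv linear0.
  move=> v; rewrite cochain_lin_coef.
  apply: (@expansionE g (fun v => v - fixproj g v)) => // u w.
  have p1 a b : klin (a - fixproj g a) b g = klin a b g.
    rewrite -scaleN1r addrC klinPl Q2 ?scaler0 ?add0r //; exact: delta_fixproj.
  by rewrite p1 klin_anti // p1 -klin_anti.
have z (v : {ffun 'I_2 -> V}) : skew_coef (cochain_of rho (lin_part kappa) v) g = 0.
  by rewrite cochain_lin_coef S // linear0.
case: ifP => _ //; exists 0%N, (fun _ => 0), (fun _ _ => 0); split; try by case.
by move=> v; rewrite z big_ord0.
Qed.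

Hypothesis kinv : forall h v w g, klin (rho h v) (rho h w) (h * g * h^-1)%g = rho h (klin v w g).
Hypothesis kH : in_H (cochain_of rho (lin_part kappa)).

(** If g acts trivially all terms vanish. In codimension 1 or 2, membership in H^2 gives values
    in V^g and vanishing on pairs of vectors of V^g; the invariance under g extends the
    vanishing to a single argument f in V^g, since the other argument is, modulo V^g, of
    the form gz - z, and kappa(gz, f) = g kappa(z, f) = kappa(z, f). Then [tensor_cyc0]
    applies. In larger codimension the cochain is zero. *)
Lemma in_H_tensor (M : zmodType) (t : V -> V -> M) g a b c :
    (forall u v w, t u (v + w) = t u v + t u w) ->
    (forall x u v, t (x *: u) v = t u (x *: v)) ->
    (forall u v, t (- u) v = - t u v) ->
  cyc3 (fun u v w => t (klin u v g) (delta g w)) a b c = 0.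
Proof.
move=> tD tZ tN.
have t0 u : t u 0 = 0 by apply: (addrI (t u 0)); rewrite -tD !addr0.
have t0l u : t 0 u = 0 by have := tZ 0 0 u; rewrite !scale0r t0.
have := kH g; rewrite /in_Hg; case: ifP => [le|_]; last first.
  move=> z; have z' u v : klin u v g = 0.
    apply: (@symX_inj k V); rewrite linear0.
    have := z [ffun i : 'I_2 => if i == 0 then u else v].
    by rewrite cochain_lin_coef !ffunE.
  by rewrite /cyc3 !z' !t0l !addr0.
case=> n [s [f [_ fF fE]]].
have kE u v : symX (klin u v g) = \sum_r (f r 0 u * f r 1 v - f r 0 v * f r 1 u)
    *: Sym_map (Vfix_incl rho g) (s r).
  have := fE [ffun i : 'I_2 => if i == 0 then u else v].
  rewrite cochain_lin_coef !ffunE /= => ->; apply: eq_bigr => r _.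
  by rewrite wedge2 !ffunE.
have [c0|c0] := eqVneq (codim rho g) 0%N.
  by rewrite /cyc3 !(delta0_codim _ c0) !t0 !addr0.
have f1 r v : v \in Vfix rho g -> f r 1 v = 0.
  by apply: fF; rewrite /= leq_subLR addn1 ltnS lt0n.
have fix_ u v : rho g (klin u v g) = klin u v g.
  apply: (@symX_inj k V); rewrite -Sym_mapX kE linear_sum; apply: eq_bigr => r _.
  rewrite linearZ /=; congr (_ *: _).
  apply: (@Sym_ext k _ _ (Sym_map (rho g) \o Sym_map (Vfix_incl rho g))
    (Sym_map (Vfix_incl rho g))).
  move=> u' /=; rewrite !Sym_mapX; congr symX; rewrite /Vfix_incl !lfunE /=.
  exact/fixedSpaceP/subvsP.
(* The last form of each wedge product vanishes on V^g. *)
have kFF v w : v \in Vfix rho g -> w \in Vfix rho g -> klin v w g = 0.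
  move=> vF wF; apply: (@symX_inj k V); rewrite linear0 kE big1 // => r _.
  by rewrite !f1 // !mulr0 subrr scale0r.
have kF v w : delta g v = 0 -> klin v w g = 0.
  move=> dv; have vF : v \in Vfix rho g by rewrite -delta_ker dv.
  have [z wz] := fixproj_im rho card_unit g w.
  have fw : fixproj g w \in Vfix rho g by rewrite -delta_ker delta_fixproj.
  rewrite -[w](subrK (fixproj g w)) wz (klin_anti kalt v) -[delta g z]scale1r klinPl.
  rewrite (kFF _ _ fw vF) scale1r addr0.
  have gv : rho g v = v by apply/fixedSpaceP.
  rewrite deltaE -(scaleN1r z) addrC klinPl scaleN1r.
  have := kinv g z v g; rewrite mulgK gv => ->; rewrite fix_ addNr oppr0.
  by [].
apply: (tensor_cyc0 (D := delta g) (be := fun u v => klin u v g)) => //.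
- by move=> *; apply: klinPl.
- by move=> *; apply: klin_anti.
- by move=> v; rewrite /klin kalt /target_coef ffunE.
by rewrite dim_limg_delta.
Qed.
End InH.

(** * Changes of generators *)

Section FilteredIso.
Context (k : fieldType) (gT : finGroupType) (V : vectType k).
Variable rho : linrep gT V.
Local Notation TG := (TG rho).
Local Notation TG_le := (@TG_le k gT V rho).
Variables (kap1 kap2 : V -> V -> target gT V) (th1 th2 : {linear TG -> TG}).
Local Notation idl kap := (ideal_gen (@relation k gT V rho kap)).
Hypothesis thM1 : {morph th1 : x y / x * y}.
Hypothesis thM2 : {morph th2 : x y / x * y}.
Hypothesis th1_1 : th1 1 = 1.
Hypothesis thK1 : cancel th1 th2.
Hypothesis thK2 : cancel th2 th1.
Hypothesis th_rel1 : forall x, relation kap1 x -> th1 x \in idl kap2.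
Hypothesis th_rel2 : forall x, relation kap2 x -> th2 x \in idl kap1.
Hypothesis th_le1 : forall m x, x \in TG_le m -> th1 x \in TG_le m.
Hypothesis th_le2 : forall m x, x \in TG_le m -> th2 x \in TG_le m.

Lemma hom_ideal (A : algType k) (X Y : A -> Prop) (f : {linear A -> A}) :
    {morph f : x y / x * y} -> (forall x, X x -> f x \in ideal_gen Y) ->
  forall x, x \in ideal_gen X -> f x \in ideal_gen Y.
Proof.
move=> fM fX _ /asboolP [s [Xs ->]]; rewrite linear_sum /= big_seq.
apply: rpred_sum => t /Xs Xt; rewrite !fM; apply: ideal_genMr; apply: ideal_genMl.
exact: fX.
Qed.

Local Notation H1 := (Halg rho kap1).
Local Notation H2 := (Halg rho kap2).
Local Notation pi1 := (@H_pi k gT V rho kap1).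
Local Notation pi2 := (@H_pi k gT V rho kap2).

(** The map between quotients, through representatives since H_kappa is a quotient type. *)
Definition induced (a : H1) : H2 := pi2 (th1 (repr (a : quotmod (idl kap1)))).

Lemma inducedE x : induced (pi1 x) = pi2 (th1 x).
Proof.
apply/H_pi_eq; rewrite -linearB; apply: (hom_ideal thM1 th_rel1).
exact: qm_repr_pi.
Qed.

Lemma induced_is_linear : linear induced.
Proof.
move=> c; elim/qm_ind=> x; elim/qm_ind=> y.
apply: etrans (congr1 induced (esym (qm_pi_linear _ c x y))) _.
apply: etrans (inducedE _) _; rewrite (linearP th1).
apply: etrans (qm_pi_linear _ _ _ _) _; apply: (congr2 (fun u v : H2 => c *: u + v)).
  by apply: esym; apply: inducedE.
by apply: esym; apply: inducedE.
Qed.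

(** Two filtered endomorphisms of T(V) # G, inverse to each other, that exchange the ideals of
    relations induce a filtered isomorphism of the quotients. *)
Lemma change_generators : filtered_iso (Hfilt rho kap1) (Hfilt rho kap2).
Proof.
exists (HB.pack_for {linear H1 -> H2} induced
  (GRing.isLinear.Build k H1 H2 _ induced induced_is_linear)); split.
- exists (fun b : H2 => pi1 (th2 (repr (b : quotmod (idl kap2))))).
    elim/qm_ind=> x; rewrite -[qm_pi _ _]/(pi1 x) /= inducedE; apply/H_pi_eq.
    rewrite -[X in _ - X]thK1 -linearB; apply: (hom_ideal thM2 th_rel2).
    exact: qm_repr_pi.
  elim/qm_ind=> x; rewrite -[qm_pi _ _]/(pi2 x) /= inducedE; apply/H_pi_eq.
  by rewrite thK2; apply: qm_repr_pi.
- by apply: etrans (inducedE 1) _; rewrite th1_1.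
- elim/qm_ind=> x; elim/qm_ind=> y; rewrite /=.
  apply: etrans (congr1 induced (@qa_mulE k TG (@relation k gT V rho kap1) x y)) _.
  apply: etrans (inducedE _) _; rewrite thM1.
  apply: etrans (esym (@qa_mulE k TG (@relation k gT V rho kap2) _ _)) _.
  by apply: (congr2 (@qa_mul k TG (@relation k gT V rho kap2))); apply: esym; apply: inducedE.
move=> m; elim/qm_ind=> x; rewrite -[qm_pi _ _]/(pi1 x) /= inducedE.
apply/asboolP/asboolP => [[y hy /H_pi_eq e]|[y hy /H_pi_eq e]].
  exists (th2 y); first exact: th_le2.
  apply/H_pi_eq; rewrite -[x in X in X \in _]thK1 -linearB.
  exact: (hom_ideal thM2 th_rel2).
exists (th1 y); first exact: th_le1.
by apply/H_pi_eq; rewrite -linearB; apply: (hom_ideal thM1 th_rel1).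
Qed.
End FilteredIso.

Section Shift.
Context (k : fieldType) (gT : finGroupType) (V : vectType k).
Variable rho : linrep gT V.
Local Notation TG := (TG rho).
Local Notation Tg := (skewg (Tens_act rho)).
Local Notation vT := (vTG rho).
Local Notation TG_le := (@TG_le k gT V rho).

Definition kG_part (r : gT -> 'Hom(V, k^o)) (v : V) : TG := \sum_g (r g v : k) *: Tg g.

(** The condition for the substitution v -> v + sum_g r_g(v) g to respect the relations
    h v = (h v) h. *)
Definition equivariant (r : gT -> 'Hom(V, k^o)) : Prop :=
  forall h g v, r (h * g * h^-1)%g (rho h v) = r g v.

Section ShiftMap.
Variable r : gT -> 'Hom(V, k^o).
Hypothesis req : equivariant r.
Local Notation R := (kG_part r).

Lemma kG_part_is_linear : linear R.
Proof.
move=> c u v; rewrite /kG_part scaler_sumr -big_split; apply: eq_bigr => g _ /=.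
by rewrite linearP scalerDl scalerA.
Qed.
HB.instance Definition _ := GRing.isLinear.Build k V TG _ R kG_part_is_linear.

Definition shift_v (v : V) : TG := vT v + R v.
HB.instance Definition _ := GRing.Linear.copy shift_v (vT \+ R).

Lemma Tg_kG h v : Tg h * R v = R (rho h v) * Tg h.
Proof.
rewrite mulr_sumr mulr_suml [RHS](reindex_inj (conjg_inj h^-1%g)) /=.
apply: eq_bigr => g _; rewrite -scalerAr -scalerAl -!skewgM conjgE invgK !mulgA mulgKV.
by rewrite req.
Qed.

Lemma Tg_shift h v : Tg h * shift_v v = shift_v (rho h v) * Tg h.
Proof. by apply: etrans (mulrDr _ _ _) _; rewrite Tg_vT Tg_kG -mulrDl. Qed.

Definition shift : TG -> TG := @TGlift k gT V rho TG shift_v Tg.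
HB.instance Definition _ := GRing.Linear.on shift.

Lemma shiftM x y : shift (x * y) = shift x * shift y.
Proof. by apply: TGliftM; [exact: skewgM | exact: Tg_shift]. Qed.
Lemma shift_vT v : shift (vT v) = shift_v v.
Proof. by apply: TGlift_v; exact: skewU_1. Qed.
Lemma shift_g g : shift (Tg g) = Tg g.
Proof. exact: TGlift_g. Qed.
Lemma shift1 : shift 1 = 1.
Proof. by apply: TGlift1; exact: skewU_1. Qed.

Lemma shiftD x y : shift (x + y) = shift x + shift y.
Proof. exact: linearD. Qed.
Lemma shift_kG r' v : shift (kG_part r' v) = kG_part r' v.
Proof.
by rewrite linear_sum; apply: eq_bigr => g _; rewrite linearZ /= [X in _ *: X]shift_g.
Qed.

Lemma shift_le m x : x \in TG_le m -> shift x \in TG_le m.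
Proof.
move: x; apply: TG_le_ind => [|c x y IHx IHy|s g sm].
- by rewrite linear0 rpred0.
- rewrite (linearP shift); apply: rpredD; last exact: IHy.
  by apply: rpredZ; exact: IHx.
apply: (TG_le_trans sm) => {sm}; elim: s => [|i s IH].
  by rewrite TU_word_nil shift_g; apply: TG_le_g.
rewrite TU_word_cons shiftM; apply: (@TG_leM _ _ _ _ 1) IH.
rewrite shift_vT; apply: rpredD; first exact: TG_le_v.
by apply: rpred_sum => h _; apply: rpredZ; apply: TG_le_trans (TG_le_g _ _).
Qed.
End ShiftMap.

(** The generators g are fixed and the added part lies in kG, so adding the opposite part
    undoes the substitution. *)
Lemma shiftK (r r' : gT -> 'Hom(V, k^o)) : equivariant r -> equivariant r' ->
  (forall g v, r' g v = - r g v) -> cancel (shift r) (shift r').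
Proof.
move=> req req' rN x.
apply: (@TG_ext _ _ _ rho TG (shift r' \o shift r : {linear TG -> TG}) idfun).
- by move=> y z; rewrite /= (shiftM req) (shiftM req').
- by [].
- move=> v; rewrite /= (shift_vT r) shiftD (shift_vT r') shift_kG.
  rewrite /shift_v -addrA -[RHS]addr0; congr (_ + _).
  rewrite /kG_part -big_split big1 // => g _ /=.
  by rewrite -scalerDl rN addNr scale0r.
by move=> g; rewrite /= !shift_g.
Qed.

Section ShiftedParameter.
Variables (kt : {bilinear V -> V -> target gT V}) (r : gT -> 'Hom(V, k^o)).
Hypothesis ktalt : alternating kt.
Hypothesis req : equivariant r.
Local Notation R := (kG_part r).

(** The constant part of the new parameter: it comes from applying the substitution to
    the linear part of kappa, and from the commutator of the two added elements of kG. *)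
Definition shift_cst v w x : k :=
  \sum_g (r (x * g^-1)%g (klin kt v w g) : k)
  - (\sum_g (r g v : k) * r (g^-1 * x)%g w - \sum_g (r g w : k) * r (g^-1 * x)%g v).

(** The coboundary of r, which comes from commutators of vectors with the elements of kG
    added to the generators. *)
Definition shift_lin v w x : V := r x w *: delta rho x v - r x v *: delta rho x w.

Definition shifted v w : target gT V :=
  kt v w + [ffun x => (shift_cst v w x : k^o, shift_lin v w x)].

Lemma shift_cst_anti v w x : shift_cst v w x = - shift_cst w v x.
Proof.
rewrite /shift_cst [RHS]opprB [X in X = _]addrC opprB; congr (_ + _).
rewrite -sumrN; apply: eq_bigr => g _; by rewrite (klin_anti ktalt) linearN.
Qed.

Lemma shift_lin_anti v w x : shift_lin v w x = - shift_lin w v x.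
Proof. by rewrite /shift_lin opprB. Qed.

Lemma shift_cstP c u v w x :
  shift_cst (c *: u + v) w x = c * shift_cst u w x + shift_cst v w x.
Proof.
rewrite /shift_cst; have S (F1 F2 F3 : gT -> k) : (forall g, F1 g = c * F2 g + F3 g) ->
    \sum_g F1 g = c * \sum_g F2 g + \sum_g F3 g.
  by move=> e; rewrite mulr_sumr -big_split; apply: eq_bigr => g _; apply: e.
rewrite (S (fun g => r (x * g^-1)%g (klin kt (c *: u + v) w g) : k)
  (fun g => r (x * g^-1)%g (klin kt u w g) : k)
  (fun g => r (x * g^-1)%g (klin kt v w g) : k)); last first.
  by move=> g; rewrite klinPl linearP.
rewrite (S (fun g => (r g (c *: u + v) : k) * r (g^-1 * x)%g w)
  (fun g => (r g u : k) * r (g^-1 * x)%g w)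
  (fun g => (r g v : k) * r (g^-1 * x)%g w)); last first.
  by move=> g; rewrite linearP mulrDl -mulrA.
rewrite (S (fun g => (r g w : k) * r (g^-1 * x)%g (c *: u + v))
  (fun g => (r g w : k) * r (g^-1 * x)%g u) (fun g => (r g w : k) * r (g^-1 * x)%g v)); last first.
  by move=> g; rewrite linearP mulrDr mulrCA.
by ring.
Qed.

Lemma shift_linP c u v w x :
  shift_lin (c *: u + v) w x = c *: shift_lin u w x + shift_lin v w x.
Proof.
have rP : r x (c *: u + v) = c * r x u + r x v by rewrite linearP.
rewrite /shift_lin rP (linearP (delta rho x)) /=.
move: (delta rho x u) (delta rho x v) (delta rho x w) (r x u) (r x v) (r x w).
by move=> a b d y z t; by_coords.
Qed.

Lemma shifted_linear_l w : linear (shifted^~ w).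
Proof.
move=> c u v; apply/ffunP => x; rewrite -!/(target_coef _ x) target_coefP.
rewrite /shifted !target_coefD linearPl target_coefP ![target_coef [ffun _ => _] _]ffunE.
rewrite shift_cstP shift_linP.
have -> : ((c * shift_cst u w x + shift_cst v w x : k^o), c *: shift_lin u w x + shift_lin v w x) =
   c *: (shift_cst u w x : k^o, shift_lin u w x) + (shift_cst v w x : k^o, shift_lin v w x) by [].
by rewrite scalerDr addrACA.
Qed.

Lemma shifted_anti v w : shifted v w = - shifted w v.
Proof.
rewrite /shifted opprD (kappa_anti ktalt); congr (_ + _); apply/ffunP => x.
by rewrite !ffunE shift_cst_anti shift_lin_anti.
Qed.

Lemma shifted_linear_r v : linear (shifted v).
Proof.
move=> c u w; rewrite shifted_anti shifted_linear_l (shifted_anti v u) (shifted_anti v w).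
by rewrite scalerN opprD.
Qed.

HB.instance Definition _ := bilinear_isBilinear.Build k V V (target gT V) *:%R *:%R shifted
  (conj shifted_linear_l shifted_linear_r).

Definition shifted_bilinear : {bilinear V -> V -> target gT V} := shifted.
End ShiftedParameter.
End Shift.

(** * The parameter after a change of generators *)

(** The relation ab - ba = s under the substitution a -> a + p, b -> b + q, s -> s + t. *)
Lemma shift_commutator (R : pzRingType) (a b p q s t : R) :
  (a + p) * (b + q) - (b + q) * (a + p) - (s + t) =
  a * b - b * a - (s + t - ((a * q - q * a) - (b * p - p * b)) - (p * q - q * p)).
Proof.
rewrite !mulrDl !mulrDr !opprD !opprK !addrA.
by rewrite [LHS](ACl (1*5*9*10*2*7*6*3*4*8)%AC).
Qed.

Lemma sum_commutator (k : comPzRingType) (A : algType k) (J : finType) (a : A)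
    (c : J -> k) (g d d' : J -> A) : (forall j, a * g j - g j * a = - (d j * g j)) ->
    (forall j, d' j = c j *: d j) ->
  a * (\sum_j c j *: g j) - (\sum_j c j *: g j) * a = - \sum_j d' j * g j.
Proof.
move=> e e'; rewrite mulr_sumr mulr_suml -sumrB -sumrN; apply: eq_bigr => j _.
by rewrite -scalerAr -scalerAl -scalerBr e e' scalerN scalerAl.
Qed.

Lemma skew_coef_mul_scalar (k : fieldType) (gT : finGroupType) (A : algType k)
    (act : algact gT A) (x y : Defs.skew act) (c d : gT -> k) z :
    (forall g, skew_coef x g = (c g)%:A) -> (forall g, skew_coef y g = (d g)%:A) ->
  skew_coef (x * y) z = (\sum_g c g * d (g^-1 * z)%g)%:A.
Proof.
move=> ex ey; apply: etrans (skew_mulE x y z) _; rewrite scaler_suml.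
apply: eq_bigr => g _; rewrite ex ey linearZ /= rmorph1.
by rewrite mulr_algl scalerA.
Qed.

Lemma skew_coefB (k : fieldType) (gT : finGroupType) (A : algType k) (act : algact gT A)
    (x y : Defs.skew act) g : skew_coef (x - y) g = skew_coef x g - skew_coef y g.
Proof. exact: (linearB (coefr g)). Qed.

Lemma skew_coef_gsum (k : fieldType) (gT : finGroupType) (A : algType k)
    (act : algact gT A) (c : gT -> k) x :
  skew_coef (\sum_g c g *: skewg act g) x = (c x)%:A.
Proof.
rewrite skew_coef_sum (bigD1 x) //= big1 => [|g gx].
  by rewrite skew_coefZ skewUE eqxx addr0.
by rewrite skew_coefZ skewUE eq_sym (negPf gx) scaler0.
Qed.

Lemma skew_coef_scalar_subr (k : fieldType) (gT : finGroupType) (A : algType k)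
    (act : algact gT A) (x y z : Defs.skew act) g (a b c : k) :
    skew_coef x g = a%:A -> skew_coef y g = b%:A -> skew_coef z g = c%:A ->
  skew_coef (x - (y - z)) g = (a - (b - c))%:A.
Proof. by move=> ex ey ez; rewrite !skew_coefB ex ey ez -!scalerBl. Qed.

Lemma morph_relation (A B : pzRingType) (f : {additive A -> B}) a b t a' b' t' :
    {morph f : x y / x * y} -> f a = a' -> f b = b' -> f t = t' ->
  f (a * b - b * a - t) = a' * b' - b' * a' - t'.
Proof. by move=> fM <- <- <-; rewrite !raddfB !fM. Qed.

Lemma shift_term (k : comPzRingType) (A : algType k) c (g g' v p w : A) :
  g' = g -> w = (v + p) * g -> c *: g' + w = c *: g + v * g + p * g.
Proof. by move=> -> ->; rewrite mulrDl addrA. Qed.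

Lemma sum_oppB (R : pzRingType) (J : finType) (a b c : J -> R) (x y : R) :
    (forall j, c j = a j - b j) -> x = - \sum_j a j -> y = - \sum_j b j ->
  \sum_j c j = - (x - y).
Proof. by move=> e -> ->; rewrite opprB opprK addrC -sumrB; apply: eq_bigr => j _. Qed.

Lemma addr_regroup (M : zmodType) (s t x y u : M) :
  u = t - y + - x -> s + u = s + t - x - y.
Proof. by move=> ->; rewrite -!addrA; congr (_ + (_ + _)); rewrite addrC. Qed.

Section ShiftRel.
Context (k : fieldType) (gT : finGroupType) (V : vectType k).
Variable rho : linrep gT V.
Local Notation TG := (TG rho).
Local Notation Tg := (skewg (Tens_act rho)).
Local Notation vT := (vTG rho).
Local Notation tT := (@target_TG k gT V rho).
Variables (kt : {bilinear V -> V -> target gT V}) (r : gT -> 'Hom(V, k^o)).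
Hypothesis ktalt : alternating kt.
Hypothesis req : equivariant rho r.
Local Notation R := (kG_part rho r).
Local Notation sh := (@shift k gT V rho r).
Local Notation ks := (shifted_bilinear rho r ktalt).

Lemma vT_commutator v g : vT v * Tg g - Tg g * vT v = - (vT (delta rho g v) * Tg g).
Proof.
by rewrite Tg_vT deltaE vT_B mulrBl opprB.
Qed.

Lemma kG_commutator v w : vT v * R w - R w * vT v =
  - \sum_g vT (r g w *: delta rho g v) * Tg g.
Proof.
apply: (@sum_commutator k TG gT (vT v) (fun g => r g w : k) (fun g => Tg g)
  (fun g => vT (delta rho g v)) (fun g => vT (r g w *: delta rho g v))) => g.
  exact: vT_commutator.
exact: linearZ_LR.
Qed.

Lemma kG_coef v x : skew_coef (R v) x = (r x v : k)%:A.
Proof. exact: (skew_coef_gsum (Tens_act rho) (fun g => r g v : k)). Qed.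

Lemma kG_mul_coef v w x : skew_coef (R v * R w) x =
  (\sum_g (r g v : k) * r (g^-1 * x)%g w)%:A.
Proof.
exact: (skew_coef_mul_scalar x (kG_coef v) (kG_coef w)).
Qed.

Lemma shift_target u : sh (tT u) = tT u + \sum_g R (target_coef u g).2 * Tg g.
Proof.
rewrite target_TG_sum linear_sum -big_split; apply: eq_bigr => g _.
apply: etrans (linearP sh _ _ _) _; apply: (@shift_term k TG).
  exact: shift_g.
by apply: etrans (shiftM req _ _) _; rewrite shift_vT shift_g.
Qed.

Lemma kG_target_coef v w x :
  skew_coef (\sum_g R (klin kt v w g) * Tg g) x =
  (\sum_g (r (x * g^-1)%g (klin kt v w g) : k))%:A.
Proof.
rewrite skew_coef_sum scaler_suml; apply: eq_bigr => g _.
by rewrite skew_coef_mulg kG_coef.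
Qed.

Lemma shift_cst_TG v w : \sum_x shift_cst kt r v w x *: Tg x =
  \sum_g R (klin kt v w g) * Tg g - (R v * R w - R w * R v).
Proof.
apply/skewP => x; apply: etrans (skew_coef_gsum _ _ _) _; apply: esym.
apply: skew_coef_scalar_subr; first exact: kG_target_coef.
  exact: kG_mul_coef.
exact: kG_mul_coef.
Qed.

Lemma shift_lin_TG v w : \sum_x vT (shift_lin rho r v w x) * Tg x =
  - ((vT v * R w - R w * vT v) - (vT w * R v - R v * vT w)).
Proof.
apply: (sum_oppB _ (kG_commutator v w) (kG_commutator w v)) => g.
by rewrite /shift_lin vT_B mulrBl.
Qed.

Lemma shifted_TG v w : tT (ks v w) =
  tT (kt v w) + \sum_g R (klin kt v w g) * Tg g
  - ((vT v * R w - R w * vT v) - (vT w * R v - R v * vT w)) - (R v * R w - R w * R v).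
Proof.
apply: etrans (linearD tT (kt v w) _) _; apply: (@addr_regroup TG).
apply: etrans (congr2 +%R (shift_cst_TG v w) (shift_lin_TG v w)).
apply: etrans (target_TG_sum rho _) _; apply: etrans _ (big_split _ _ _ _ _) => /=.
by apply: eq_bigr => x _; rewrite /target_coef ffunE.
Qed.

(** The substitution carries the relations of kt to those of the shifted parameter, which was
    defined by solving this requirement. *)
Lemma shift_krel v w : sh (krel rho kt v w) = krel rho ks v w.
Proof.
have h : sh (krel rho kt v w) = _ := morph_relation (shiftM req)
  (shift_vT rho r v) (shift_vT rho r w) (shift_target (kt v w)).
apply: etrans h _.
apply: etrans (shift_commutator _ _ _ _ _ _) _.
exact: (congr1 (fun x : TG => _ - x) (esym (shifted_TG v w))).
Qed.

(** Antisymmetry suffices as the characteristic is not 2. *)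
Lemma shifted_alternating : (2%:R != 0 :> k) -> alternating ks.
Proof.
move=> two v; apply/eqP; suff : 2%:R *: ks v v == 0.
  by rewrite scaler_eq0 (negPf two).
by rewrite scaler_nat mulr2n {1}[ks v v](shifted_anti rho r ktalt) addNr.
Qed.

Lemma oppr_equivariant : equivariant rho (fun g => (- r g)%VF).
Proof. by move=> h g v; rewrite !opp_lfunE req. Qed.

Lemma shifted_iso : filtered_iso (Hfilt rho kt) (Hfilt rho ks).
Proof.
have opp_r g v : (- r g)%VF v = - r g v by rewrite opp_lfunE.
have opp_r' g v : r g v = - (- r g)%VF v by rewrite opp_lfunE opprK.
have K1 := shiftK req oppr_equivariant opp_r.
have K2 := shiftK oppr_equivariant req opp_r'.
apply: (@change_generators k gT V rho kt ks sh
  (@shift k gT V rho (fun g => - r g)%VF)).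
- exact: shiftM.
- exact: (shiftM oppr_equivariant).
- exact: shift1.
- exact: K1.
- exact: K2.
- move=> _ [v [w ->]]; 
  have h : sh (krel rho kt v w) \in ideal_gen (@relation k gT V rho ks).
    by rewrite shift_krel; exact: krel_ideal.
  exact: h.
- move=> _ [v [w ->]]; 
  have h : @shift k gT V rho (fun g => - r g)%VF (krel rho ks v w)
      \in ideal_gen (@relation k gT V rho kt).
    by rewrite -shift_krel K1; exact: krel_ideal.
  exact: h.
- by move=> m x; apply: shift_le.
by move=> m x; apply: (shift_le oppr_equivariant).
Qed.
End ShiftRel.

(** * Contracting quadratic identities *)

Section Contraction.
Context (k : fieldType) (V : vectType k).
Local Notation SV := (Defs.Sym V).

(** The derivation of S(V) that extends the linear form e. On the symmetric square it is the
    contraction with e. *)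
Definition contract (e : 'Hom(V, k^o)) (x : SV) : SV :=
  \sum_(i < \dim {:V}) (e (vbasis {:V})`_i : k) *: mderiv i x.

Lemma contractD e x y : contract e (x + y) = contract e x + contract e y.
Proof.
by rewrite -big_split; apply: eq_bigr => i _; rewrite mderivD scalerDr.
Qed.

Lemma contractM e x y : contract e (x * y) = contract e x * y + x * contract e y.
Proof.
rewrite mulr_suml mulr_sumr -big_split; apply: eq_bigr => i _.
by rewrite mderivM scalerDr scalerAl scalerAr.
Qed.

Lemma contract_symX e v : contract e (symX v) = (e v : k)%:A.
Proof.
have E (i : 'I_(\dim {:V})) : mderiv i (symX v) = (coord (vbasis {:V}) i v)%:A.
  rewrite /symX raddf_sum (bigD1 i) //= mderivZ mderivX big1 => [|j ji].
    have -> : (U_(i) - U_(i) = 0)%MM by apply/mnmP => j; rewrite mnmBE subnn mnm0E.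
    by rewrite mpolyX0 mnm1E eqxx scale1r addr0.
  by rewrite mderivZ mderivX mnm1E (negPf ji) scale0r scaler0.
rewrite /contract; under eq_bigr do rewrite E scalerA.
rewrite -scaler_suml {2}(coord_vbasis (memvf v)) linear_sum; congr (_ *: _).
by apply: eq_bigr => i _; rewrite linearZ mulrC.
Qed.

Lemma contract_cyc (e : 'Hom(V, k^o)) a1 b1 a2 b2 a3 b3 :
    symX a1 * symX b1 + symX a2 * symX b2 + symX a3 * symX b3 = 0 :> SV ->
  (e a1 *: b1 + e b1 *: a1) + (e a2 *: b2 + e b2 *: a2) + (e a3 *: b3 + e b3 *: a3) = 0.
Proof.
have E a b : contract e (symX a * symX b) = symX ((e a : k) *: b + (e b : k) *: a).
  by rewrite contractM !contract_symX linearD !linearZ /= mulr_algl mulr_algr.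
move=> /(congr1 (contract e)); rewrite !contractD !E -!linearD => h.
apply: (@symX_inj k V); rewrite h linear0 /contract big1 // => i _.
by rewrite raddf0 scaler0.
Qed.
End Contraction.

(** * Averaging over the group *)

Section Average.
Context (k : fieldType) (gT : finGroupType) (V : vectType k).
Variable rho : linrep gT V.
Hypothesis card_unit : (#|[set: gT]|%:R : k) \is a GRing.unit.
Local Notation N := #|[set: gT]|.
Local Notation delta := (@delta k gT V rho).

Lemma delta_conj g h v : delta g (rho h v) = rho h (delta (g ^ h)%g v).
Proof.
by rewrite !deltaE linearB /= -!rhoM -conjgC.
Qed.

(** The average of r over the conjugation action of G on families of linear forms. *)
Definition average (r : gT -> 'Hom(V, k^o)) (g : gT) : 'Hom(V, k^o) :=
  (N%:R^-1 *: \sum_h (r (g ^ h)%g \o rho h^-1%g))%VF.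

Lemma averageE r g v : average r g v = N%:R^-1 * \sum_h (r (g ^ h)%g (rho h^-1%g v) : k).
Proof.
rewrite /average scale_lfunE sum_lfunE; congr (_ * _).
by apply: eq_bigr => h _; rewrite comp_lfunE.
Qed.

Lemma average_equivariant r : equivariant rho (average r).
Proof.
move=> h g v; rewrite !averageE; congr (_ * _).
rewrite (reindex_inj (mulgI h)); apply: eq_bigr => x _.
rewrite -rhoM invMg mulgKV conjgM; congr (r (_ ^ _)%g _).
by rewrite conjgE !mulgA mulVg mul1g mulgKV.
Qed.

Lemma average_const (u : V) : N%:R^-1 *: \sum_(h : gT) u = u.
Proof. by rewrite sumr_const -scaler_nat scalerA -cardsT mulVr ?scale1r. Qed.

Variables (al : V -> V -> gT -> V) (r : gT -> 'Hom(V, k^o)).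
Hypothesis al_equiv : forall h v w g, al (rho h v) (rho h w) (h * g * h^-1)%g = rho h (al v w g).

(** For an equivariant cochain, the correction by the averaged forms is the average of the
    conjugates of the corrected cochain. *)
Lemma average_cochain v w g :
  al v w g + (average r g w *: delta g v - average r g v *: delta g w) =
  N%:R^-1 *: \sum_h rho h (
    al (rho h^-1%g v) (rho h^-1%g w) (g ^ h)%g +
    (r (g ^ h)%g (rho h^-1%g w) *: delta (g ^ h)%g (rho h^-1%g v)
     - r (g ^ h)%g (rho h^-1%g v) *: delta (g ^ h)%g (rho h^-1%g w))).
Proof.
have A : N%:R^-1 *: \sum_h rho h (al (rho h^-1%g v) (rho h^-1%g w) (g ^ h)%g) = al v w g.
  rewrite -[RHS]average_const; congr (_ *: _); apply: eq_bigr => h _.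
  by rewrite -al_equiv !rhoVK -conjgC mulgK.
have B u1 u2 : average r g u1 *: delta g u2 =
    N%:R^-1 *: \sum_h rho h (r (g ^ h)%g (rho h^-1%g u1) *: delta (g ^ h)%g (rho h^-1%g u2)).
  rewrite averageE -scalerA scaler_suml; congr (_ *: _); apply: eq_bigr => h _.
  by rewrite linearZ /= -delta_conj rhoVK.
rewrite -A !B -scalerBr -scalerDr -sumrB -big_split; congr (_ *: _).
by apply: eq_bigr => h _; rewrite !(linearB, linearD).
Qed.

(** For a linear cocycle this means lying in the g-part of H^2, which contains all linear
    cochains at g when g acts trivially. *)
Definition normalized (be : V -> V -> V) g := (exists v, delta g v != 0) ->
  (forall v w, delta g (be v w) = 0) /\ (forall f w, delta g f = 0 -> be f w = 0).

(** Conjugation by h carries V^(h^-1 g h) to V^g, so each term of the average in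
    [average_cochain] is normalized. *)
Lemma average_normalized :
    (forall g, normalized (fun v w => al v w g +
      (r g w *: delta g v - r g v *: delta g w)) g) ->
  forall g, normalized (fun v w => al v w g +
      (average r g w *: delta g v - average r g v *: delta g w)) g.
Proof.
move=> nr g [v0 dv0].
have nrh h : (forall v w, delta (g ^ h)%g (al v w (g ^ h)%g +
      (r (g ^ h)%g w *: delta (g ^ h)%g v - r (g ^ h)%g v *: delta (g ^ h)%g w)) = 0)
   /\ (forall f w, delta (g ^ h)%g f = 0 -> al f w (g ^ h)%g +
      (r (g ^ h)%g w *: delta (g ^ h)%g f - r (g ^ h)%g f *: delta (g ^ h)%g w) = 0).
  apply: nr; exists (rho h^-1%g v0); apply: contraNneq dv0 => z.
  by rewrite -[v0](rhoVK rho h) delta_conj z linear0.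
split=> [v w|f w df]; rewrite average_cochain.
  rewrite linearZ linear_sum big1 => [|h _]; first exact: scaler0.
  by apply: etrans (delta_conj _ _ _) _; rewrite (nrh h).1 linear0.
rewrite big1 ?scaler0 // => h _; rewrite (nrh h).2 ?linear0 //.
have : rho h (delta (g ^ h)%g (rho h^-1%g f)) = 0 by rewrite -delta_conj rhoVK.
by move/(congr1 (rho h^-1%g)); rewrite rhoK linear0.
Qed.
End Average.

(** * The two implications *)

Lemma addr_eq00 (M : zmodType) (x y : M) : x = 0 -> y = 0 -> x + y = 0.
Proof. by move=> -> ->; rewrite addr0. Qed.

Section Main.
Context (k : fieldType) (gT : finGroupType) (V : vectType k).
Variable rho : linrep gT V.
Hypothesis char_not2 : 2%N \notin [pchar k].
Hypothesis card_unit : (#|[set: gT]|%:R : k) \is a GRing.unit.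
Local Notation TG := (TG rho).
Local Notation Tg := (skewg (Tens_act rho)).
Local Notation vT := (vTG rho).
Local Notation delta := (@delta k gT V rho).

Lemma two_neq0 : 2%:R != 0 :> k.
Proof. by move: char_not2; rewrite inE. Qed.

Section Equivariant.
Variable kappa : {bilinear V -> V -> target gT V}.
Hypothesis kact : forall h v w, target_act rho h (kappa v w) = kappa (rho h v) (rho h w).

Lemma act_klin h v w g :
  klin kappa (rho h v) (rho h w) (h * g * h^-1)%g = rho h (klin kappa v w g).
Proof.
rewrite /klin -kact [target_coef (target_act _ _ _) _]ffunE /=.
by congr (rho h (target_coef _ _).2); rewrite conjgE !mulgA mulVg mul1g mulgKV.
Qed.

Lemma act_kT h v w : Tg h * kT rho kappa v w = kT rho kappa (rho h v) (rho h w) * Tg h.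
Proof. by rewrite /kT -kact; apply: Tg_target. Qed.

(** Invariance under g itself, at vectors w and f with f fixed by g. *)
Lemma klin_delta g f w : delta g f = 0 ->
  klin kappa (delta g w) f g = delta g (klin kappa w f g).
Proof.
rewrite !deltaE => /eqP; rewrite subr_eq0 => /eqP gf.
rewrite -act_klin gf mulgK -scaleN1r addrC klinPl scaleN1r addrC.
by [].
Qed.

Hypothesis kalt : alternating kappa.

(** [in_H_tensor] for the product of T(V) # G followed by the multiplication by g. *)
Lemma in_H_Jquad : in_H (cochain_of rho (lin_part kappa)) ->
  forall a b c, cyc3 (Jquad rho kappa) a b c = 0.
Proof.
move=> kH a b c; rewrite /cyc3 /Jquad -!big_split big1 // => g _ /=.
have h := @in_H_tensor k gT V rho card_unit kappa kalt act_klin kH TG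
  (fun u v => vT u * vT v * Tg g) g a b c.
rewrite -!deltaE; apply: h => [u v w|x u v|u v].
- by rewrite -mulrDl -mulrDr linearD.
- by rewrite !linearZ /= -!scalerAl -!scalerAr -scalerAl.
by rewrite linearN !mulNr.
Qed.
End Equivariant.

(** The cocycle identity in the symmetric square, contracted with a linear form. *)
Lemma PBW_contraction (kappa : {bilinear V -> V -> target gT V}) :
    PBW rho kappa -> forall g (e : 'Hom(V, k^o)) u v w,
  cyc3 (fun a b c =>
    e (klin kappa a b g) *: delta g c + e (delta g c) *: klin kappa a b g) u v w = 0.
Proof.
move=> pbw g e u v w; rewrite /cyc3; apply: contract_cyc.
by rewrite !deltaE; apply: (PBW_cocycle pbw g u v w).
Qed.

Definition standard_parameter (kappa : {bilinear V -> V -> target gT V}) : Prop :=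
  [/\ G_invariant rho kappa,
      in_H (cochain_of rho (lin_part kappa)),
      (forall v, bracket rho (lin_part kappa) (lin_part kappa) v
                 = dstar (cochain_of rho (const_part kappa)) v *+ 2)
    & (forall v, bracket rho (const_part kappa) (lin_part kappa) v = 0)].

(** By PBW the parameter is invariant and its linear part is a cocycle. Normalization and the
    cocycle identity put the linear part in H^2, hence [Jquad] has vanishing cyclic sum and
    the Jacobi identity reduces to the bracket conditions. *)
Lemma normalized_standard (kappa : {bilinear V -> V -> target gT V}) :
    alternating kappa -> PBW rho kappa ->
    (forall g, normalized rho (fun v w => klin kappa v w g) g) ->
  standard_parameter kappa.
Proof.
move=> kalt pbw nrm; have kact := PBW_act pbw.
have Q g : codim rho g != 0%N -> (forall v w, delta g (klin kappa v w g) = 0) /\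
    (forall f w, delta g f = 0 -> klin kappa f w g = 0).
  move=> c0; apply: nrm; apply: contrapT => none; move/eqP: c0; apply.
  apply: codim0_delta => v; apply/eqP/negP => /negP dv; apply: none; by exists v.
have kH : in_H (cochain_of rho (lin_part kappa)).
  apply: (in_H_normalized card_unit two_neq0 kalt Q) => g c0 c2.
  have [Q1 Q2] := Q g c0.
  have bP c u v w : klin kappa (c *: u + v) w g = c *: klin kappa u w g + klin kappa v w g.
    exact: klinPl.
  have bA v : klin kappa v v g = 0 by rewrite /klin kalt /target_coef ffunE.
  have bN u v : klin kappa u v g = - klin kappa v u g by apply: klin_anti.
  have [small|big] := leqP (\dim (limg (delta g))) 1.
    exact: (@support_codim1 k V (delta g) (fun v w => klin kappa v w g)).
  apply: (@support_codim3 k V (delta g) (fixproj rho g) _ _ (fun v w => klin kappa v w g)) => //.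
  - exact: fixproj_fix.
  - exact: fixproj_delta.
  - by rewrite ltn_neqAle big dim_limg_delta eq_sym c2.
  exact: PBW_contraction.
have [] := (bracket_conditions rho char_not2 kalt).2 => //.
  by move=> a b c; apply: PBW_low => //; apply: in_H_Jquad.
by move=> h1 h2; split => //; apply: PBW_invariant.
Qed.

(** The quadratic part of the Jacobi element vanishes since kappa^L lies in H^2, the
    lower part by the bracket conditions. *)
Lemma standard_PBW (kappa : {bilinear V -> V -> target gT V}) :
  alternating kappa -> standard_parameter kappa -> PBW rho kappa.
Proof.
move=> kalt [ki kH b1 b2].
have kact h v w : target_act rho h (kappa v w) = kappa (rho h v) (rho h w).
  by rewrite -(ki h (rho h v)) !rhoK.
have kq := in_H_Jquad kact kalt kH.
have kb := (bracket_conditions rho char_not2 kalt).1 (conj b1 b2).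
apply: (PBW_sufficient kalt (act_kT kact)) => a b c.
apply: (@addr_eq00 TG); first exact: kq.
have low : cyc3 (Jlow rho kappa) a b c = target_TG rho (cyc3 (Jtarget rho kappa) a b c).
  apply: etrans _ (cyc3_linear (@target_TG k gT V rho) (Jtarget rho kappa) a b c).
  by rewrite /cyc3 !Jlow_target.
apply: etrans low (etrans (congr1 (target_TG rho) (kb a b c)) _).
exact: (linear0 (@target_TG k gT V rho)).
Qed.

(** Choose r_g by [normal_form] for each g separately, then average. *)
Lemma normalizing_shift (kt : {bilinear V -> V -> target gT V}) :
    alternating kt -> PBW rho kt ->
  exists2 r : gT -> 'Hom(V, k^o), equivariant rho r &
    forall g, normalized rho (fun v w => klin kt v w g + shift_lin rho r v w g) g.
Proof.
move=> ktalt pbw; have kact := PBW_act pbw.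
have /boolp.choice [r rN] : forall g, exists r : 'Hom(V, k^o),
    normalized rho (fun v w => klin kt v w g + (r w *: delta g v - r v *: delta g w)) g.
  move=> g; apply: (@normal_form k V two_neq0 (delta g) (fun v w => klin kt v w g) (fixproj rho g)).
  - by move=> c u v w; apply: klinPl.
  - by move=> v; rewrite /klin ktalt /target_coef ffunE.
  - by move=> u v; apply: klin_anti.
  - by move=> w f; apply: klin_delta.
  - exact: PBW_contraction.
  - exact: delta_fixproj.
  - exact: fixproj_fix.
  - exact: fixproj_delta.
  exact: fixproj_im.
exists (average rho r); first exact: average_equivariant.
by apply: (average_normalized card_unit (act_klin kact)).
Qed.
End Main.

Theorem theorem7p2 (k : fieldType) (gT : finGroupType) (V : vectType k)
    (rho : linrep gT V)
    (char_not2 : 2%N \notin [pchar k])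
    (card_unit : (#|[set: gT]|%:R : k) \is a GRing.unit)
    (eigen : contains_eigenvalues rho)
    (kt : {bilinear V -> V -> target gT V})
    (kt_alt : alternating kt) :
  Drinfeld_orbifold rho kt <->
  exists kappa : {bilinear V -> V -> target gT V},
    alternating kappa /\
    filtered_iso (Hfilt rho kt) (Hfilt rho kappa) /\
    [/\ G_invariant rho kappa,
        in_H (cochain_of rho (lin_part kappa)),
        (forall v, bracket rho (lin_part kappa) (lin_part kappa) v
                   = dstar (cochain_of rho (const_part kappa)) v *+ 2)
      & (forall v, bracket rho (const_part kappa) (lin_part kappa) v = 0)].
Proof.
split=> [drinfeld|[kappa [kalt [iso spec]]]]; last first.
  apply: graded_iso_trans (filtered_iso_gr iso) _; apply: PBW_Drinfeld.
  exact: (@standard_PBW k gT V rho char_not2 card_unit kappa kalt spec).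
have pbw := Drinfeld_PBW drinfeld.
have [r req nrm] := normalizing_shift char_not2 card_unit kt_alt pbw.
have iso := shifted_iso kt_alt req.
have kalt : alternating (shifted_bilinear rho r kt_alt).
  exact: (shifted_alternating rho r kt_alt (two_neq0 char_not2)).
exists (shifted_bilinear rho r kt_alt); split=> //; split=> //.
apply: (normalized_standard char_not2 card_unit kalt).
  apply: Drinfeld_PBW; apply: graded_iso_trans drinfeld.
  exact: filtered_iso_gr (filtered_iso_sym iso).
move=> g; have lin v w : klin (shifted_bilinear rho r kt_alt) v w g =
    klin kt v w g + shift_lin rho r v w g.
  by rewrite /klin /= /shifted target_coefD /target_coef [X in (_ + X).2]ffunE.
move=> /nrm [n1 n2]; split=> [v w|f w df]; first by rewrite lin n1.
by rewrite lin n2.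
Qed.
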